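(* A Lorentzian surface in $\mathbb{S}^{m}_s(1)$ has non-harmonic 1-type pseudo-spherical Gauss map if and only if it is congruent to an open part of the image of $$\mathbf{x}(u,v)=\frac{1}{\sqrt{2}}(\cos u,\sin u,\cosh v,\sinh v)$$ in a totally geodesic $\mathbb{S}^3_1(1)\subset\mathbb{S}^{m}_{s}(1)$, or of $$\mathbf{x}(u,v)=(\cosh u\cos v,\cosh u\sin v,\sinh u\cos v,\sinh u\sin v)$$ in a totally geodesic $\mathbb{S}^3_2(1)\subset\mathbb{S}^m_s(1)$.
   Context: $\mathbb{E}^{m}_s$ denotes $\mathbb{R}^m$ with the metric $ds^2=\sum_{i=1}^{m-s}dx_i^2-\sum_{j=m-s+1}^{m}dx_j^2$ and associated inner product $\langle\cdot,\cdot\rangle$. The pseudo-sphere of dimension $m$ and index $s$ is $\mathbb{S}^m_s(1)=\{x\in\mathbb{E}^{m+1}_s \mid \langle x,x\rangle=1\}$ with the induced metric. A surface in $\mathbb{S}^m_s(1)$ is an isometrically immersed 2-dimensional oriented (pseudo-)Riemannian manifold $\mathbf{x}:M\to\mathbb{S}^m_s(1)$, locally identified with its image; it is Lorentzian if its induced metric has index 1. A totally geodesic $\mathbb{S}^3_t(1)\subset\mathbb{S}^m_s(1)$ is the intersection of $\mathbb{S}^m_s(1)$ with a 4-dimensional non-degenerate linear subspace of $\mathbb{E}^{m+1}_s$ of index $t$, identified with $\mathbb{E}^4_t$ (so $\mathbb{S}^3_t(1)\subset\mathbb{E}^4_t$, and the coordinates in the displayed formulas are those of $\mathbb{E}^4_1$,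 respectively $\mathbb{E}^4_2$). Congruent means equal up to an isometry of the ambient pseudo-sphere. Pseudo-spherical Gauss map: $\bigwedge^{3}\mathbb{E}^{m+1}_s$ carries the pseudo-Euclidean inner product determined by $\langle\langle f_{i_1}\wedge f_{i_2}\wedge f_{i_3},\, g_{j_1}\wedge g_{j_2}\wedge g_{j_3}\rangle\rangle=\det(\langle f_{i_\ell},g_{j_k}\rangle)$ and is thereby identified with a pseudo-Euclidean space $\mathbb{E}^N_q$, $N=\binom{m+1}{3}$. The pseudo-spherical Gauss map of $M$ is $\nu:M\to\bigwedge^3\mathbb{E}^{m+1}_s=\mathbb{E}^N_q$, $\nu(p)=\mathbf{x}(p)\wedge e_1\wedge e_2$, where $\{e_1,e_2\}$ is any positively oriented orthonormal basis of $T_pM$ (i.e. $\langle e_i,e_j\rangle=\varepsilon_i\delta_{ij}$, $\varepsilon_i\in\{-1,1\}$). Let $\Delta$ be the Laplacian of $M$ (of its induced Lorentzian metric) acting componentwise, with sign convention $\Delta=-\operatorname{tr}\nabla^2$. The map $\nu$ is of 1-type if $\Delta\nu=\lambda\nu$ for some constant $\lambda\in\mathbb{R}$, and harmonic if $\Delta\nu=0$; non-harmonic 1-type means $\Delta\nu=\lambda\nu$ with $\lambda\neq0$. *)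

(* Defs.v *)
(* MathComp-Analysis, over an arbitrary R : realType. *)
From HB Require Import structures.
From mathcomp Require Import all_boot all_order all_algebra.
From mathcomp Require Import all_classical all_reals all_analysis.

Set Implicit Arguments.
Unset Strict Implicit.
Unset Printing Implicit Defensive.

Import Order.TTheory GRing.Theory Num.Theory.
Import numFieldNormedType.Exports.

Local Open Scope classical_set_scope.
Local Open Scope ring_scope.

Section Smooth.
Variable R : realType.

Definition partial n (a : 'I_n) (f : 'rV[R]_n -> R) : 'rV[R]_n -> R :=
  'D_(delta_mx 0 a) f.

(* C^oo on an open set U: all iterated partial derivatives exist and are
   continuous at every point of U. *)
Definition smooth_on n (U : set 'rV[R]_n) (f : 'rV[R]_n -> R) : Prop :=
  forall l : seq 'I_n, let g := foldr (@partial n) f l in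
  forall q, U q -> {for q, continuous g} /\
    forall a : 'I_n, derivable g q (delta_mx 0 a).

Definition smooth_map_on n k (U : set 'rV[R]_n) (F : 'rV[R]_n -> 'rV[R]_k) :=
  forall j : 'I_k, smooth_on U (fun q => F q 0 j).

End Smooth.

Section PseudoSphere.
Variable R : realType.

(* The scalar product of E^n_s; indices start at 0, and the last s coordinates
   carry the minus sign. *)
Definition scal n (s : nat) (x y : 'rV[R]_n) : R :=
  \sum_(i < n) (if (i < n - s)%N then 1 else -1) * x 0 i * y 0 i.

(* pseudosphere n s has dimension n - 1: S^m_s(1) is pseudosphere m.+1 s. *)
Definition pseudosphere n (s : nat) : set 'rV[R]_n :=
  [set x | scal s x x = 1].

Definition pseudosphere_tangent n (s : nat) (p : 'rV[R]_n) : set 'rV[R]_n :=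
  [set v | scal s p v = 0].

(* Isometries in the sense of pseudo-Riemannian geometry: diffeomorphisms of
   the pseudo-sphere that preserve the induced metric.  Only the values on the
   pseudo-sphere matter; smoothness means that Phi and its inverse Psi extend
   smoothly to an open neighbourhood U of it. *)
Definition pseudosphere_isometry n (s : nat) (Phi : 'rV[R]_n -> 'rV[R]_n) :=
  let S := @pseudosphere n s in
  exists U Psi,
  [/\ open U /\ S `<=` U,
      smooth_map_on U Phi /\ smooth_map_on U Psi,
      forall p, S p -> S (Phi p) /\ S (Psi p),
      forall p, S p -> Psi (Phi p) = p /\ Phi (Psi p) = p &
      forall p v w, S p ->
        pseudosphere_tangent s p v -> pseudosphere_tangent s p w ->
        scal s ('d Phi p v) ('d Phi p w) = scal s v w].

End PseudoSphere.

Section Wedge.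
Variable R : realType.

(* The index triples i1 < i2 < i3. *)
Definition triple n := {t : 3.-tuple 'I_n | sorted ltn (map val t)}.

(* Coordinates of f1 ^ f2 ^ f3 in the basis (E_i1 ^ E_i2 ^ E_i3)_(i1 < i2 < i3)
   of the third exterior power, where E_i is the canonical basis.  This basis
   is orthonormal for the product given by det(<f_i, g_j>), so these are the
   coordinates in E^N_q up to their order. *)
Definition wedge3 n (f1 f2 f3 : 'rV[R]_n) : {ffun triple n -> R} :=
  [ffun t => \det (\matrix_(a < 3, b < 3)
     (tnth [tuple f1; f2; f3] a) 0 (tnth (val t) b))].

Lemma card_triple n : #|{: triple n}| = 'C(n, 3).
Proof.
rewrite card_sig -card_ltn_sorted_tuples cardsE.
by apply: eq_card => t; rewrite !inE.
Qed.

End Wedge.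

(* Connected oriented smooth 2-manifolds, given by an oriented atlas: the chart
   coord i has domain dom i and inverse param i. *)
Record surface (R : realType) := Surface {
  carrier :> topologicalType;
  atlas : Type;
  dom : atlas -> set carrier;
  coord : atlas -> carrier -> 'rV[R]_2;
  param : atlas -> 'rV[R]_2 -> carrier;
  surface_nonempty : [set: carrier] !=set0;
  surface_connected : connected [set: carrier];
  surface_hausdorff : hausdorff_space carrier;
  surface_second_countable : @second_countable carrier;
  dom_open : forall i, open (dom i);
  dom_cover : forall p, exists i, dom i p;
  coord_open : forall i, open (coord i @` dom i);
  coordK : forall i p, dom i p -> param i (coord i p) = p;
  coord_continuous : forall i p, dom i p -> {for p, continuous (coord i)};
  param_continuous : forall i q, (coord i @` dom i) q ->
    {for q, continuous (param i)};
  transition_smooth : forall i j,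
    smooth_map_on (coord i @` (dom i `&` dom j)) (coord j \o param i);
  transition_oriented : forall i j q, (coord i @` (dom i `&` dom j)) q ->
    0 < \det ('J (coord j \o param i) q)
}.

Section SurfaceInPseudoSphere.
Variables (R : realType) (n s : nat) (M : surface R) (x : M -> 'rV[R]_n).

(* The expression of x in the chart i. *)
Definition local (i : atlas M) : 'rV[R]_2 -> 'rV[R]_n := x \o @param R M i.

Definition immersed_in_pseudosphere :=
  [/\ forall p, pseudosphere s (x p),
      forall i, smooth_map_on (@coord R M i @` @dom R M i) (local i) &
      forall i p, dom i p -> injective ('d (local i) (coord i p))].

(* Tangent vectors at p, viewed in E^n_s through the differential of x. *)
Definition tangent (p : M) : set 'rV[R]_n :=
  [set e | exists i a, dom i p /\ e = 'd (local i) (coord i p) a].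

Definition lorentzian := forall p : M, exists e1 e2,
  [/\ tangent p e1, tangent p e2,
      scal s e1 e1 = 1, scal s e2 e2 = -1 & scal s e1 e2 = 0].

Definition oriented_basis (p : M) (e : 'rV[R]_n * 'rV[R]_n) :=
  exists i (a1 a2 : 'rV[R]_2),
  [/\ dom i p, 0 < \det (\matrix_(k < 2) tnth [tuple a1; a2] k),
    e.1 = 'd (local i) (coord i p) a1 & e.2 = 'd (local i) (coord i p) a2].

Definition oriented_orthonormal_basis (p : M) (e : 'rV[R]_n * 'rV[R]_n) :=
  [/\ oriented_basis p e, `|scal s e.1 e.1| = 1, `|scal s e.2 e.2| = 1 &
      scal s e.1 e.2 = 0].

(* The value does not depend on the basis that xget selects. *)
Definition gauss_map (p : M) : {ffun triple n -> R} :=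
  let e := xget (0, 0) (oriented_orthonormal_basis p) in
  wedge3 (x p) e.1 e.2.

Definition metric (i : atlas M) (q : 'rV[R]_2) : 'M[R]_2 :=
  \matrix_(a, b) scal s ('d (local i) q (delta_mx 0 a))
                        ('d (local i) q (delta_mx 0 b)).

(* christoffel i q k a b is Gamma^k_ab, with a factor 1/2 and the inverse
   metric g^kl. *)
Definition christoffel (i : atlas M) (q : 'rV[R]_2) (k a b : 'I_2) : R :=
  2^-1 * \sum_l invmx (metric i q) k l *
    (partial a (fun r => metric i r b l) q
     + partial b (fun r => metric i r a l) q
     - partial l (fun r => metric i r a b) q).

(* Components of the second covariant derivative of f. *)
Definition hessian (f : M -> R) (i : atlas M) (q : 'rV[R]_2) (a b : 'I_2) : R :=
  let F := f \o @param R M i in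
  partial a (partial b F) q - \sum_k christoffel i q k a b * partial k F q.

(* - tr (nabla^2 f) at p, computed in the chart i *)
Definition laplacian (f : M -> R) (i : atlas M) (p : M) : R :=
  - \sum_a \sum_b invmx (metric i (coord i p)) a b * hessian f i (coord i p) a b.

(* The Laplacian of a vector-valued map acts componentwise. *)
Definition laplacian_eigenmap (T : finType) (nu : M -> {ffun T -> R}) (lam : R) :=
  forall i p, dom i p -> forall t : T,
    laplacian (fun r => nu r t) i p = lam * nu p t.

Definition nonharmonic_one_type (T : finType) (nu : M -> {ffun T -> R}) :=
  exists2 lam : R, lam != 0 & laplacian_eigenmap nu lam.

End SurfaceInPseudoSphere.

Section Models.
Variable R : realType.

Definition cosh (v : R) : R := (expR v + expR (- v)) / 2.
Definition sinh (v : R) : R := (expR v - expR (- v)) / 2.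

Definition row4 (a b c d : R) : 'rV[R]_4 := \row_i tnth [tuple a; b; c; d] i.

Definition model1 (u v : R) : 'rV[R]_4 :=
  (Num.sqrt 2)^-1 *: row4 (cos u) (sin u) (cosh v) (sinh v).

Definition model2 (u v : R) : 'rV[R]_4 :=
  row4 (cosh u * cos v) (cosh u * sin v) (sinh u * cos v) (sinh u * sin v).

(* J identifies E^4_t with its row space, which is then a non-degenerate
   4-dimensional subspace of index t in E^n_s; every such subspace arises so. *)
Definition isometric_embedding n (s t : nat) (J : 'M[R]_(4, n)) :=
  forall a b : 'rV[R]_4, scal s (a *m J) (b *m J) = scal t a b.

(* A is congruent in the pseudo-sphere to an open part of the image of sigma,
   where sigma takes values in a totally geodesic S^3_t(1). *)
Definition congruent_to_open_part n (s t : nat) (sigma : R -> R -> 'rV[R]_4)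
    (A : set 'rV[R]_n) :=
  exists (J : 'M[R]_(4, n)) (Phi : 'rV[R]_n -> 'rV[R]_n) (O : set 'rV[R]_n),
  [/\ isometric_embedding s t J, pseudosphere_isometry s Phi, open O &
      Phi @` A = [set sigma w.1 w.2 *m J | w in [set: R * R]] `&` O].

End Models.

(* Main.v *)
From HB Require Import structures.
Require Import Defs.
From mathcomp Require Import all_boot all_order all_algebra.
From mathcomp Require Import all_classical all_reals all_analysis.
From mathcomp Require Import ring lra.

Set Implicit Arguments.
Unset Strict Implicit.
Unset Printing Implicit Defensive.

Import Order.TTheory GRing.Theory Num.Theory.
Import numFieldNormedType.Exports.

Local Open Scope classical_set_scope.
Local Open Scope ring_scope.

(** The proof rests on the fact that both model surfaces are quadrics. In the
4-space of index 1 or 2 let [twist] be the symmetric operator that maps the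
position to the unit normal; it has square 1 or -1, and the two surfaces are given
by [scal a a = 1] and [scal a (twist a) = 0]. An isometric embedding [J] of the
4-space carries them to the sets [quadric b J].

Suppose that the Gauss map is an eigenmap with nonzero eigenvalue. Along a null
frame [l1], [l2] of the tangent planes it is [- X ^ l1 ^ l2]. Contracted with
suitable trivectors, the eigenvalue equation says that the second fundamental form
[II] satisfies [II12 = 0] (the surface is minimal, [sff12_eq0]), that [II11] and
[II22] are proportional ([sff_wedge]), and that the eigenvalue is twice their
product ([sff_eigenvalue]). As it is not zero, [II11] is not null, and a rescaling
of the frame makes [II11] a unit normal [N] and [II22] a constant multiple of it
([exists_cartan_frame]). The equations of Codazzi and Gauss then make the frame
parallel, the metric flat, [II22 = N] or [- N], and [N] parallel in the normal
bundle ([rot_eq0], [flat_eigenvalue], [dN_tangent]). It follows that the projection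
on the span of [X], [l1], [l2], [N] and the operator exchanging [X] and [N] are
constant along the surface, which therefore lies in a quadric near every point
([eigen_quadric]).

The second-order jet of a surface determines the quadric that contains it
([quadric_unique]), so on a connected surface the quadric is the same everywhere
([eigen_quadric_global]). Since the quadric projects injectively on its tangent
planes near a point while the projection of the surface is locally onto
([quadric_image_open]), the surface is open in the quadric, which is parametrized
by the model; for the first model, which covers one of two sheets, connectedness
and a reflection select the sheet.

Conversely, an isometry of the pseudo-sphere extends homogeneously to an isometry
of an open cone in flat space, and is therefore linear near every point
([isometry_locally_linear]). So a surface congruent to a piece of a model lies
locally in a quadric. The twist is traceless and exchanges position and normal,
hence its tangential part is traceless: the surface is minimal, and its position
is an eigenmap with eigenvalue 2 by Beltrami's formula. By duality in the 4-space
the Gauss map is, up to a locally constant sign, a linear image of the normal,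
which is the image of the position under the twist; it has the same eigenvalue
([quadric_gauss_eigen]). *)

(** * Differential calculus in coordinates *)

Section Calculus.
Variable R : realType.
Implicit Types n : nat.

Lemma coord_le_norm n (v : 'rV[R]_n) i : `|v 0 i| <= `|v|.
Proof.
rewrite [leRHS]/Num.Def.normr/= mx_normrE.
exact: (le_bigmax _ (fun ij : 'I_1 * 'I_n => `|v ij.1 ij.2|) (0, i)).
Qed.

Lemma norm_le_coord n (v : 'rV[R]_n) e : 0 <= e -> (forall i, `|v 0 i| <= e) ->
  `|v| <= e.
Proof.
move=> e0 h; rewrite [leLHS]/Num.Def.normr/= mx_normrE.
by apply: bigmax_le => // -[i j] _ /=; rewrite ord1.
Qed.

Lemma ball_rVP n (q z : 'rV[R]_n) d : 0 < d ->
  ball q d z <-> forall i, `|q 0 i - z 0 i| < d.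
Proof.
move=> d0; split=> [[_ h] i|h]; first exact: (h 0 i).
by split=> // i j; rewrite ord1; exact: h.
Qed.

Lemma is_derive_line n (f : 'rV[R]_n -> R) (q v : 'rV[R]_n) (t : R) :
  derivable f (q + t *: v) v ->
  is_derive t (1 : R) (fun s : R => f (q + s *: v)) ('D_v f (q + t *: v)).
Proof.
move=> df.
have E : (fun h : R => h^-1 *: ((f \o shift (q + t *: v)) (h *: v) - f (q + t *: v)))
   = (fun h : R => h^-1 *: (((fun s : R => f (q + s *: v)) \o shift t) (h *: (1 : R)) - f (q + t *: v))).
  apply/funext => h /=; congr (_ *: (f _ - _)).
  rewrite addrC -addrA -scalerDl; congr (_ + _ *: _).
  by rewrite addrC; congr (_ + _); rewrite -[LHS]mulr1.
by split; rewrite /derivable /derive -E.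
Qed.

Lemma MVT_line n (f : 'rV[R]_n -> R) (q v : 'rV[R]_n) (t : R) :
  (forall s, 0 <= s <= 1 -> derivable f (q + (s * t) *: v) v) ->
  exists2 s, 0 <= s <= 1 & f (q + t *: v) - f q = t * 'D_v f (q + (s * t) *: v).
Proof.
move=> df; set g := fun s => f (q + s *: v).
have [->|t0] := eqVneq t 0.
  by exists 0; rewrite ?lexx ?ler01 // scale0r addr0 subrr mul0r.
have df' u : 0 <= u / t <= 1 -> derivable f (q + u *: v) v.
  by move=> /df; rewrite divfK.
have dg u : 0 <= u / t <= 1 -> is_derive u (1 : R) g ('D_v f (q + u *: v)).
  by move=> ut; apply: is_derive_line; exact: df'.
have cg (a b : R) : (forall u, a <= u <= b -> 0 <= u / t <= 1) ->
    {within `[a, b], continuous g}.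
  move=> ab; apply: derivable_within_continuous => u; rewrite in_itv /= => /ab /dg gs.
  exact: ex_derive.
have fin c : 0 <= c / t <= 1 -> f (q + t *: v) - f q = t * 'D_v f (q + c *: v) ->
   exists2 s, 0 <= s <= 1 & f (q + t *: v) - f q = t * 'D_v f (q + (s * t) *: v).
  by exists (c / t) => //; rewrite divfK.
move: t0; rewrite neq_lt => /orP[] t0.
- have h u : t <= u <= 0 -> 0 <= u / t <= 1.
    by rewrite ler_ndivlMr // ler_ndivrMr // mul0r mul1r => /andP[-> ->].
  have [|c] := MVT_segment (ltW t0) _ (cg _ _ h) (df := fun s => 'D_v f (q + s *: v)).
    by move=> s; rewrite in_itv /= => /andP[s0 s1]; apply/dg/h; rewrite !ltW.
  rewrite in_itv /= /g => /h hc; rewrite scale0r addr0 sub0r mulrN => e.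
  by apply: (fin c) => //; apply: oppr_inj; rewrite opprB e mulrC.
- have h u : 0 <= u <= t -> 0 <= u / t <= 1.
    by rewrite ler_pdivlMr // ler_pdivrMr // mul0r mul1r.
  have [|c] := MVT_segment (ltW t0) _ (cg _ _ h) (df := fun s => 'D_v f (q + s *: v)).
    by move=> s; rewrite in_itv /= => /andP[s0 s1]; apply/dg/h; rewrite !ltW.
  rewrite in_itv /= /g => /h hc; rewrite scale0r addr0 subr0 mulrC => e.
  exact: (fin c).
Qed.

(** Telescoping along the coordinates from [a] to [b]: each step moves one
coordinate, so that the mean value theorem applies to it. *)
Lemma partial_increment n (f : 'rV[R]_n -> R) (q : 'rV[R]_n) (d : R) (A : 'I_n -> R) e : 0 < d ->
  (forall (z : 'rV[R]_n) i, ball q d z -> derivable f z (delta_mx 0 i)) ->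
  (forall (z : 'rV[R]_n) i, ball q d z -> `|partial i f z - A i| <= e) ->
  forall a b, ball q d a -> ball q d b ->
  `|f b - f a - \sum_i (b 0 i - a 0 i) * A i| <= n%:R * e * `|b - a|.
Proof.
move=> d0 df dA a b /(ball_rVP _ _ d0) qa /(ball_rVP _ _ d0) qb.
pose z k : 'rV[R]_n := \row_i (if (i < k)%N then b 0 i else a 0 i).
have z0 : z 0%N = a by apply/rowP => i; rewrite mxE.
have zn : z n = b by apply/rowP => i; rewrite mxE ltn_ord.
have zS (k : 'I_n) : z k.+1 = z k + (b 0 k - a 0 k) *: delta_mx 0 k.
  apply/rowP => i; rewrite !mxE eqxx /= ltnS leq_eqVlt -val_eqE /=.
  have [ik|ik] := eqVneq (i : nat) k; last by rewrite /= mulr0 addr0.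
  by rewrite ik ltnn /= mulr1 (val_inj ik : i = k) addrC subrK.
have -> : f b - f a = \sum_(k < n) (f (z k.+1) - f (z k)).
  by rewrite -(big_mkord xpredT (fun k => f (z k.+1) - f (z k)))
             (telescope_sumr (fun k => f (z k))) // z0 zn.
rewrite -sumrB; apply: le_trans (ler_norm_sum _ _ _) _.
have -> : n%:R * e * `|b - a| = \sum_(k < n) e * `|b - a|.
  by rewrite sumr_const card_ord -mulrA mulr_natl.
apply: ler_sum => k _.
have bz s : 0 <= s <= 1 -> ball q d (z k + (s * (b 0 k - a 0 k)) *: delta_mx 0 k).
  move=> /andP[s0 s1]; apply/(ball_rVP _ _ d0) => i; rewrite !mxE eqxx /=.
  have [->|ik] := eqVneq i k; last first.
    by rewrite mulr0 addr0; case: ifP => _; [exact: qb|exact: qa].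
  rewrite ltnn mulr1.
  have -> : q 0 k - (a 0 k + s * (b 0 k - a 0 k)) =
     (1 - s) * (q 0 k - a 0 k) + s * (q 0 k - b 0 k) by ring.
  have := qa k; have := qb k; rewrite !ltr_norml => /andP[b1 b2] /andP[a1 a2].
  have [->|s0'] := eqVneq s 0; first by nra.
  have {}s0 : 0 < s by rewrite lt_def s0'.
  by apply/andP; split; nra.
rewrite zS; have [|s s01 ->] := @MVT_line _ f (z k) (delta_mx 0 k) (b 0 k - a 0 k).
  by move=> s /bz; exact: df.
rewrite -mulrBr normrM mulrC; apply: ler_pM => //.
  exact/dA/bz.
by have := coord_le_norm (b - a) k; rewrite !mxE.
Qed.

(** The codomain [R^o] makes this a linear map between normed modules,
comparable with a differential. *)
Definition gradient n (f : 'rV[R]_n -> R) q : 'rV[R]_n -> R^o :=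
  fun v => (\sum_i v 0 i * partial i f q : R).

Lemma gradient_linear n (f : 'rV[R]_n -> R) q : linear (gradient f q).
Proof.
move=> a u v; rewrite /gradient scaler_sumr -big_split; apply: eq_bigr => i _ /=.
by rewrite !mxE mulrDl -mulrA.
Qed.

Definition C1 n (U : set 'rV[R]_n) (f : 'rV[R]_n -> R) :=
  forall q, U q -> {for q, continuous f} /\ forall i, derivable f q (delta_mx 0 i) /\
    {for q, continuous (partial i f)}.

(** Strict differentiability: both endpoints vary. This uniform form of the
first-order expansion is what makes Newton's map a contraction in
[local_surjectivity]. *)
Lemma C1_strict n (U : set 'rV[R]_n) (f : 'rV[R]_n -> R) q e :
  open U -> C1 U f -> U q -> 0 < e ->
  exists2 d, 0 < d & ball q d `<=` U /\ forall a b, ball q d a -> ball q d b ->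
    `|f b - f a - gradient f q (b - a)| <= e * `|b - a|.
Proof.
move=> oU fU Uq e0; pose e' := e / n.+1%:R.
have e'0 : 0 < e' by rewrite divr_gt0.
have /nbhs_ballP[d /= d0 dU] : \forall z \near q,
    U z /\ forall i, `|partial i f z - partial i f q| <= e'.
  apply: filterI; first exact: open_nbhs_nbhs (conj oU Uq).
  apply: (@filter_forall _ _ (fun i => [set z | `|partial i f z - partial i f q| <= e']) (nbhs q) _) => i.
  have [_ /(_ i)[_ ci]] := fU _ Uq.
  near=> z; rewrite /= distrC; near: z; move/cvgrPdist_le: ci; exact.
exists d => //; split=> [z /dU[]//|a b qa qb].
have := @partial_increment _ f q d (fun i => partial i f q) e' d0 _ _ _ _ qa qb.
have -> : gradient f q (b - a) = \sum_i (b 0 i - a 0 i) * partial i f q.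
  by apply: eq_bigr => i _; rewrite !mxE.
move=> h; apply: le_trans (h _ _) _.
- by move=> z i /dU[/fU[_ /(_ i)[]]].
- by move=> z i /dU[_ /(_ i)].
- apply: ler_wpM2r => //; rewrite /e' mulrCA ger_pMr // ler_pdivrMr // mul1r ler_nat.
  exact: leqnSn.
Unshelve. all: end_near.
Qed.

HB.instance Definition _ n (f : 'rV[R]_n -> R) q :=
  GRing.isLinear.Build R 'rV[R]_n R^o *:%R (gradient f q) (gradient_linear f q).

Lemma gradient_continuous n (f : 'rV[R]_n -> R) q : continuous (gradient f q).
Proof.
move=> v.
have -> : gradient f q = \sum_(i < n) (fun w : 'rV[R]_n => partial i f q *: w 0 i).
  by apply/funext => w; rewrite fct_sumE; apply: eq_bigr => i _; rewrite mulrC.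
apply/differentiable_continuous/differentiable_sum => i; apply: differentiableZ.
exact: differentiable_coord.
Qed.

Lemma C1_is_diff n (U : set 'rV[R]_n) (f : 'rV[R]_n -> R) q :
  open U -> C1 U f -> U q -> is_diff q (f : 'rV[R]_n -> R^o) (gradient f q).
Proof.
move=> oU fU Uq.
pose g : 'rV[R]_n -> R^o := f.
have E e : 0 < e -> \forall v \near (0 : 'rV[R]_n),
    `|g (v + q) - (g q + gradient f q v)| <= e * `|v|.
  move=> e0; have [d d0 [_ h]] := C1_strict oU fU Uq e0.
  near=> v; rewrite opprD addrA.
  have := h q (v + q); rewrite addrK; apply; first exact: ballxx.
  rewrite -ball_normE /= opprD addrCA subrr addr0 normrN.
  near: v; apply/nbhs_ballP; exists d => // v; rewrite -ball_normE /= sub0r normrN //.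
have D : 'd g q = gradient f q :> (_ -> _).
  apply: diff_unique; first exact: gradient_continuous.
  by apply/eqaddoP => e e0; exact: E.
split=> //; apply/diff_locallyP; rewrite D; split; first exact: gradient_continuous.
by apply/eqaddoP => e e0; exact: E.
Unshelve. all: end_near.
Qed.

Lemma C1_derivable n (U : set 'rV[R]_n) (f : 'rV[R]_n -> R) q v :
  open U -> C1 U f -> U q -> derivable f q v /\ 'D_v f q = gradient f q v.
Proof.
move=> oU fU Uq; have [df D] := C1_is_diff oU fU Uq; split.
  exact: diff_derivable.
by rewrite deriveE // D.
Qed.

(** [partial_increment] with slopes and error zero. *)
Lemma partial0_locally_cst n (f : 'rV[R]_n -> R) q d : 0 < d ->
  (forall (z : 'rV[R]_n) i, ball q d z -> derivable f z (delta_mx 0 i)) ->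
  (forall (z : 'rV[R]_n) i, ball q d z -> partial i f z = 0) ->
  forall z, ball q d z -> f z = f q.
Proof.
move=> d0 df D z qz.
have := @partial_increment _ f q d (fun=> 0) 0 d0 df _ _ _ (ballxx _ d0) qz.
rewrite mulr0 mul0r big1 => [|i _]; last by rewrite mulr0.
rewrite subr0 normr_le0 subr_eq0 => h; apply/eqP/h => z' i /D ->.
by rewrite subr0 normr0.
Qed.

(** The mean value theorem, applied along [i] to the increment of [f] along
[j], and then along [j]. *)
Lemma second_difference n (f : 'rV[R]_n -> R) (q : 'rV[R]_n) (d : R) (i j : 'I_n)
    (t : R) : 0 < t -> t < d ->
  (forall (z : 'rV[R]_n) k, ball q d z -> derivable f z (delta_mx 0 k)) ->
  (forall (z : 'rV[R]_n) k l, ball q d z -> derivable (partial k f) z (delta_mx 0 l)) ->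
  i != j ->
  exists2 z : 'rV[R]_n, ball q d z &
    f (q + t *: delta_mx 0 i + t *: delta_mx 0 j) - f (q + t *: delta_mx 0 i)
    - (f (q + t *: delta_mx 0 j) - f q) = t * (t * partial j (partial i f) z).
Proof.
move=> t0 td df ddf ij; have d0 := lt_trans t0 td.
have inb (s u : R) : 0 <= s <= 1 -> 0 <= u <= 1 ->
    ball q d (q + (s * t) *: delta_mx 0 i + (u * t) *: delta_mx 0 j).
  move=> /andP[s0 s1] /andP[u0 u1]; apply/(ball_rVP _ _ d0) => k.
  have K (a x y : R) : a - (a + x + y) = - (x + y) by ring.
  rewrite !mxE eqxx /= K normrN.
  have [->|ki] := eqVneq k i.
    rewrite (negbTE ij) mulr0 addr0 mulr1 ger0_norm; last by rewrite mulr_ge0 // ltW.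
    by apply: le_lt_trans td; rewrite ger_pMl.
  rewrite mulr0 add0r; case: eqP => _; last by rewrite mulr0 normr0.
  rewrite mulr1 ger0_norm; last by rewrite mulr_ge0 // ltW.
  by apply: le_lt_trans td; rewrite ger_pMl.
pose g z := f (z + t *: delta_mx 0 j) - f z.
have dj (z : 'rV[R]_n) w : derivable f (z + w) (delta_mx 0 i) ->
    is_derive z (delta_mx 0 i) (fun z => f (z + w)) (partial i f (z + w)).
  move=> dz.
  have E : (fun h : R => h^-1 *: ((f \o shift (z + w)) (h *: delta_mx 0 i) - f (z + w)))
    = (fun h : R => h^-1 *: (((fun z => f (z + w)) \o shift z) (h *: delta_mx 0 i) - f (z + w))).
    by apply/funext => h /=; rewrite addrA.
  by split; rewrite /derivable /partial /derive -E.
have dg s : 0 <= s <= 1 -> is_derive (q + (s * t) *: delta_mx 0 i) (delta_mx 0 i) g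
    (partial i f (q + (s * t) *: delta_mx 0 i + t *: delta_mx 0 j) -
     partial i f (q + (s * t) *: delta_mx 0 i)).
  move=> s01; apply: is_deriveB.
    by apply: dj; apply: df; have := inb s 1 s01; rewrite mul1r; apply; rewrite ler01 lexx.
  apply: derivableP; apply: df; have := inb s 0 s01; rewrite mul0r scale0r addr0.
  by apply; rewrite ler01 lexx.
have [|s s01] := @MVT_line _ g q (delta_mx 0 i) t.
  by move=> s /dg dgs; exact: ex_derive.
rewrite /g => ->; have := dg s s01; rewrite /g => -[_ ->].
have [|u u01 ->] := @MVT_line _ (partial i f) (q + (s * t) *: delta_mx 0 i) (delta_mx 0 j) t.
  by move=> u u01; apply: ddf; exact: inb.
by exists (q + (s * t) *: delta_mx 0 i + (u * t) *: delta_mx 0 j); [exact: inb|].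
Qed.

Lemma eq_of_near_values n (F G : 'rV[R]_n -> R) (q : 'rV[R]_n) :
  {for q, continuous F} -> {for q, continuous G} ->
  (forall d, 0 < d -> exists z w, [/\ ball q d z, ball q d w & F z = G w]) ->
  F q = G q.
Proof.
move=> cF cG h.
apply/eqP; rewrite -subr_eq0 -normr_le0; apply/ler_addgt0Pl => e e0; rewrite addr0.
have e20 : 0 < e / 2 by rewrite divr_gt0.
have [d1 /= d10 h1] : exists2 d, 0 < d & forall z, ball q d z -> `|F q - F z| <= e / 2.
  by move/cvgrPdist_le: cF => /(_ _ e20) /nbhs_ballP[d d0 dU]; exists d.
have [d2 /= d20 h2] : exists2 d, 0 < d & forall z, ball q d z -> `|G q - G z| <= e / 2.
  by move/cvgrPdist_le: cG => /(_ _ e20) /nbhs_ballP[d d0 dU]; exists d.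
have [|z [w [bz bw E]]] := h (Num.min d1 d2); first by rewrite lt_min d10.
rewrite -(subrKA (F z)) (le_trans (ler_normD _ _)) // (splitr e) lerD //.
  by apply: h1; apply: le_ball bz; rewrite ge_min lexx.
by rewrite E distrC; apply: h2; apply: le_ball bw; rewrite ge_min lexx orbT.
Qed.

(** Symmetry of second derivatives: both mixed derivatives are limits of the
second difference quotient. *)
Lemma partialC n (U : set 'rV[R]_n) (f : 'rV[R]_n -> R) q i j :
  open U -> C1 U f -> (forall k, C1 U (partial k f)) -> U q ->
  partial j (partial i f) q = partial i (partial j f) q.
Proof.
move=> oU fU dfU Uq; have [->//|ij] := eqVneq i j.
have cP k l : {for q, continuous (partial k (partial l f))}.
  by have [_ /(_ k)[]] := dfU l q Uq.
apply: (eq_of_near_values (cP j i) (cP i j)) => d d0.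
have /nbhs_ballP[d' /= d'0 d'U] : nbhs q U by exact: open_nbhs_nbhs (conj oU Uq).
pose t := Num.min d d' / 2.
have m0 : 0 < Num.min d d' by rewrite lt_min d0.
have t0 : 0 < t by rewrite divr_gt0.
have td : t < Num.min d d' by rewrite /t; lra.
have mU z : ball q (Num.min d d') z -> U z.
  by move=> bz; apply: d'U; apply: le_ball bz; rewrite ge_min lexx orbT.
have h1 (z : 'rV[R]_n) k : ball q (Num.min d d') z -> derivable f z (delta_mx 0 k).
  by move=> /mU/fU[_ /(_ k)[]].
have h2 (z : 'rV[R]_n) k l : ball q (Num.min d d') z ->
    derivable (partial k f) z (delta_mx 0 l).
  by move=> /mU/(dfU k)[_ /(_ l)[]].
have [z zb E1] := second_difference t0 td h1 h2 ij.
rewrite eq_sym in ij.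
have [w wb E2] := second_difference t0 td h1 h2 ij.
exists z, w; split.
- by apply: le_ball zb; rewrite ge_min lexx.
- by apply: le_ball wb; rewrite ge_min lexx.
- apply: (mulfI (lt0r_neq0 t0)); apply: (mulfI (lt0r_neq0 t0)).
  have K (a b c e : R) : a - b - (c - e) = a - c - (b - e) by ring.
  apply: (etrans (esym E1)); apply: (etrans _ E2).
  by rewrite (addrAC q (t *: delta_mx 0 j)) K.
Qed.

End Calculus.

(** * Closure properties of smooth functions *)

Section Smoothness.
Variable R : realType.
Implicit Types n : nat.

Lemma is_derive_lineP n (f : 'rV[R]_n -> R) (q v : 'rV[R]_n) (d : R) :
  is_derive q v f d <-> is_derive (0 : R) (1 : R) (fun t : R => f (q + t *: v)) d.
Proof.
have E : (fun h : R => h^-1 *: ((f \o shift q) (h *: v) - f q))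
   = (fun h : R => h^-1 *: (((fun s : R => f (q + s *: v)) \o shift (0 : R)) (h *: (1 : R))
       - f (q + (0 : R) *: v))).
  apply/funext => h; have -> : h *: (1 : R) = h by exact: mulr1.
  by rewrite /= scale0r !addr0 (addrC q).
split=> -[]; rewrite /derivable /derive.
  by move=> h1 h2; split; rewrite /derivable /derive -E.
by rewrite -E => h1 h2; split.
Qed.

(** Smoothness quantifies over all iterated partial derivatives at once; finite
orders allow the closure properties to be proved by induction. *)
Fixpoint Ck k n (U : set 'rV[R]_n) (f : 'rV[R]_n -> R) : Prop :=
  if k is k'.+1 then
    (forall q, U q -> {for q, continuous f} /\
       forall i, derivable f q (delta_mx 0 i))
    /\ forall i, Ck k' U (partial i f)
  else forall q, U q -> {for q, continuous f}.

Lemma smoothP n (U : set 'rV[R]_n) f : smooth_on U f <-> forall k, Ck k U f.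
Proof.
split=> [+ k|].
  elim: k f => [|k IH] f sf; first by move=> q /(sf [::])[].
  split=> [q /(sf [::])//|i]; apply: IH => l g q Uq.
  by have := sf (rcons l i) q Uq; rewrite foldr_rcons.
move=> h l; elim/last_ind: l f h => [|l i IH] f h.
  by move=> g q Uq; have [/(_ q Uq)] := h 1%N.
rewrite /= foldr_rcons; apply: IH => k.
by have [_] := h k.+1; exact.
Qed.

Lemma open_near n (U : set 'rV[R]_n) q : open U -> U q -> \forall z \near q, U z.
Proof. by move=> oU Uq; exact: open_nbhs_nbhs (conj oU Uq). Qed.

Lemma near_eq_on n (U : set 'rV[R]_n) T (f g : 'rV[R]_n -> T) q : open U -> U q ->
  (forall z, U z -> f z = g z) -> \forall z \near q, f z = g z.
Proof. by move=> oU Uq h; apply: filterS (open_near oU Uq) => z /h. Qed.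

Lemma eq_partial n (U : set 'rV[R]_n) (f g : 'rV[R]_n -> R) i q : open U ->
  (forall z, U z -> f z = g z) -> U q -> partial i f q = partial i g q.
Proof. by move=> oU h Uq; apply: near_eq_derive; exact: near_eq_on h. Qed.

Lemma Ck_eq k n (U : set 'rV[R]_n) (f g : 'rV[R]_n -> R) : open U ->
  (forall z, U z -> f z = g z) -> Ck k U f -> Ck k U g.
Proof.
move=> oU; have ceq (h h' : 'rV[R]_n -> R) q : (forall z, U z -> h z = h' z) -> U q ->
    {for q, continuous h} -> {for q, continuous h'}.
  move=> e Uq; rewrite /prop_for /continuous_at -e //.
  move=> c; apply: cvg_trans c; apply: (@near_eq_cvg _ _ (nbhs q)).
  by apply: filterS (open_near oU Uq) => z /e ->.
elim: k f g => [|k IH] f g e /=; first by move=> cf q Uq; exact: ceq e Uq (cf q Uq).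
move=> [cf df]; split=> [q Uq|i].
  have [c d] := cf q Uq; split; first exact: ceq e Uq c.
  by move=> i; apply: near_eq_derivable (d i); exact: near_eq_on e.
by apply: IH (df i) => z; exact: eq_partial.
Qed.

Lemma CkS k n (U : set 'rV[R]_n) f : Ck k.+1 U f -> Ck k U f.
Proof.
elim: k f => [|k IH] f [c d]; first by move=> q /c[].
by split=> // i; apply: IH.
Qed.

Lemma Ck_continuous k n (U : set 'rV[R]_n) f : Ck k U f ->
  forall q, U q -> {for q, continuous f}.
Proof. by case: k => [|k] //= [c _] q /c[]. Qed.

Lemma Ck_C1 k n (U : set 'rV[R]_n) f : Ck k.+1 U f -> C1 U f.
Proof.
move=> [c d] q Uq; have [cq dq] := c q Uq; split=> // i; split=> //.
exact: Ck_continuous (d i) _ Uq.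
Qed.

Lemma partial_cst n i c q : partial i (fun _ : 'rV[R]_n => c) q = 0 :> R.
Proof. exact: derive_cst. Qed.

Lemma partialD n i (f g : 'rV[R]_n -> R) q :
  derivable f q (delta_mx 0 i) -> derivable g q (delta_mx 0 i) ->
  partial i (fun z => f z + g z) q = partial i f q + partial i g q.
Proof. by move=> df dg; exact: deriveD. Qed.

Lemma partialM n i (f g : 'rV[R]_n -> R) q :
  derivable f q (delta_mx 0 i) -> derivable g q (delta_mx 0 i) ->
  partial i (fun z => f z * g z) q = partial i f q * g q + f q * partial i g q.
Proof.
move=> df dg; rewrite /partial (deriveM df dg) addrC; congr (_ + _).
exact: mulrC.
Qed.

Lemma partialV n i (f : 'rV[R]_n -> R) q : f q != 0 ->
  derivable f q (delta_mx 0 i) ->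
  partial i (fun z => (f z)^-1) q = - partial i f q * ((f q)^-1 * (f q)^-1).
Proof.
move=> f0 df; rewrite /partial (deriveV f0 df) -exprVn expr2 mulNr mulrC -mulrN.
exact: mulrC.
Qed.

Lemma Ck_cst k n (U : set 'rV[R]_n) c : Ck k U (fun=> c).
Proof.
elim: k c => [|k IH] c /=; first by move=> q _; exact: cst_continuous.
split=> [q _|i]; first by split; [exact: cst_continuous|move=> i; exact: derivable_cst].
have -> : partial i (fun=> c) = fun=> 0 by apply/funext => q; exact: partial_cst.
exact: IH.
Qed.

Lemma CkD k n (U : set 'rV[R]_n) f g : open U -> Ck k U f -> Ck k U g ->
  Ck k U (fun z => f z + g z).
Proof.
move=> oU; elim: k f g => [|k IH] f g /=.
  by move=> cf cg q Uq; apply: continuousD; [exact: cf|exact: cg].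
move=> [cf df] [cg dg]; split=> [q Uq|i].
  have [cfq dfq] := cf q Uq; have [cgq dgq] := cg q Uq.
  by split=> [|i]; [exact: continuousD|exact: derivableD].
apply: (Ck_eq (f := fun z => partial i f z + partial i g z) oU); last exact: IH.
move=> q Uq; rewrite partialD //; first by have [_] := cf q Uq.
by have [_] := cg q Uq.
Qed.

Lemma CkM k n (U : set 'rV[R]_n) f g : open U -> Ck k U f -> Ck k U g ->
  Ck k U (fun z => f z * g z).
Proof.
move=> oU; elim: k f g => [|k IH] f g.
  by move=> cf cg q Uq; apply: continuousM; [exact: cf|exact: cg].
move=> Cf Cg; have [[cf df] [cg dg]] := (Cf, Cg); split=> [q Uq|i].
  have [cfq dfq] := cf q Uq; have [cgq dgq] := cg q Uq.
  by split=> [|i]; [exact: continuousM|exact: derivableM].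
apply: (Ck_eq (f := fun z => partial i f z * g z + f z * partial i g z) oU).
  move=> q Uq; rewrite partialM //; first by have [_] := cf q Uq.
  by have [_] := cg q Uq.
apply: CkD => //; apply: IH; [exact: df|exact: CkS|exact: CkS|exact: dg].
Qed.

Lemma CkV k n (U : set 'rV[R]_n) f : open U -> (forall q, U q -> f q != 0) ->
  Ck k U f -> Ck k U (fun z => (f z)^-1).
Proof.
move=> oU f0; elim: k => [|k IH].
  by move=> cf q Uq; apply: continuousV; [exact: f0|exact: cf].
move=> Cf; have [cf df] := Cf; split=> [q Uq|i].
  have [cfq dfq] := cf q Uq; have f0q := f0 q Uq.
  by split=> [|i]; [exact: continuousV|exact: derivableV].
apply: (Ck_eq (f := fun z => -1 * partial i f z * ((f z)^-1 * (f z)^-1)) oU).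
  by move=> q Uq; have [_ dq] := cf q Uq; rewrite mulN1r (partialV (f0 _ Uq) (dq i)).
apply: CkM => //; apply: CkM => //; [exact: Ck_cst|exact: df|exact/IH/CkS|exact/IH/CkS].
Qed.

Lemma partial_sqrt n i (f : 'rV[R]_n -> R) q : 0 < f q ->
  derivable f q (delta_mx 0 i) ->
  derivable (fun z => Num.sqrt (f z)) q (delta_mx 0 i) /\
  partial i (fun z => Num.sqrt (f z)) q = partial i f q * (2 * Num.sqrt (f q))^-1.
Proof.
move=> f0 df.
have [] : is_derive q (delta_mx 0 i) (fun z => Num.sqrt (f z))
    (partial i f q * (2 * Num.sqrt (f q))^-1); last by [].
apply/is_derive_lineP; have := is_derive_lineP f q (delta_mx 0 i) (partial i f q).
move=> [h _]; have hl := h (derivableP df).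
have ds : is_derive (f (q + (0 : R) *: delta_mx 0 i)) (1 : R) Num.sqrt
    (2 * Num.sqrt (f q))^-1.
  by rewrite scale0r addr0; exact: is_derive1_sqrt.
have := @is_derive1_comp R Num.sqrt (fun t : R => f (q + t *: delta_mx 0 i)) 0 _ _ ds hl.
by rewrite mulrC.
Qed.

Lemma Ck_sqrt k n (U : set 'rV[R]_n) f : open U -> (forall q, U q -> 0 < f q) ->
  Ck k U f -> Ck k U (fun z => Num.sqrt (f z)).
Proof.
move=> oU f0; elim: k => [|k IH].
  move=> cf q Uq; apply: (@continuous_comp _ _ _ f Num.sqrt); first exact: cf.
  exact: sqrt_continuous.
move=> Cf; have [cf df] := Cf; split=> [q Uq|i].
  have [cfq dfq] := cf q Uq; have f0q := f0 q Uq.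
  split=> [|i]; last by have [] := partial_sqrt f0q (dfq i).
  apply: (@continuous_comp _ _ _ f Num.sqrt) => //; exact: sqrt_continuous.
apply: (Ck_eq (f := fun z => partial i f z * (2 * Num.sqrt (f z))^-1) oU).
  move=> q Uq; have [cfq dfq] := cf q Uq.
  by have [_ ->] := partial_sqrt (f0 q Uq) (dfq i).
apply: CkM => //; first exact: df.
apply: CkV => // [q /f0 fq|]; first by rewrite mulf_neq0 // gt_eqF // sqrtr_gt0.
by apply: CkM => //; [exact: Ck_cst|exact/IH/CkS].
Qed.

Lemma Ck_sum k n (U : set 'rV[R]_n) (I : Type) (r : seq I) (F : I -> 'rV[R]_n -> R) :
  open U -> (forall i, Ck k U (F i)) -> Ck k U (fun z => \sum_(i <- r) F i z).
Proof.
move=> oU h; elim: r => [|i r IH].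
  by apply: (Ck_eq (f := fun=> 0) oU); [move=> z; rewrite big_nil|exact: Ck_cst].
apply: (Ck_eq (f := fun z => F i z + \sum_(j <- r) F j z) oU).
  by move=> z _; rewrite big_cons.
exact: CkD.
Qed.

Lemma is_derive_coord n i j (q : 'rV[R]_n) :
  is_derive q (delta_mx 0 i) (fun z : 'rV[R]_n => z 0 j) (j == i)%:R.
Proof.
apply/is_derive_lineP.
have -> : (fun t : R => (q + t *: delta_mx 0 i) 0 j) =
   (fun t : R => q 0 j + (j == i)%:R * t).
  by apply/funext => t; rewrite !mxE eqxx /= mulrC.
have := is_deriveD (is_derive_cst (q 0 j : R^o) (0 : R) (1 : R))
  (is_deriveZ (f := id) (j == i)%:R (is_derive_id (0 : R) (1 : R))).
by rewrite add0r (_ : _ *: _ = (j == i)%:R) //; exact: mulr1.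
Qed.

Lemma partial_coord n i j (q : 'rV[R]_n) :
  partial i (fun z : 'rV[R]_n => z 0 j) q = (j == i)%:R.
Proof. by have [] := is_derive_coord i j q. Qed.

Lemma Ck_coord k n (U : set 'rV[R]_n) j : Ck k U (fun z : 'rV[R]_n => z 0 j).
Proof.
case: k => [|k] /=; first by move=> q _; exact: coord_continuous.
split=> [q _|i].
  split; first exact: coord_continuous.
  by move=> i; have [] := is_derive_coord i j q.
have -> : partial i (fun z : 'rV[R]_n => z 0 j) = fun=> (j == i)%:R.
  by apply/funext => q; exact: partial_coord.
exact: Ck_cst.
Qed.

(** The differential written through the gradients of the coordinates; see
[is_diff_coords]. *)
Definition tangent_map n p (G : 'rV[R]_n -> 'rV[R]_p) q (v : 'rV[R]_n) : 'rV[R]_p :=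
  \row_j gradient (fun r => G r 0 j) q v.

Lemma is_diff_coords n p (U : set 'rV[R]_n) (G : 'rV[R]_n -> 'rV[R]_p) q :
  open U -> (forall j, C1 U (fun r => G r 0 j)) -> U q ->
  is_diff q G (tangent_map G q).
Proof.
move=> oU CG Uq.
have EG : G = \sum_(j < p) (fun r => (G r 0 j : R) *: (delta_mx 0 j : 'rV[R]_p)).
  apply/funext => r; rewrite fct_sumE; apply/rowP => j; rewrite summxE (bigD1 j) //=.
  rewrite big1 ?addr0 => [|i ij]; first by rewrite !mxE !eqxx mulr1.
  by rewrite !mxE eqxx eq_sym (negbTE ij) mulr0.
have dG : differentiable G q.
  rewrite EG; apply: differentiable_sum => j; apply: differentiableZl.
  by have [] := C1_is_diff oU (CG j) Uq.
split=> //; apply/funext => v; rewrite -deriveE // derive_mx; last exact: diff_derivable.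
by apply/rowP => j; rewrite !mxE; have [_ ->] := C1_derivable v oU (CG j) Uq.
Qed.

Lemma is_derive_comp n p (U : set 'rV[R]_n) (V : set 'rV[R]_p) f
    (G : 'rV[R]_n -> 'rV[R]_p) i q :
  open U -> open V -> (forall j, C1 U (fun r => G r 0 j)) -> C1 V f ->
  U q -> V (G q) ->
  is_derive q (delta_mx 0 i) (fun r => f (G r))
    (\sum_j partial i (fun r => G r 0 j) q * partial j f (G q)).
Proof.
move=> oU oV CG Cf Uq VGq.
have [dG DG] := is_diff_coords oU CG Uq.
have [df Df] := C1_is_diff oV Cf VGq.
have dfG : differentiable ((f : 'rV[R]_p -> R^o) \o G) q by exact: differentiable_comp.
split; first exact: (diff_derivable (f := (f : 'rV[R]_p -> R^o) \o G)).
rewrite -[LHS]/('D_(delta_mx 0 i) ((f : 'rV[R]_p -> R^o) \o G) q) deriveE //.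
rewrite diff_comp // Df /= DG /gradient; apply: eq_bigr => j _.
have [dj Dj] := C1_derivable (delta_mx 0 i) oU (CG j) Uq.
by rewrite mxE -Dj.
Qed.

(** The inner map has one order more than the conclusion, so that its first
derivatives, which by the chain rule multiply those of [f], still have order
[k]. *)
Lemma Ck_comp k n p (U : set 'rV[R]_n) (V : set 'rV[R]_p) f
    (G : 'rV[R]_n -> 'rV[R]_p) :
  open U -> open V -> (forall j, Ck k.+1 U (fun r => G r 0 j)) -> Ck k V f ->
  (forall q, U q -> V (G q)) -> Ck k U (fun r => f (G r)).
Proof.
move=> oU oV + + UV; elim: k f => [|k IH] f CG Cf.
  move=> q Uq; have [dG _] := is_diff_coords oU (fun j => Ck_C1 (CG j)) Uq.
  apply: (@continuous_comp _ _ _ G f); first exact: differentiable_continuous.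
  exact: Cf (UV _ Uq).
have CG' j : Ck k.+1 U (fun r => G r 0 j) by exact: CkS.
have D i q : U q -> is_derive q (delta_mx 0 i) (fun r => f (G r))
    (\sum_j partial i (fun r => G r 0 j) q * partial j f (G q)).
  move=> Uq; exact: (@is_derive_comp n p U V f G i q oU oV (fun j => Ck_C1 (CG j))
    (Ck_C1 Cf) Uq (UV _ Uq)).
split=> [q Uq|i].
  split; last by move=> i; have [] := D i q Uq.
  have [dG _] := is_diff_coords oU (fun j => Ck_C1 (CG j)) Uq.
  apply: (@continuous_comp _ _ _ G f); first exact: differentiable_continuous.
  exact: Ck_continuous Cf _ (UV _ Uq).
apply: (Ck_eq (f := fun q => \sum_j partial i (fun r => G r 0 j) q * partial j f (G q)) oU).
  by move=> q Uq; have [_ <-] := D i q Uq.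
apply: Ck_sum => // j; apply: CkM => //.
  by have [_] := CG j => /(_ i)/CkS.
by have [_ dCf] := Cf; apply: (IH (partial j f)); [exact: CG'|exact: dCf].
Qed.

Section Smooth_closure.
Variables (n : nat) (U : set 'rV[R]_n).
Hypothesis oU : open U.
Implicit Types f g : 'rV[R]_n -> R.

Lemma smooth_eq f g : (forall z, U z -> f z = g z) -> smooth_on U f -> smooth_on U g.
Proof. by move=> e /smoothP h; apply/smoothP => k; exact: Ck_eq (h k). Qed.

Lemma smooth_sub (V : set 'rV[R]_n) f : V `<=` U -> smooth_on U f -> smooth_on V f.
Proof. by move=> VU h l g q /VU; exact: h. Qed.

Lemma smooth_C1 f : smooth_on U f -> C1 U f.
Proof. by move/smoothP/(_ 1%N)/Ck_C1. Qed.

Lemma smooth_derivable f q i : smooth_on U f -> U q -> derivable f q (delta_mx 0 i).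
Proof. by move=> /(_ [::]) h /h[]. Qed.

Lemma smooth_continuous f q : smooth_on U f -> U q -> {for q, continuous f}.
Proof. by move=> /(_ [::]) h /h[]. Qed.

Lemma smooth_partial f i : smooth_on U f -> smooth_on U (partial i f).
Proof. by move=> /smoothP h; apply/smoothP => k; have [_] := h k.+1; exact. Qed.

Lemma smooth_cst c : smooth_on U (fun=> c).
Proof. by apply/smoothP => k; exact: Ck_cst. Qed.

Lemma smooth_coord j : smooth_on U (fun z => z 0 j).
Proof. by apply/smoothP => k; exact: Ck_coord. Qed.

Lemma smoothD f g : smooth_on U f -> smooth_on U g -> smooth_on U (fun z => f z + g z).
Proof. by move=> /smoothP h /smoothP h'; apply/smoothP => k; exact: CkD. Qed.

Lemma smoothM f g : smooth_on U f -> smooth_on U g -> smooth_on U (fun z => f z * g z).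
Proof. by move=> /smoothP h /smoothP h'; apply/smoothP => k; exact: CkM. Qed.

Lemma smoothN f : smooth_on U f -> smooth_on U (fun z => - f z).
Proof.
move=> h; apply: (smooth_eq (f := fun z => -1 * f z)) => [z _|]; first by rewrite mulN1r.
by apply: smoothM => //; exact: smooth_cst.
Qed.

Lemma smoothB f g : smooth_on U f -> smooth_on U g -> smooth_on U (fun z => f z - g z).
Proof. by move=> h h'; apply: smoothD => //; exact: smoothN. Qed.

Lemma smoothV f : (forall q, U q -> f q != 0) -> smooth_on U f ->
  smooth_on U (fun z => (f z)^-1).
Proof. by move=> f0 /smoothP h; apply/smoothP => k; exact: CkV. Qed.

Lemma smooth_sqrt f : (forall q, U q -> 0 < f q) -> smooth_on U f ->
  smooth_on U (fun z => Num.sqrt (f z)).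
Proof. by move=> f0 /smoothP h; apply/smoothP => k; exact: Ck_sqrt. Qed.

Lemma smooth_sum (I : Type) (r : seq I) (F : I -> 'rV[R]_n -> R) :
  (forall i, smooth_on U (F i)) -> smooth_on U (fun z => \sum_(i <- r) F i z).
Proof.
by move=> h; apply/smoothP => k; apply: Ck_sum => // i; have /smoothP := h i.
Qed.

Lemma smooth_comp p (V : set 'rV[R]_p) (f : 'rV[R]_p -> R) (G : 'rV[R]_n -> 'rV[R]_p) :
  open V -> smooth_map_on U G -> smooth_on V f -> (forall q, U q -> V (G q)) ->
  smooth_on U (fun r => f (G r)).
Proof.
move=> oV GU /smoothP h UV; apply/smoothP => k; apply: (Ck_comp (V := V)) => // j.
by have /smoothP := GU j.
Qed.

Lemma smooth_partialC f i j q : smooth_on U f -> U q ->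
  partial j (partial i f) q = partial i (partial j f) q.
Proof.
move=> h; apply: (partialC _ _ oU (smooth_C1 h)) => k.
exact/smooth_C1/smooth_partial.
Qed.

Lemma partialN f i q : smooth_on U f -> U q ->
  partial i (fun z => - f z) q = - partial i f q.
Proof. by move=> h Uq; apply: deriveN; exact: smooth_derivable h Uq. Qed.

Lemma partial_sum (I : Type) (r : seq I) (F : I -> 'rV[R]_n -> R) i q :
  (forall j, smooth_on U (F j)) -> U q ->
  partial i (fun z => \sum_(j <- r) F j z) q = \sum_(j <- r) partial i (F j) q.
Proof.
move=> h Uq; elim: r => [|j r IH].
  have -> : (fun z => \sum_(j <- [::]) F j z) = fun=> 0.
    by apply/funext => z; rewrite big_nil.
  by rewrite big_nil partial_cst.
have -> : (fun z => \sum_(j <- j :: r) F j z) = fun z => F j z + \sum_(j <- r) F j z.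
  by apply/funext => z; rewrite big_cons.
rewrite big_cons partialD ?IH //; first exact: smooth_derivable (h j) Uq.
by apply: (smooth_derivable _ Uq); exact: smooth_sum.
Qed.

End Smooth_closure.

End Smoothness.

(** * Local surjectivity *)

HB.instance Definition _ (R : realType) m n := Complete.on 'M[R]_(m, n).

Section LocalSurjectivity.
Variable R : realType.

Lemma mulmx_bounded n (B : 'M[R]_n) :
  exists2 K : R, 0 < K & forall v : 'rV[R]_n, `|v *m B| <= K * `|v|.
Proof.
exists (1 + \sum_i \sum_j `|B i j|).
  by rewrite ltr_pwDl // sumr_ge0 // => i _; rewrite sumr_ge0.
move=> v; apply: norm_le_coord => [|j].
  by rewrite mulr_ge0 // addr_ge0 // sumr_ge0 // => i _; rewrite sumr_ge0.
rewrite mxE (le_trans (ler_norm_sum _ _ _)) // mulrDl mul1r ler_wpDl //.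
rewrite mulr_suml; apply: ler_sum => i _; rewrite normrM mulrC.
apply: ler_pM => //; last exact: coord_le_norm.
by rewrite (bigD1 j) //= ler_wpDr // sumr_ge0.
Qed.

(** The surjective half of the inverse function theorem: a solution of [G z = y]
is a fixed point of Newton's map with the derivative taken at [q], which
contracts a small closed ball around [q]. *)
Lemma local_surjectivity n (U W : set 'rV[R]_n) (G : 'rV[R]_n -> 'rV[R]_n) q
    (A : 'M[R]_n) : open U -> (forall j, C1 U (fun r => G r 0 j)) -> U q ->
  (forall v, tangent_map G q v = v *m A) -> A \in unitmx -> nbhs q W ->
  nbhs (G q) (G @` W).
Proof.
move=> oU CG Uq JA uA nW.
have [K K0 BK] := mulmx_bounded (invmx A).
(* An error [e] below [(2 K)^-1] in the expansion of [G] gives ratio 1/2. *)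
pose e := (2 * K)^-1; have e0 : 0 < e by rewrite invr_gt0 mulr_gt0.
have /nbhs_ballP[d /= d0 dW] : \forall z \near q, W z.
  exact: nW.
have [d' d'0 dG] : exists2 d', 0 < d' & forall j a b, ball q d' a -> ball q d' b ->
    `|G b 0 j - G a 0 j - gradient (fun r => G r 0 j) q (b - a)| <= e * `|b - a|.
  have : forall j, exists d', 0 < d' /\ forall a b, ball q d' a -> ball q d' b ->
      `|G b 0 j - G a 0 j - gradient (fun r => G r 0 j) q (b - a)| <= e * `|b - a|.
    by move=> j; have [x x0 [_ xG]] := C1_strict oU (CG j) Uq e0; exists x.
  move=> /choice[D DP]; exists (\big[Num.min/1]_j D j).
    by apply/bigmin_gtP; split=> // j _; have [] := DP j.
  move=> j a b qa qb; have [_] := DP j; apply; [apply: le_ball qa|apply: le_ball qb];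
  exact: bigmin_le.
pose r := Num.min d d' / 2.
have m0 : 0 < Num.min d d' by rewrite lt_min d0.
have r0 : 0 < r by rewrite divr_gt0.
have rm : r < Num.min d d' by rewrite /r; lra.
pose C := closed_ball_ Num.Def.normr q r.
have Cd z : C z -> ball q d z.
  rewrite -ball_normE /C /closed_ball_ /= => /le_lt_trans; apply.
  by rewrite (lt_le_trans rm) // ge_min lexx.
have Cd' z : C z -> ball q d' z.
  rewrite -ball_normE /C /closed_ball_ /= => /le_lt_trans; apply.
  by rewrite (lt_le_trans rm) // ge_min lexx orbT.
apply/nbhs_ballP; exists (r * e) => [|y]; first by rewrite /= mulr_gt0.
rewrite -ball_normE /= => yq.
pose T z := z + (y - G z) *m invmx A.
have TC a b : C a -> C b -> `|T a - T b| <= 2^-1 * `|a - b|.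
  move=> Ca Cb.
  have -> : T a - T b = - ((G a - G b - (a - b) *m A) *m invmx A).
    rewrite mulmxBl mulmxK // /T !mulmxBl.
    move: (y *m _) (G a *m _) (G b *m _) => Y P Q.
    by apply/rowP => i; rewrite !mxE; ring.
  rewrite normrN (le_trans (BK _)) //.
  have -> : 2^-1 * `|a - b| = K * (e * `|a - b|).
    by rewrite /e invfM mulrA mulrCA mulfV ?mulr1 // gt_eqF.
  rewrite ler_pM2l //; apply: norm_le_coord => [|j]; first by rewrite mulr_ge0 // ltW.
  by have := dG j b a (Cd' _ Cb) (Cd' _ Ca); rewrite -JA !mxE.
have Cq : C q by rewrite /C /closed_ball_ /= subrr normr0 ltW.
have TCC z : C z -> C (T z).
  move=> Cz; rewrite /C /closed_ball_ /=.
  have -> : q - T z = (T q - T z) - (y - G q) *m invmx A by rewrite /T addrAC addrK.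
  rewrite (le_trans (ler_normB _ _)) // [r]splitr lerD //.
    rewrite (le_trans (TC _ _ Cq Cz)) // mulrC; apply: ler_pM => //.
  rewrite (le_trans (BK _)) // distrC mulrC -ler_pdivlMr // (le_trans (ltW yq)) //.
  by rewrite /e invfM mulrA.
have hT : {homo T : x / C x >-> C x} by exact: TCC.
have [|||z Cz zT] := @banach_fixed_point R _ C (mkfun_fun hT).
- exists (2^-1)%:nng; split=> //=; first by rewrite invf_lt1 // ltr1n.
  by move=> -[a b] /= [Ca Cb]; exact: TC.
- exact: closed_closed_ball_.
- by exists q.
exists z; first exact/dW/Cd.
move: zT => /= /eqP; rewrite /T -subr_eq0 opprD addrA subrr add0r oppr_eq0 => /eqP zT.
apply/eqP; rewrite eq_sym -subr_eq0; apply/eqP.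
by rewrite -[LHS](mulmxKV uA) zT mul0mx.
Qed.

End LocalSurjectivity.

(** * Scalar products, vector-valued derivatives and trivectors *)

#[local] Opaque partial smooth_on.

Section Scal.
Variables (R : realType) (n s : nat).
Local Notation "<< x , y >>" := (@scal R n s x y) (at level 0, format "<< x ,  y >>").
Implicit Types (x y z : 'rV[R]_n) (c : R).

Lemma scalC x y : << x, y >> = << y, x >>.
Proof. by apply: eq_bigr => i _; rewrite mulrAC. Qed.

Lemma scalDl x y z : << x + y, z >> = << x, z >> + << y, z >>.
Proof. by rewrite -big_split; apply: eq_bigr => i _ /=; rewrite mxE; ring. Qed.

Lemma scalZl c x z : << c *: x, z >> = c * << x, z >>.
Proof. by rewrite /scal mulr_sumr; apply: eq_bigr => i _ /=; rewrite mxE; ring. Qed.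

Lemma scalNl x z : << - x, z >> = - << x, z >>.
Proof. by rewrite -scaleN1r scalZl mulN1r. Qed.

Lemma scalBl x y z : << x - y, z >> = << x, z >> - << y, z >>.
Proof. by rewrite scalDl scalNl. Qed.

Lemma scal0l z : << 0, z >> = 0.
Proof. by rewrite -(scale0r 0) scalZl mul0r. Qed.

Lemma scalDr x y z : << z, x + y >> = << z, x >> + << z, y >>.
Proof. by rewrite !(scalC z) scalDl. Qed.

Lemma scalZr c x z : << z, c *: x >> = c * << z, x >>.
Proof. by rewrite !(scalC z) scalZl. Qed.

Lemma scalNr x z : << z, - x >> = - << z, x >>.
Proof. by rewrite !(scalC z) scalNl. Qed.

Lemma scalBr x y z : << z, x - y >> = << z, x >> - << z, y >>.
Proof. by rewrite !(scalC z) scalBl. Qed.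

Lemma scal0r z : << z, 0 >> = 0.
Proof. by rewrite scalC scal0l. Qed.

Definition scalE := (scalDl, scalDr, scalBl, scalBr, scalNl, scalNr, scalZl, scalZr,
  scal0l, scal0r).

Lemma scal_delta x i :
  << x, delta_mx 0 i >> = (if (i < n - s)%N then 1 else -1) * x 0 i.
Proof.
rewrite /scal (bigD1 i) //= big1 => [|j ji]; rewrite !mxE eqxx.
  by rewrite eqxx mulr1 addr0.
by rewrite (negbTE ji) mulr0.
Qed.

Lemma scal_nondegenerate x : (forall y, << x, y >> = 0) -> x = 0.
Proof.
move=> h; apply/rowP => i; rewrite mxE; have := h (delta_mx 0 i).
by rewrite scal_delta; case: ifP => _; rewrite ?mul1r ?mulN1r // => /eqP;
  rewrite oppr_eq0 => /eqP.
Qed.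

Lemma scal_inj x y : (forall z, << x, z >> = << y, z >>) -> x = y.
Proof.
move=> h; apply/eqP; rewrite -subr_eq0; apply/eqP/scal_nondegenerate => z.
by rewrite scalBl h subrr.
Qed.

End Scal.

Section SmoothPartials.
Variables (R : realType) (p : nat) (U : set 'rV[R]_p).
Hypothesis oU : open U.
Implicit Types f g : 'rV[R]_p -> R.

Lemma smooth_partialM f g a q : smooth_on U f -> smooth_on U g -> U q ->
  partial a (fun z => f z * g z) q = partial a f q * g q + f q * partial a g q.
Proof. by move=> hf hg Uq; apply: partialM; exact: smooth_derivable Uq. Qed.

Lemma smooth_partialD f g a q : smooth_on U f -> smooth_on U g -> U q ->
  partial a (fun z => f z + g z) q = partial a f q + partial a g q.
Proof. by move=> hf hg Uq; apply: partialD; exact: smooth_derivable Uq. Qed.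

Lemma smooth_partialB f g a q : smooth_on U f -> smooth_on U g -> U q ->
  partial a (fun z => f z - g z) q = partial a f q - partial a g q.
Proof.
move=> hf hg Uq; rewrite (smooth_partialD a hf (smoothN oU hg) Uq).
by rewrite (partialN a hg Uq).
Qed.

Lemma smooth_partialZ c f a q : smooth_on U f -> U q ->
  partial a (fun z => c * f z) q = c * partial a f q.
Proof.
move=> hf Uq; rewrite (smooth_partialM a (smooth_cst c) hf Uq).
by rewrite partial_cst mul0r add0r.
Qed.

End SmoothPartials.

Fact vpartial_key : unit. Proof. exact: tt. Qed.

Definition row_partial (R : realType) (n p : nat) (a : 'I_p) (f : 'rV[R]_p -> 'rV[R]_n)
    (q : 'rV[R]_p) : 'rV[R]_n :=
  \row_j partial a (fun r => f r 0 j) q.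

Definition vpartial := locked_with vpartial_key row_partial.
Arguments vpartial {R n p} a f q.

Section VectorCalculus.
Variables (R : realType) (n s p : nat) (U : set 'rV[R]_p).
Hypothesis oU : open U.
Implicit Types (f g : 'rV[R]_p -> 'rV[R]_n) (c : 'rV[R]_p -> R).

Lemma vpartialE a f q j : vpartial a f q 0 j = partial a (fun r => f r 0 j) q.
Proof. by rewrite /vpartial unlock mxE. Qed.

Lemma smoothvD f g : smooth_map_on U f -> smooth_map_on U g ->
  smooth_map_on U (fun q => f q + g q).
Proof.
move=> hf hg j; apply: (smooth_eq oU (f := fun q => f q 0 j + g q 0 j)).
  by move=> q _; rewrite mxE.
exact: smoothD.
Qed.

Lemma smoothvZ c f : smooth_on U c -> smooth_map_on U f ->
  smooth_map_on U (fun q => c q *: f q).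
Proof.
move=> hc hf j; apply: (smooth_eq oU (f := fun q => c q * f q 0 j)).
  by move=> q _; rewrite mxE.
exact: smoothM.
Qed.

Lemma smoothvN f : smooth_map_on U f -> smooth_map_on U (fun q => - f q).
Proof.
move=> hf j; apply: (smooth_eq oU (f := fun q => - (f q 0 j))).
  by move=> q _; rewrite mxE.
exact: smoothN.
Qed.

Lemma smoothvB f g : smooth_map_on U f -> smooth_map_on U g ->
  smooth_map_on U (fun q => f q - g q).
Proof. by move=> hf hg; exact: (smoothvD hf (smoothvN hg)). Qed.

Lemma smooth_vpartial a f : smooth_map_on U f -> smooth_map_on U (vpartial a f).
Proof.
move=> hf j; apply: (smooth_eq oU (f := partial a (fun r => f r 0 j))).
  by move=> q _; rewrite vpartialE.
exact: smooth_partial.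
Qed.

Lemma smooth_scal f g : smooth_map_on U f -> smooth_map_on U g ->
  smooth_on U (fun q => scal s (f q) (g q)).
Proof.
move=> hf hg; apply: smooth_sum => // i.
by apply: smoothM => //; apply: smoothM => //; exact: smooth_cst.
Qed.

Lemma eq_vpartial a f g q : (forall z, U z -> f z = g z) -> U q ->
  vpartial a f q = vpartial a g q.
Proof.
move=> e Uq; apply/rowP => j; rewrite !vpartialE; apply: (eq_partial _ oU) => // z Uz.
by rewrite e.
Qed.

Lemma vpartialD a f g q : smooth_map_on U f -> smooth_map_on U g -> U q ->
  vpartial a (fun z => f z + g z) q = vpartial a f q + vpartial a g q.
Proof.
move=> hf hg Uq; apply/rowP => j; rewrite vpartialE !mxE ?vpartialE.
rewrite (eq_partial (g := fun z => f z 0 j + g z 0 j) a oU _ Uq); last by move=> z; rewrite mxE.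
by rewrite (smooth_partialD a (hf j) (hg j) Uq).
Qed.

Lemma vpartialZ a c f q : smooth_on U c -> smooth_map_on U f -> U q ->
  vpartial a (fun z => c z *: f z) q = partial a c q *: f q + c q *: vpartial a f q.
Proof.
move=> hf hg Uq; apply/rowP => j; rewrite vpartialE !mxE ?vpartialE.
rewrite (eq_partial (g := fun z => c z * f z 0 j) a oU _ Uq); last by move=> z; rewrite mxE.
by rewrite (smooth_partialM a hf (hg j) Uq).
Qed.

Lemma vpartialN a f q : smooth_map_on U f -> U q ->
  vpartial a (fun z => - f z) q = - vpartial a f q.
Proof.
move=> hf Uq; apply/rowP => j; rewrite vpartialE !mxE ?vpartialE.
rewrite (eq_partial (g := fun z => - (f z 0 j)) a oU _ Uq); last by move=> z; rewrite mxE.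
exact: partialN (hf j) Uq.
Qed.

Lemma vpartialB a f g q : smooth_map_on U f -> smooth_map_on U g -> U q ->
  vpartial a (fun z => f z - g z) q = vpartial a f q - vpartial a g q.
Proof.
move=> hf hg Uq; rewrite (vpartialD a hf (smoothvN hg) Uq).
by rewrite (vpartialN a hg Uq).
Qed.

Lemma vpartialC a b f q : smooth_map_on U f -> U q ->
  vpartial a (vpartial b f) q = vpartial b (vpartial a f) q.
Proof.
move=> hf Uq; apply/rowP => j; rewrite [LHS]vpartialE [RHS]vpartialE.
have E d : (fun r => vpartial d f r 0 j) = partial d (fun r => f r 0 j).
  by apply/funext => r; rewrite vpartialE.
rewrite (E a) (E b); exact: (smooth_partialC oU _ _ (hf j) Uq).
Qed.

Lemma partial_scal a f g q : smooth_map_on U f -> smooth_map_on U g -> U q ->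
  partial a (fun z => scal s (f z) (g z)) q =
  scal s (vpartial a f q) (g q) + scal s (f q) (vpartial a g q).
Proof.
move=> hf hg Uq; have sfg (i : 'I_n) : smooth_on U (fun z : 'rV[R]_p =>
    (if (i < n - s)%N then 1 else -1) * f z 0 i * g z 0 i).
  by apply: smoothM => //; apply: smoothM => //; exact: smooth_cst.
apply: (etrans (partial_sum oU _ _ sfg Uq)).
rewrite -big_split; apply: eq_bigr => i _ /=.
rewrite !vpartialE (smooth_partialM a _ (hg i) Uq).
  by rewrite (smooth_partialZ _ a (hf i) Uq).
by apply: (smoothM oU) (hf i); exact: smooth_cst.
Qed.

End VectorCalculus.

Section Trivectors.
Variables (R : realType) (n s : nat).
Implicit Types (f g h x y z : 'rV[R]_n).

(** The coordinates of [f ^ g ^ h] for all index triples, increasing or not. *)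
Definition tri f g h (i j k : 'I_n) : R :=
  f 0 i * (g 0 j * h 0 k - g 0 k * h 0 j) - f 0 j * (g 0 i * h 0 k - g 0 k * h 0 i)
  + f 0 k * (g 0 i * h 0 j - g 0 j * h 0 i).

Lemma wedge3E f g h (t : triple n) : wedge3 f g h t =
  tri f g h (tnth (val t) ord0) (tnth (val t) (lift ord0 ord0))
    (tnth (val t) (lift ord0 (lift ord0 ord0))).
Proof.
rewrite ffunE (expand_det_row _ ord0) !big_ord_recl big_ord0 /cofactor.
rewrite !(expand_det_row _ ord0) !big_ord_recl !big_ord0 /cofactor !det_mx11 !mxE /=.
rewrite !(tnth_nth 0) /= /tri.
have i0 := tnth (val t) ord0; rewrite !(tnth_nth i0) /= /bump /=; ring.
Qed.

(** Pairing with the trivector x ^ y ^ z for the product of the third exterior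
power, up to the factor counting ordered index triples. *)
Definition contract x y z (t : 'I_n -> 'I_n -> 'I_n -> R) : R :=
  scal s x (\row_i scal s y (\row_j scal s z (\row_k t i j k))).

Lemma contractD x y z t t' : contract x y z (fun i j k => t i j k + t' i j k) =
  contract x y z t + contract x y z t'.
Proof.
rewrite /contract -scalDr; congr (scal s x _); apply/rowP => i; rewrite !mxE.
rewrite -scalDr; congr (scal s y _); apply/rowP => j; rewrite !mxE.
by rewrite -scalDr; congr (scal s z _); apply/rowP => k; rewrite !mxE.
Qed.

Lemma contractZ x y z c t : contract x y z (fun i j k => c * t i j k) =
  c * contract x y z t.
Proof.
rewrite /contract -scalZr; congr (scal s x _); apply/rowP => i; rewrite !mxE.
rewrite -scalZr; congr (scal s y _); apply/rowP => j; rewrite !mxE.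
by rewrite -scalZr; congr (scal s z _); apply/rowP => k; rewrite !mxE.
Qed.

Lemma contract_eq x y z t t' : (forall i j k, t i j k = t' i j k) ->
  contract x y z t = contract x y z t'.
Proof.
move=> e; congr contract; apply/funext => i; apply/funext => j; exact/funext.
Qed.

Lemma contract0 x y z : contract x y z (fun _ _ _ => 0) = 0.
Proof.
rewrite -[RHS](mul0r (contract x y z (fun _ _ _ => 0))) -contractZ.
by apply: contract_eq => *; rewrite mul0r.
Qed.

(** The Gram determinant of two triples: the product of trivectors. *)
Definition gram3 f g h x y z : R :=
  scal s f x * (scal s g y * scal s h z - scal s g z * scal s h y)
  - scal s f y * (scal s g x * scal s h z - scal s g z * scal s h x)
  + scal s f z * (scal s g x * scal s h y - scal s g y * scal s h x).

Lemma contract_tri f g h x y z : contract x y z (tri f g h) = gram3 f g h x y z.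
Proof.
rewrite /contract.
have E1 i j : scal s z (\row_k tri f g h i j k) =
   f 0 i * (g 0 j * scal s z h - h 0 j * scal s z g) -
   f 0 j * (g 0 i * scal s z h - h 0 i * scal s z g) +
   scal s z f * (g 0 i * h 0 j - g 0 j * h 0 i).
  have -> : (\row_k tri f g h i j k) =
     (f 0 i * g 0 j - f 0 j * g 0 i) *: h - (f 0 i * h 0 j - f 0 j * h 0 i) *: g +
     (g 0 i * h 0 j - g 0 j * h 0 i) *: f.
    by apply/rowP => k; rewrite !mxE /tri; ring.
  by rewrite !scalE; ring.
have E2 i : scal s y (\row_j scal s z (\row_k tri f g h i j k)) =
   f 0 i * (scal s y g * scal s z h - scal s y h * scal s z g) -
   scal s y f * (g 0 i * scal s z h - h 0 i * scal s z g) +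
   scal s z f * (g 0 i * scal s y h - scal s y g * h 0 i).
  have -> : (\row_j scal s z (\row_k tri f g h i j k)) =
     (f 0 i * scal s z h - scal s z f * h 0 i) *: g -
     (f 0 i * scal s z g - scal s z f * g 0 i) *: h -
     (g 0 i * scal s z h - h 0 i * scal s z g) *: f.
    by apply/rowP => j; rewrite mxE E1 !mxE; ring.
  by rewrite !scalE; ring.
have -> : (\row_i scal s y (\row_j scal s z (\row_k tri f g h i j k))) =
   (scal s y g * scal s z h - scal s y h * scal s z g) *: f
   - (scal s y f * scal s z h - scal s z f * scal s y h) *: g
   + (scal s y f * scal s z g - scal s z f * scal s y g) *: h.
  by apply/rowP => i; rewrite mxE E2 !mxE; ring.
by rewrite !scalE /gram3 !(scalC _ x, scalC _ y, scalC _ z); ring.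
Qed.

Lemma smooth_tri p (U : set 'rV[R]_p) (F G H : 'rV[R]_p -> 'rV[R]_n) i j k :
  open U -> smooth_map_on U F -> smooth_map_on U G -> smooth_map_on U H ->
  smooth_on U (fun r => tri (F r) (G r) (H r) i j k).
Proof.
move=> oU hF hG hH.
have sGH (l m : 'I_n) : smooth_on U (fun r => G r 0 l * H r 0 m).
  exact: (smoothM oU (hG l) (hH m)).
have sT (o l m : 'I_n) :
    smooth_on U (fun r => F r 0 o * (G r 0 l * H r 0 m - G r 0 m * H r 0 l)).
  exact: (smoothM oU (hF o) (smoothB oU (sGH l m) (sGH m l))).
exact: (smoothD oU (smoothB oU (sT i j k) (sT j i k)) (sT k i j)).
Qed.

Lemma partial_tri p (U : set 'rV[R]_p) (F G H : 'rV[R]_p -> 'rV[R]_n) a q i j k :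
  open U -> smooth_map_on U F -> smooth_map_on U G -> smooth_map_on U H -> U q ->
  partial a (fun r => tri (F r) (G r) (H r) i j k) q =
  tri (vpartial a F q) (G q) (H q) i j k + tri (F q) (vpartial a G q) (H q) i j k
  + tri (F q) (G q) (vpartial a H q) i j k.
Proof.
move=> oU hF hG hH Uq.
have sF := fun l => hF l; have sG := fun l => hG l; have sH := fun l => hH l.
have sGH (l m : 'I_n) : smooth_on U (fun r => G r 0 l * H r 0 m).
  exact: (smoothM oU (hG l) (hH m)).
have dGH (l m : 'I_n) : partial a (fun r => G r 0 l * H r 0 m - G r 0 m * H r 0 l) q =
  partial a (fun r => G r 0 l) q * H q 0 m + G q 0 l * partial a (fun r => H r 0 m) q
  - (partial a (fun r => G r 0 m) q * H q 0 l + G q 0 m * partial a (fun r => H r 0 l) q).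
  rewrite (smooth_partialB oU a (sGH l m) (sGH m l) Uq).
  by rewrite (smooth_partialM a (hG l) (hH m) Uq) (smooth_partialM a (hG m) (hH l) Uq).
have sB (l m : 'I_n) : smooth_on U (fun r => G r 0 l * H r 0 m - G r 0 m * H r 0 l).
  exact: (smoothB oU (sGH l m) (sGH m l)).
have sT (o l m : 'I_n) :
    smooth_on U (fun r => F r 0 o * (G r 0 l * H r 0 m - G r 0 m * H r 0 l)).
  exact: (smoothM oU (hF o) (sB l m)).
rewrite /tri (smooth_partialD a (smoothB oU (sT i j k) (sT j i k)) (sT k i j) Uq).
rewrite (smooth_partialB oU a (sT i j k) (sT j i k) Uq).
rewrite (smooth_partialM a (hF i) (sB j k) Uq) (smooth_partialM a (hF j) (sB i k) Uq).
rewrite (smooth_partialM a (hF k) (sB i j) Uq) !dGH.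
rewrite !vpartialE; do 9!move: (partial a _ q) => ?.
ring.
Qed.

End Trivectors.

(** * Null frames on a Lorentzian patch *)

Section NullFrame.
Variables (R : realType) (n s : nat).
Local Notation "<< x , y >>" := (@scal R n s x y) (at level 0, format "<< x ,  y >>").
Implicit Types (X l : 'rV[R]_2 -> 'rV[R]_n) (D U : set 'rV[R]_2).

Lemma sum2 (V : nmodType) (F : 'I_2 -> V) : \sum_(a < 2) F a = F 0 + F 1.
Proof. by rewrite !big_ord_recl big_ord0 addr0; congr (_ + F _); apply/val_inj. Qed.

Lemma open_pos D (f : 'rV[R]_2 -> R) : open D -> (forall q, D q -> {for q, continuous f}) ->
  open [set q | D q /\ 0 < f q].
Proof.
move=> oD cf; rewrite openE => q [Dq fq]; rewrite /interior.
have n1 := open_near oD Dq.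
have n2 : \forall z \near q, 0 < f z.
  move/cvgrPdist_lt: (cf q Dq) => /(_ _ fq); apply: filterS => z.
  by rewrite ltr_norml => /andP[_]; rewrite ltrBlDr ltrDl.
exact: filterI n1 n2.
Qed.

(** A parametrized Lorentzian piece of the pseudo-sphere. The null frame is
built from the spacelike direction. *)
Record lorentz_patch D X : Prop := LorentzPatch {
  lp_open : open D;
  lp_smooth : smooth_map_on D X;
  lp_sphere : forall q, D q -> << X q, X q >> = 1;
  lp_det : forall q, D q ->
    << vpartial 0 X q, vpartial 0 X q >> * << vpartial 1 X q, vpartial 1 X q >>
      < << vpartial 0 X q, vpartial 1 X q >> ^+ 2;
  lp_spacelike : forall q, D q -> exists c d : R,
    0 < << c *: vpartial 0 X q + d *: vpartial 1 X q,
           c *: vpartial 0 X q + d *: vpartial 1 X q >> }.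

(** The tangent planes have index one, so they carry frames of null vectors. In
such a frame the trace of a symmetric tensor is twice its mixed entry, and
minimality reads as the vanishing of one component. The sign in [nf_area] fixes
the orientation of the frame. *)
Record null_frame U X l1 l2 : Prop := NullFrame {
  nf_open : open U;
  nf_sX : smooth_map_on U X;
  nf_s1 : smooth_map_on U l1;
  nf_s2 : smooth_map_on U l2;
  nf_XX : forall q, U q -> << X q, X q >> = 1;
  nf_X1 : forall q, U q -> << X q, l1 q >> = 0;
  nf_X2 : forall q, U q -> << X q, l2 q >> = 0;
  nf_11 : forall q, U q -> << l1 q, l1 q >> = 0;
  nf_22 : forall q, U q -> << l2 q, l2 q >> = 0;
  nf_12 : forall q, U q -> << l1 q, l2 q >> = 1;
  nf_dX : forall a q, U q -> vpartial a X q =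
    << vpartial a X q, l2 q >> *: l1 q + << vpartial a X q, l1 q >> *: l2 q;
  nf_area : forall q, U q ->
    << vpartial 0 X q, l2 q >> * << vpartial 1 X q, l1 q >>
    - << vpartial 1 X q, l2 q >> * << vpartial 0 X q, l1 q >> < 0 }.

(** Null vectors of the plane spanned by a spacelike [y1] and by [y2], where
[w] is the area of the parallelogram they span; the second one is normalized by
its product with the first. They are rational in [y1], [y2] and [w], hence
smooth. *)
Definition null1 (w : R) (y1 y2 : 'rV[R]_n) := (w - << y1, y2 >>) *: y1 + << y1, y1 >> *: y2.
Definition null2 (w : R) (y1 y2 : 'rV[R]_n) :=
  (2 * w ^+ 2 * << y1, y1 >>)^-1 *: ((w + << y1, y2 >>) *: y1 - << y1, y1 >> *: y2).

Lemma null_pairP (w : R) (y1 y2 : 'rV[R]_n) : 0 < << y1, y1 >> -> 0 < w ->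
  w ^+ 2 = << y1, y2 >> ^+ 2 - << y1, y1 >> * << y2, y2 >> ->
  let l1 := null1 w y1 y2 in let l2 := null2 w y1 y2 in
  [/\ << l1, l1 >> = 0, << l2, l2 >> = 0, << l1, l2 >> = 1,
    (forall c d, c *: y1 + d *: y2 = << c *: y1 + d *: y2, l2 >> *: l1
                                     + << c *: y1 + d *: y2, l1 >> *: l2) &
    << y1, l2 >> * << y2, l1 >> - << y2, l2 >> * << y1, l1 >> = - w].
Proof.
rewrite /null1 /null2; set a := << y1, y1 >>; set b := << y1, y2 >>; set c := << y2, y2 >>.
move=> a0 w0 E.
have Ec : c = (b ^+ 2 - w ^+ 2) / a.
  by rewrite E opprB addrC subrK mulrC mulKf // gt_eqF.
have wn : w != 0 by rewrite gt_eqF.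
have an : a != 0 by rewrite gt_eqF.
have P1 : << y1, (w - b) *: y1 + a *: y2 >> = w * a.
  by rewrite !scalE -/a -/b; ring.
have P2 : << y2, (w - b) *: y1 + a *: y2 >> = w * (b - w).
  by rewrite !scalE (scalC _ y2) -/a -/b -/c Ec; field.
have Q1 : << y1, (2 * w ^+ 2 * a)^-1 *: ((w + b) *: y1 - a *: y2) >> = (2 * w)^-1.
  by rewrite !scalE -/a -/b; field; rewrite wn an.
have Q2 : << y2, (2 * w ^+ 2 * a)^-1 *: ((w + b) *: y1 - a *: y2) >> = (b + w) / (2 * w * a).
  by rewrite !scalE (scalC _ y2) -/a -/b -/c Ec; field; rewrite wn an.
split=> /=.
- by rewrite scalDl !scalZl P1 P2; ring.
- by rewrite scalZl scalBl !scalZl Q1 Q2; field; rewrite wn an.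
- by rewrite scalDl !scalZl Q1 Q2; field; rewrite wn an.
- move=> u v; rewrite !scalDl !scalZl P1 P2 Q1 Q2.
  by apply/rowP => i; rewrite !mxE; field; rewrite wn an.
- by rewrite P1 P2 Q1 Q2; field; rewrite wn an.
Qed.

Lemma exists_null_frame D X q0 : lorentz_patch D X -> D q0 ->
  exists U l1 l2, [/\ U q0, U `<=` D & null_frame U X l1 l2].
Proof.
move=> LP Dq0; have [oD sX XX dt sp] := LP.
have [c [d pos]] := sp q0 Dq0.
(* A similarity of the coordinate frame, of determinant [c ^+ 2 + d ^+ 2], makes
   its first vector spacelike. *)
pose y1 q := c *: vpartial 0 X q + d *: vpartial 1 X q.
pose y2 q := - d *: vpartial 0 X q + c *: vpartial 1 X q.
pose U := [set q | D q /\ 0 < << y1 q, y1 q >>].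
have s0 := smooth_vpartial oD 0 sX; have s1 := smooth_vpartial oD 1 sX.
have sy1 : smooth_map_on D y1.
  by apply: (smoothvD oD); apply: (smoothvZ oD) => //; exact: smooth_cst.
have sy2 : smooth_map_on D y2.
  by apply: (smoothvD oD); apply: (smoothvZ oD) => //; exact: smooth_cst.
have oU : open U.
  by apply: open_pos => // q Dq; apply: smooth_continuous Dq; exact: smooth_scal.
have UD : U `<=` D by move=> q [].
have sub (f : 'rV[R]_2 -> 'rV[R]_n) : smooth_map_on D f -> smooth_map_on U f.
  by move=> h j; exact: (smooth_sub UD (h j)).
pose E q := << y1 q, y2 q >> ^+ 2 - << y1 q, y1 q >> * << y2 q, y2 q >>.
pose x0 q := vpartial 0 X q; pose x1 q := vpartial 1 X q.
have cd0 : 0 < c ^+ 2 + d ^+ 2.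
  rewrite lt_neqAle addr_ge0 ?sqr_ge0 // andbT eq_sym.
  apply: contraTneq pos => /eqP.
  rewrite paddr_eq0 ?sqr_ge0 // !sqrf_eq0 => /andP[/eqP -> /eqP ->].
  by rewrite !scale0r addr0 scal0l ltxx.
have EE q : E q = (c ^+ 2 + d ^+ 2) ^+ 2 *
    (<< x0 q, x1 q >> ^+ 2 - << x0 q, x0 q >> * << x1 q, x1 q >>).
  rewrite /E /y1 /y2 -/(x0 q) -/(x1 q); move: (x0 q) (x1 q) => u v.
  by rewrite !scalE !(scalC _ v u); ring.
have E0 q : U q -> 0 < E q.
  move=> [Dq yq]; rewrite EE mulr_gt0 ?subr_gt0 //; last exact: dt.
  by rewrite exprn_gt0.
pose w q := Num.sqrt (E q).
have w0 q : U q -> 0 < w q by move=> /E0; rewrite sqrtr_gt0.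
have ww q : U q -> w q ^+ 2 = E q by move=> /E0/ltW; exact: sqr_sqrtr.
have Xy q : D q -> << X q, x0 q >> = 0 /\ << X q, x1 q >> = 0.
  move=> Dq; have P a : << X q, vpartial a X q >> = 0; last by split; exact: P.
  have := partial_scal s oD a sX sX Dq; rewrite (eq_partial (g := fun=> 1) a oD) //.
  rewrite partial_cst (scalC s (vpartial a X q)) -mulr2n => /esym/eqP.
  by rewrite mulrn_eq0 /= => /eqP.
pose l1 q := null1 (w q) (y1 q) (y2 q); pose l2 q := null2 (w q) (y1 q) (y2 q).
have yx q : D q -> << X q, y1 q >> = 0 /\ << X q, y2 q >> = 0.
  move=> /Xy[]; rewrite /y1 /y2 -/(x0 q) -/(x1 q); move: (X q) (x0 q) (x1 q) => x u v h0 h1.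
  by rewrite !(scalDr, scalZr) h0 h1 !mulr0 addr0.
exists U, l1, l2; split; [by []|exact: UD|].
have NP q : U q -> _ := fun Uq => null_pairP (proj2 Uq) (w0 _ Uq) (ww _ Uq).
have sE : smooth_on U E.
  have a11 := smooth_scal s oU (sub _ sy1) (sub _ sy1).
  have a12 := smooth_scal s oU (sub _ sy1) (sub _ sy2).
  have a22 := smooth_scal s oU (sub _ sy2) (sub _ sy2).
  exact: (smoothB oU (smoothM oU a12 a12) (smoothM oU a11 a22)).
have sw : smooth_on U w by exact: (smooth_sqrt oU E0 sE).
split.
- exact: oU.
- exact: sub.
- have a11 := smooth_scal s oU (sub _ sy1) (sub _ sy1).
  have a12 := smooth_scal s oU (sub _ sy1) (sub _ sy2).
  exact: (smoothvD oU (smoothvZ oU (smoothB oU sw a12) (sub _ sy1))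
    (smoothvZ oU a11 (sub _ sy2))).
- have a11 := smooth_scal s oU (sub _ sy1) (sub _ sy1).
  have a12 := smooth_scal s oU (sub _ sy1) (sub _ sy2).
  have k : smooth_on U (fun q => 2 * w q ^+ 2 * << y1 q, y1 q >>).
    exact: (smoothM oU (smoothM oU (smooth_cst 2) (smoothM oU sw sw)) a11).
  have kV : smooth_on U (fun q => (2 * w q ^+ 2 * << y1 q, y1 q >>)^-1).
    apply: (smoothV oU _ k) => q Uq; have wq := w0 q Uq; have [_ yq] := Uq.
    by apply: lt0r_neq0; rewrite mulr_gt0 ?yq // mulr_gt0 // exprn_gt0.
  exact: (smoothvZ oU kV (smoothvB oU (smoothvZ oU (smoothD oU sw a12) (sub _ sy1))
    (smoothvZ oU a11 (sub _ sy2)))).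
- by move=> q /UD/XX.
- move=> q /UD/yx[]; rewrite /l1 /null1; move: (X q) (y1 q) (y2 q) => x u v h1 h2.
  by rewrite !(scalDr, scalZr) h1 h2 !mulr0 addr0.
- move=> q /UD/yx[]; rewrite /l2 /null2; move: (X q) (y1 q) (y2 q) => x u v h1 h2.
  by rewrite !(scalBr, scalZr) h1 h2 !mulr0 subr0 mulr0.
- by move=> q /NP[].
- by move=> q /NP[].
- by move=> q /NP[].
- move=> a q Uq; have [Dq yq] := Uq; have [_ _ _ span _] := NP q Uq.
  have k0 : c ^+ 2 + d ^+ 2 != 0 by rewrite gt_eqF.
  have e0 : x0 q = (c / (c ^+ 2 + d ^+ 2)) *: y1 q + (- d / (c ^+ 2 + d ^+ 2)) *: y2 q.
    rewrite /y1 /y2 -/(x0 q) -/(x1 q); move: (x0 q) (x1 q) => u v.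
    by apply/rowP => i; rewrite !mxE; field.
  have e1 : x1 q = (d / (c ^+ 2 + d ^+ 2)) *: y1 q + (c / (c ^+ 2 + d ^+ 2)) *: y2 q.
    rewrite /y1 /y2 -/(x0 q) -/(x1 q); move: (x0 q) (x1 q) => u v.
    by apply/rowP => i; rewrite !mxE; field.
  have [-> | ->] : a = 0 \/ a = 1.
    by case: a => -[|[|//]] h; [left|right]; exact/val_inj.
  + by rewrite -/(x0 q) e0; exact: span.
  + by rewrite -/(x1 q) e1; exact: span.
- move=> q Uq; have [Dq yq] := Uq; have [_ _ _ _ ar] := NP q Uq.
  rewrite -/(x0 q) -/(x1 q).
  rewrite -(pmulr_rlt0 _ cd0).
  have -> : (c ^+ 2 + d ^+ 2) * (<< x0 q, l2 q >> * << x1 q, l1 q >> -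
      << x1 q, l2 q >> * << x0 q, l1 q >>) =
     << y1 q, l2 q >> * << y2 q, l1 q >> - << y2 q, l2 q >> * << y1 q, l1 q >>.
    rewrite /y1 /y2 -/(x0 q) -/(x1 q); move: (x0 q) (x1 q) (l1 q) (l2 q) => u v y z.
    by rewrite !(scalDl, scalZl); ring.
  by rewrite ar oppr_lt0 w0.
Qed.

End NullFrame.

(** * Structure equations of a null frame *)

Section StructureEquations.
Variables (R : realType) (n s : nat).
Local Notation "<< x , y >>" := (@scal R n s x y) (at level 0, format "<< x ,  y >>").
Variables (U : set 'rV[R]_2) (X l1 l2 : 'rV[R]_2 -> 'rV[R]_n).
Hypothesis NF : null_frame s U X l1 l2.

(** The components of the differential of [X] along [l1] and [l2], and the
connection form of the frame. *)
Definition theta a q := << vpartial a X q, l2 q >>.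
Definition phi a q := << vpartial a X q, l1 q >>.
Definition rot a q := << vpartial a l1 q, l2 q >>.
Definition area q := theta 0 q * phi 1 q - theta 1 q * phi 0 q.

(** The normal parts of the derivatives of [l1] and [l2]. *)
Definition kap a q := locked (vpartial a l1 q - rot a q *: l1 q + phi a q *: X q).
Definition mu a q := locked (vpartial a l2 q + rot a q *: l2 q + theta a q *: X q).

(** The second fundamental form on the pairs of frame vectors, recovered from
its values [kap] and [mu] on a frame vector and a coordinate vector by Cramer's
rule. *)
Definition sff11 q := locked ((area q)^-1 *: (phi 1 q *: kap 0 q - phi 0 q *: kap 1 q)).
Definition sff12 q := locked ((area q)^-1 *: (theta 0 q *: kap 1 q - theta 1 q *: kap 0 q)).
Definition sff22 q := locked ((area q)^-1 *: (theta 0 q *: mu 1 q - theta 1 q *: mu 0 q)).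

Let oU := nf_open NF.
Let sX := nf_sX NF.
Let s1 := nf_s1 NF.
Let s2 := nf_s2 NF.

Lemma thetaE a q : << vpartial a X q, l2 q >> = theta a q. Proof. by []. Qed.
Lemma phiE a q : << vpartial a X q, l1 q >> = phi a q. Proof. by []. Qed.
Lemma rotE a q : << vpartial a l1 q, l2 q >> = rot a q. Proof. by []. Qed.

Lemma area_neq0 q : U q -> area q != 0.
Proof. by move=> /(nf_area NF) h; rewrite lt_eqF. Qed.

Lemma smooth_theta a : smooth_on U (theta a).
Proof. exact: (smooth_scal s oU (smooth_vpartial oU a sX) s2). Qed.

Lemma smooth_phi a : smooth_on U (phi a).
Proof. exact: (smooth_scal s oU (smooth_vpartial oU a sX) s1). Qed.

Lemma smooth_rot a : smooth_on U (rot a).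
Proof. exact: (smooth_scal s oU (smooth_vpartial oU a s1) s2). Qed.

Lemma smooth_areaV : smooth_on U (fun q => (area q)^-1).
Proof.
apply: (smoothV oU area_neq0).
exact: (smoothB oU (smoothM oU (smooth_theta 0) (smooth_phi 1))
  (smoothM oU (smooth_theta 1) (smooth_phi 0))).
Qed.

Lemma kapE a q : kap a q = vpartial a l1 q - rot a q *: l1 q + phi a q *: X q.
Proof. by rewrite /kap -lock. Qed.

Lemma muE a q : mu a q = vpartial a l2 q + rot a q *: l2 q + theta a q *: X q.
Proof. by rewrite /mu -lock. Qed.

Lemma sff11E q : sff11 q = (area q)^-1 *: (phi 1 q *: kap 0 q - phi 0 q *: kap 1 q).
Proof. by rewrite /sff11 -lock. Qed.

Lemma sff12E q : sff12 q = (area q)^-1 *: (theta 0 q *: kap 1 q - theta 1 q *: kap 0 q).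
Proof. by rewrite /sff12 -lock. Qed.

Lemma sff22E q : sff22 q = (area q)^-1 *: (theta 0 q *: mu 1 q - theta 1 q *: mu 0 q).
Proof. by rewrite /sff22 -lock. Qed.

Lemma smooth_kap a : smooth_map_on U (kap a).
Proof.
rewrite (funext (kapE a)).
exact: (smoothvD oU (smoothvB oU (smooth_vpartial oU a s1) (smoothvZ oU (smooth_rot a) s1))
  (smoothvZ oU (smooth_phi a) sX)).
Qed.

Lemma smooth_mu a : smooth_map_on U (mu a).
Proof.
rewrite (funext (muE a)).
exact: (smoothvD oU (smoothvD oU (smooth_vpartial oU a s2) (smoothvZ oU (smooth_rot a) s2))
  (smoothvZ oU (smooth_theta a) sX)).
Qed.

Lemma smooth_sff11 : smooth_map_on U sff11.
Proof.
rewrite (funext sff11E).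
exact: (smoothvZ oU smooth_areaV (smoothvB oU (smoothvZ oU (smooth_phi 1) (smooth_kap 0))
  (smoothvZ oU (smooth_phi 0) (smooth_kap 1)))).
Qed.

Lemma scal_cst_derive (f g : 'rV[R]_2 -> 'rV[R]_n) c a q :
  smooth_map_on U f -> smooth_map_on U g -> (forall z, U z -> << f z, g z >> = c) ->
  U q -> << vpartial a f q, g q >> = - << f q, vpartial a g q >>.
Proof.
move=> hf hg E Uq; apply/eqP; rewrite -addr_eq0; apply/eqP.
rewrite -(partial_scal s oU a hf hg Uq) (eq_partial (g := fun=> c) a oU E Uq).
exact: partial_cst.
Qed.

Lemma scal_self_derive (f : 'rV[R]_2 -> 'rV[R]_n) c a q : smooth_map_on U f ->
  (forall z, U z -> << f z, f z >> = c) -> U q -> << vpartial a f q, f q >> = 0.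
Proof.
move=> hf E Uq; have := scal_cst_derive a hf hf E Uq.
rewrite (scalC s (f q)) => /eqP; rewrite -addr_eq0 -mulr2n mulrn_eq0 /= => /eqP.
exact.
Qed.

Lemma dX_X a q : U q -> << vpartial a X q, X q >> = 0.
Proof. by move=> Uq; exact: (scal_self_derive a sX (nf_XX NF) Uq). Qed.

Lemma dl1_l1 a q : U q -> << vpartial a l1 q, l1 q >> = 0.
Proof. by move=> Uq; exact: (scal_self_derive a s1 (nf_11 NF) Uq). Qed.

Lemma dl2_l2 a q : U q -> << vpartial a l2 q, l2 q >> = 0.
Proof. by move=> Uq; exact: (scal_self_derive a s2 (nf_22 NF) Uq). Qed.

Lemma dl1_X a q : U q -> << vpartial a l1 q, X q >> = - phi a q.
Proof.
move=> Uq; have := scal_cst_derive a sX s1 (nf_X1 NF) Uq.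
by rewrite (scalC s (X q)) -/(phi a q) => ->; rewrite opprK.
Qed.

Lemma dl2_X a q : U q -> << vpartial a l2 q, X q >> = - theta a q.
Proof.
move=> Uq; have := scal_cst_derive a sX s2 (nf_X2 NF) Uq.
by rewrite (scalC s (X q)) -/(theta a q) => ->; rewrite opprK.
Qed.

Lemma dl2_l1 a q : U q -> << vpartial a l2 q, l1 q >> = - rot a q.
Proof.
move=> Uq; have := scal_cst_derive a s1 s2 (nf_12 NF) Uq.
by rewrite (scalC s (l1 q)) -/(rot a q) => ->; rewrite opprK.
Qed.

Lemma dX_frame a q : U q -> vpartial a X q = theta a q *: l1 q + phi a q *: l2 q.
Proof. exact: nf_dX. Qed.

Lemma dl1_frame a q : vpartial a l1 q = rot a q *: l1 q + kap a q - phi a q *: X q.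
Proof.
rewrite kapE; move: (vpartial a l1 q) (rot a q) (phi a q) (l1 q) (X q) => *; apply/rowP => i; rewrite !mxE; ring.
Qed.

Lemma dl2_frame a q : vpartial a l2 q = - rot a q *: l2 q + mu a q - theta a q *: X q.
Proof.
rewrite muE; move: (vpartial a l2 q) (rot a q) (theta a q) (l2 q) (X q) => *; apply/rowP => i; rewrite !mxE; ring.
Qed.

Definition normal q (w : 'rV[R]_n) :=
  [/\ << w, X q >> = 0, << w, l1 q >> = 0 & << w, l2 q >> = 0].

Lemma frame_scal q : U q ->
  ([/\ << X q, X q >> = 1, << X q, l1 q >> = 0 & << X q, l2 q >> = 0] *
   [/\ << l1 q, X q >> = 0, << l1 q, l1 q >> = 0 & << l1 q, l2 q >> = 1] *
   [/\ << l2 q, X q >> = 0, << l2 q, l1 q >> = 1 & << l2 q, l2 q >> = 0])%type.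
Proof.
move=> Uq; have x1 := nf_X1 NF Uq; have x2 := nf_X2 NF Uq; have l12 := nf_12 NF Uq.
have k1 : << l1 q, X q >> = 0 by rewrite scalC.
have m1 : << l2 q, X q >> = 0 by rewrite scalC.
have m2 : << l2 q, l1 q >> = 1 by rewrite scalC.
exact: (And3 (nf_XX NF Uq) x1 x2, And3 k1 (nf_11 NF Uq) l12, And3 m1 m2 (nf_22 NF Uq)).
Qed.

Lemma normal_kap a q : U q -> normal q (kap a q).
Proof.
move=> Uq; have [[[xx x1 x2] [k1 k2 k3]] [m1 m2 m3]] := frame_scal Uq.
have e1 := dl1_X a Uq; have e2 := dl1_l1 a Uq; have e3 : << vpartial a l1 q, l2 q >> = rot a q by [].
move: e1 e2 e3; rewrite kapE; move: (vpartial a l1 q) (phi a q) (rot a q) => v p r e1 e2 e3.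
by split; rewrite !(scalDl, scalNl, scalZl) ?e1 ?e2 ?e3 ?xx ?x1 ?x2 ?k1 ?k2 ?k3; ring.
Qed.

Lemma normal_mu a q : U q -> normal q (mu a q).
Proof.
move=> Uq; have [[[xx x1 x2] [k1 k2 k3]] [m1 m2 m3]] := frame_scal Uq.
have e1 := dl2_X a Uq; have e2 := dl2_l2 a Uq; have e3 := dl2_l1 a Uq.
move: e1 e2 e3; rewrite muE; move: (vpartial a l2 q) (theta a q) (rot a q) => v p r e1 e2 e3.
by split; rewrite !(scalDl, scalNl, scalZl) ?e1 ?e2 ?e3 ?xx ?x1 ?x2 ?m1 ?m2 ?m3; ring.
Qed.

Lemma normalZD q c d v w : normal q v -> normal q w -> normal q (c *: v + d *: w).
Proof.
move=> [v1 v2 v3] [w1 w2 w3].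
by split; rewrite scalDl !scalZl ?v1 ?v2 ?v3 ?w1 ?w2 ?w3 !mulr0 addr0.
Qed.

Lemma normalZ q c v : normal q v -> normal q (c *: v).
Proof. by move=> h; have := normalZD c 0 h h; rewrite scale0r addr0. Qed.

(** The span of [X], [l1] and [l2] is nondegenerate, hence so is its orthogonal
complement: a normal vector is tested against normal vectors only. *)
Lemma normal_nondegenerate q v : U q -> normal q v ->
  (forall w, normal q w -> << v, w >> = 0) -> v = 0.
Proof.
move=> Uq [v1 v2 v3] h; apply: (@scal_nondegenerate R n s) => y.
have [[[xx x1 x2] [k1 k2 k3]] [m1 m2 m3]] := frame_scal Uq.
have := h (y - << y, X q >> *: X q - << y, l2 q >> *: l1 q - << y, l1 q >> *: l2 q).
rewrite !(scalDr, scalNr, scalZr) v1 v2 v3 !mulr0 !subr0; apply.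
by split; rewrite !(scalDl, scalNl, scalZl) ?xx ?x1 ?x2 ?k1 ?k2 ?k3 ?m1 ?m2 ?m3; ring.
Qed.

Lemma frame_coordinates q t t' p p' c c' u v : U q -> normal q u -> normal q v ->
  t *: l1 q + p *: l2 q + u - c *: X q = t' *: l1 q + p' *: l2 q + v - c' *: X q ->
  [/\ t = t', p = p' & u = v].
Proof.
move=> Uq; have [[[xx x1 x2] [k1 k2 k3]] [m1 m2 m3]] := frame_scal Uq.
move=> [u1 u2 u3] [v1 v2 v3] E.
have E0 := congr1 (fun y => << y, X q >>) E.
have E1 := congr1 (fun y => << y, l1 q >>) E; have E2 := congr1 (fun y => << y, l2 q >>) E.
have ec : c = c'.
  move: E0; rewrite /= !(scalDl, scalNl, scalZl) xx k1 m1 u1 v1; lra.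
have et : t = t'.
  by move: E2; rewrite /= !(scalDl, scalNl, scalZl) x2 k3 m3 u3 v3; lra.
have ep : p = p'.
  by move: E1; rewrite /= !(scalDl, scalNl, scalZl) x1 k2 m2 u2 v2; lra.
by split=> //; move: E; rewrite et ep ec => /addIr/addrI.
Qed.

Lemma d2X_frame a b q : U q -> vpartial b (vpartial a X) q =
  (partial b (theta a) q + theta a q * rot b q) *: l1 q
  + (partial b (phi a) q - phi a q * rot b q) *: l2 q
  + (theta a q *: kap b q + phi a q *: mu b q)
  - (theta a q * phi b q + phi a q * theta b q) *: X q.
Proof.
move=> Uq; rewrite (eq_vpartial oU b (g := fun z => theta a z *: l1 z + phi a z *: l2 z) _ Uq).
  rewrite (vpartialD oU b (smoothvZ oU (smooth_theta a) s1) (smoothvZ oU (smooth_phi a) s2) Uq).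
  rewrite (vpartialZ oU b (smooth_theta a) s1 Uq) (vpartialZ oU b (smooth_phi a) s2 Uq).
  rewrite dl1_frame dl2_frame; move: (partial b _ q) => c; move: (partial b _ q) => d.
  move: (theta a q) (phi a q) (theta b q) (phi b q) (rot b q) => ? ? ? ? ?.
  move: (l1 q) (l2 q) (kap b q) (mu b q) (X q) => ? ? ? ? ?.
  by apply/rowP => i; rewrite !mxE; ring.
by move=> z; exact: dX_frame.
Qed.

(** The second derivatives of [X] commute. Their tangential parts say that the
connection has no torsion, their normal part that the second fundamental form
is symmetric. *)
Lemma torsion_free q : U q ->
  [/\ partial 1 (theta 0) q + theta 0 q * rot 1 q = partial 0 (theta 1) q + theta 1 q * rot 0 q,
    partial 1 (phi 0) q - phi 0 q * rot 1 q = partial 0 (phi 1) q - phi 1 q * rot 0 q &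
    theta 0 q *: kap 1 q + phi 0 q *: mu 1 q = theta 1 q *: kap 0 q + phi 1 q *: mu 0 q].
Proof.
move=> Uq; have := vpartialC oU 1 0 sX Uq.
rewrite (d2X_frame 0 1 Uq) (d2X_frame 1 0 Uq).
have nu := normalZD (theta 0 q) (phi 0 q) (normal_kap 1 Uq) (normal_mu 1 Uq).
have nv := normalZD (theta 1 q) (phi 1 q) (normal_kap 0 Uq) (normal_mu 0 Uq).
by move=> E; exact: (frame_coordinates Uq nu nv E).
Qed.

Lemma addr_swap (V : zmodType) (a b c d : V) : a + b = c + d -> a - c = d - b.
Proof. by move=> S; rewrite -[a](addrK b) S addrAC [c + d]addrC addrK. Qed.

Lemma kap_sff a q : U q -> kap a q = theta a q *: sff11 q + phi a q *: sff12 q.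
Proof.
move=> Uq; have A := area_neq0 Uq; rewrite sff11E sff12E.
have [-> | ->] : a = 0 \/ a = 1 by case: a => -[|[|//]] h; [left|right]; exact/val_inj.
  move: A; rewrite /area; move: (kap 0 q) (kap 1 q) (theta 0 q) (theta 1 q) (phi 0 q) (phi 1 q) => u v ? ? ? ? A;
    apply/rowP => i; rewrite !mxE; field; exact: A.
  move: A; rewrite /area; move: (kap 0 q) (kap 1 q) (theta 0 q) (theta 1 q) (phi 0 q) (phi 1 q) => u v ? ? ? ? A;
  apply/rowP => i; rewrite !mxE; field; exact: A.
Qed.

Lemma mu_sff a q : U q -> mu a q = theta a q *: sff12 q + phi a q *: sff22 q.
Proof.
move=> Uq; have A := area_neq0 Uq; have [_ _ S] := torsion_free Uq.
have -> : sff12 q = (area q)^-1 *: (phi 1 q *: mu 0 q - phi 0 q *: mu 1 q).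
  rewrite sff12E; congr (_ *: _); exact: addr_swap S.
rewrite sff22E.
have [-> | ->] : a = 0 \/ a = 1 by case: a => -[|[|//]] h; [left|right]; exact/val_inj.
  move: A; rewrite /area; move: (mu 0 q) (mu 1 q) (theta 0 q) (theta 1 q) (phi 0 q) (phi 1 q) => u v ? ? ? ? A;
    apply/rowP => i; rewrite !mxE; field; exact: A.
  move: A; rewrite /area; move: (mu 0 q) (mu 1 q) (theta 0 q) (theta 1 q) (phi 0 q) (phi 1 q) => u v ? ? ? ? A;
  apply/rowP => i; rewrite !mxE; field; exact: A.
Qed.

Lemma scal_kap a q w : U q ->
  << kap a q, w >> = theta a q * << sff11 q, w >> + phi a q * << sff12 q, w >>.
Proof.
move=> Uq; rewrite (kap_sff a Uq); move: (sff11 q) (sff12 q) (theta a q) (phi a q) => *.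
by rewrite scalDl !scalZl.
Qed.

Lemma scal_mu a q w : U q ->
  << mu a q, w >> = theta a q * << sff12 q, w >> + phi a q * << sff22 q, w >>.
Proof.
move=> Uq; rewrite (mu_sff a Uq); move: (sff12 q) (sff22 q) (theta a q) (phi a q) => *.
by rewrite scalDl !scalZl.
Qed.

Lemma normal_sff11 q : U q -> normal q (sff11 q).
Proof.
move=> Uq; rewrite sff11E; apply: normalZ; rewrite -scaleNr.
exact: (normalZD _ _ (normal_kap 0 Uq) (normal_kap 1 Uq)).
Qed.

Lemma normal_sff12 q : U q -> normal q (sff12 q).
Proof.
move=> Uq; rewrite sff12E; apply: normalZ; rewrite -scaleNr.
exact: (normalZD _ _ (normal_kap 1 Uq) (normal_kap 0 Uq)).
Qed.

Lemma normal_sff22 q : U q -> normal q (sff22 q).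
Proof.
move=> Uq; rewrite sff22E; apply: normalZ; rewrite -scaleNr.
exact: (normalZD _ _ (normal_mu 1 Uq) (normal_mu 0 Uq)).
Qed.

End StructureEquations.

(** * The Laplacian of the frame trivector *)

Section PatchLaplacian.
Variables (R : realType) (n s : nat) (X : 'rV[R]_2 -> 'rV[R]_n).

Definition gmx q : 'M[R]_2 := \matrix_(a, b) scal s (vpartial a X q) (vpartial b X q).

Definition chris q (k a b : 'I_2) : R :=
  2^-1 * \sum_l invmx (gmx q) k l *
    (partial a (fun r => gmx r b l) q + partial b (fun r => gmx r a l) q
     - partial l (fun r => gmx r a b) q).

(** The Laplacian of the induced metric in coordinates, minus the trace of the
second covariant derivative. *)
Definition patch_laplacian (F : 'rV[R]_2 -> R) q : R :=
  - \sum_a \sum_b invmx (gmx q) a b *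
      (partial a (partial b F) q - \sum_k chris q k a b * partial k F q).

Lemma patch_laplacianE F q (P : 'I_2 -> R) (H : 'I_2 -> 'I_2 -> R) :
  (forall b, partial b F q = P b) -> (forall a b, partial a (partial b F) q = H a b) ->
  patch_laplacian F q =
  - \sum_a \sum_b invmx (gmx q) a b * (H a b - \sum_k chris q k a b * P k).
Proof.
move=> hP hH; congr (- _); apply: eq_bigr => a _; apply: eq_bigr => b _.
by rewrite hH; congr (_ * (_ - _)); apply: eq_bigr => k _; rewrite hP.
Qed.

End PatchLaplacian.

Section ContractCombinations.
Variables (R : realType) (n s : nat) (x y z : 'rV[R]_n).
Implicit Types t : 'I_n -> 'I_n -> 'I_n -> R.

Lemma contract_trace (G : 'I_2 -> 'I_2 -> R) (C : 'I_2 -> R) (t1 : 'I_2 -> _)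
    (t2 : 'I_2 -> 'I_2 -> _) t (lam : R) :
  (forall i j l, (G 0 0 * t2 0 0 i j l + G 0 1 * t2 0 1 i j l
    + (G 1 0 * t2 1 0 i j l + G 1 1 * t2 1 1 i j l))
    + (C 0 * t1 0 i j l + C 1 * t1 1 i j l) + lam * t i j l = 0) ->
  (forall b, contract s x y z (t1 b) = 0) ->
  \sum_a \sum_b G a b * contract s x y z (t2 a b) = - lam * contract s x y z t.
Proof.
move=> E t10; have := contract_eq s x y z E.
rewrite contract0 !contractD !contractZ !t10 !mulr0 !addr0 !sum2 mulNr => /eqP.
by rewrite addr_eq0 => /eqP.
Qed.

Lemma contract_tri2 (f1 g1 h1 f2 g2 h2 : 'rV[R]_n) :
  contract s x y z (fun i j l => tri f1 g1 h1 i j l + tri f2 g2 h2 i j l) =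
  gram3 s f1 g1 h1 x y z + gram3 s f2 g2 h2 x y z.
Proof. by rewrite contractD !contract_tri. Qed.

Lemma contract_tri6 (f1 g1 h1 f2 g2 h2 f3 g3 h3 f4 g4 h4 f5 g5 h5 f6 g6 h6 : 'rV[R]_n) :
  contract s x y z (fun i j l =>
    tri f1 g1 h1 i j l + tri f2 g2 h2 i j l + tri f3 g3 h3 i j l
    + (tri f4 g4 h4 i j l + tri f5 g5 h5 i j l + tri f6 g6 h6 i j l)) =
  gram3 s f1 g1 h1 x y z + gram3 s f2 g2 h2 x y z + gram3 s f3 g3 h3 x y z
  + (gram3 s f4 g4 h4 x y z + gram3 s f5 g5 h5 x y z + gram3 s f6 g6 h6 x y z).
Proof. by rewrite -!contract_tri -!contractD. Qed.

End ContractCombinations.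

Section EigenEquation.
Variables (R : realType) (n s : nat).
Local Notation "<< x , y >>" := (@scal R n s x y) (at level 0, format "<< x ,  y >>").
Variables (U : set 'rV[R]_2) (X l1 l2 : 'rV[R]_2 -> 'rV[R]_n).
Hypothesis NF : null_frame s U X l1 l2.
Let oU := nf_open NF.
Let sX := nf_sX NF.
Let s1 := nf_s1 NF.
Let s2 := nf_s2 NF.
Local Notation th := (theta s X l2).
Local Notation ph := (phi s X l1).
Local Notation rt := (rot s l1 l2).
Local Notation ka := (kap s X l1 l2).
Local Notation mm := (mu s X l1 l2).
Local Notation ar := (area s X l1 l2).
Local Notation II11 := (sff11 s X l1 l2).
Local Notation II12 := (sff12 s X l1 l2).
Local Notation II22 := (sff22 s X l1 l2).
Local Notation nor := (normal s X l1 l2).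

(** Components of [l1] and [l2] in the coordinate frame; the inverse metric is
their symmetric product. *)
Definition up1 (a : 'I_2) q : R := (if a == 0 then ph 1 q else - ph 0 q) / ar q.
Definition up2 (a : 'I_2) q : R := (if a == 0 then - th 1 q else th 0 q) / ar q.

Lemma up_pairings q : U q ->
  [/\ up1 0 q * th 0 q + up1 1 q * th 1 q = 1, up1 0 q * ph 0 q + up1 1 q * ph 1 q = 0,
      up2 0 q * th 0 q + up2 1 q * th 1 q = 0 & up2 0 q * ph 0 q + up2 1 q * ph 1 q = 1].
Proof.
move=> Uq; have := area_neq0 NF Uq; rewrite /up1 /up2 /area /=.
move: (th 0 q) (th 1 q) (ph 0 q) (ph 1 q) => *.
by split; field.
Qed.

Lemma gmx_frame a b q : U q -> gmx s X q a b = th a q * ph b q + ph a q * th b q.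
Proof.
move=> Uq; have [[[xx x1 x2] [k1 k2 k3]] [m1 m2 m3]] := frame_scal NF Uq.
rewrite mxE (dX_frame NF a Uq) (dX_frame NF b Uq).
move: (th a q) (th b q) (ph a q) (ph b q) => *.
by rewrite !(scalDl, scalDr, scalZl, scalZr) k2 k3 m2 m3; ring.
Qed.

Lemma ord2 (a : 'I_2) : a = 0 \/ a = 1.
Proof. by case: a => -[|[|//]] h; [left|right]; exact/val_inj. Qed.

Lemma invmx_gmx q : U q ->
  invmx (gmx s X q) = \matrix_(a, b) (up1 a q * up2 b q + up2 a q * up1 b q).
Proof.
move=> Uq; set B := \matrix_(a, b) _.
have [a1 a2 a3 a4] := up_pairings Uq.
have E : gmx s X q *m B = 1%:M.
  apply/matrixP => a b; rewrite !mxE sum2 !(gmx_frame _ _ Uq) !mxE.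
  move: a1 a2 a3 a4; rewrite /up1 /up2.
  have := area_neq0 NF Uq; rewrite /area.
  case: (ord2 a) => ->; case: (ord2 b) => -> /=;
  move: (th 0 q) (th 1 q) (ph 0 q) (ph 1 q) => t0 t1 p0 p1 A _ _ _ _;
  by rewrite ?mulr1n ?mulr0n; field.
have [uG _] := mulmx1_unit E.
by rewrite -[LHS]mulmx1 -E mulKmx.
Qed.

Definition trace q (H : 'I_2 -> 'I_2 -> R) : R :=
  \sum_a \sum_b invmx (gmx s X q) a b * H a b.

Lemma trace_mul q (u v : 'I_2 -> R) : U q ->
  trace q (fun a b => u a * v b) =
  (up1 0 q * u 0 + up1 1 q * u 1) * (up2 0 q * v 0 + up2 1 q * v 1)
  + (up2 0 q * u 0 + up2 1 q * u 1) * (up1 0 q * v 0 + up1 1 q * v 1).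
Proof.
move=> Uq; rewrite /trace invmx_gmx // !sum2 !mxE.
move: (up1 0 q) (up1 1 q) (up2 0 q) (up2 1 q) => *; ring.
Qed.

Lemma traceD q H H' : trace q (fun a b => H a b + H' a b) = trace q H + trace q H'.
Proof. by rewrite /trace !sum2 !mulrDr; ring. Qed.

Lemma traceZ q c H : trace q (fun a b => c * H a b) = c * trace q H.
Proof. by rewrite /trace !sum2; ring. Qed.

Lemma eq_trace q H H' : (forall a b, H a b = H' a b) -> trace q H = trace q H'.
Proof. by move=> E; rewrite /trace !sum2 !E. Qed.

Lemma tri_frame (x u v k m : 'rV[R]_n) (t p r : R) i j l :
  tri (t *: u + p *: v) u v i j l + tri x (r *: u + k - p *: x) v i j l
  + tri x u (- r *: v + m - t *: x) i j l = tri x k v i j l + tri x u m i j l.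
Proof. by rewrite /tri !mxE; ring. Qed.

(** Differentiating the trivector along a tangent direction replaces one of the
tangent factors by the second fundamental form; the other terms cancel or
repeat a factor. *)
Lemma dtri b q i j l : U q -> partial b (fun r => tri (X r) (l1 r) (l2 r) i j l) q =
  tri (X q) (ka b q) (l2 q) i j l + tri (X q) (l1 q) (mm b q) i j l.
Proof.
move=> Uq; rewrite (partial_tri b i j l oU sX s1 s2 Uq).
rewrite (dX_frame NF b Uq) (dl1_frame s X l1 l2) (dl2_frame s X l1 l2).
exact: tri_frame.
Qed.

Lemma d2tri a b q i j l : U q ->
  partial a (partial b (fun r => tri (X r) (l1 r) (l2 r) i j l)) q =
  tri (vpartial a X q) (ka b q) (l2 q) i j l + tri (X q) (vpartial a (ka b) q) (l2 q) i j l
  + tri (X q) (ka b q) (vpartial a l2 q) i j l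
  + (tri (vpartial a X q) (l1 q) (mm b q) i j l + tri (X q) (vpartial a l1 q) (mm b q) i j l
  + tri (X q) (l1 q) (vpartial a (mm b) q) i j l).
Proof.
move=> Uq; rewrite (eq_partial a oU (fun z Uz => dtri b i j l Uz) Uq).
have sk := smooth_kap NF b; have sm := smooth_mu NF b.
rewrite (smooth_partialD a (smooth_tri i j l oU sX sk s2) (smooth_tri i j l oU sX s1 sm) Uq).
by rewrite (partial_tri a i j l oU sX sk s2 Uq) (partial_tri a i j l oU sX s1 sm Uq).
Qed.

Variable lam : R.
Hypothesis eigen : forall q i j l, U q ->
  patch_laplacian s X (fun r => tri (X r) (l1 r) (l2 r) i j l) q =
  lam * tri (X q) (l1 q) (l2 q) i j l.

Local Notation g3 := (@gram3 R n s).

(** A contraction that annihilates the first derivatives of the Gauss map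
removes the Christoffel symbols from the eigenvalue equation, which leaves the
second derivatives alone. *)
Lemma eigen_contract q x y z : U q ->
  (forall b, g3 (X q) (ka b q) (l2 q) x y z + g3 (X q) (l1 q) (mm b q) x y z = 0) ->
  trace q (fun a b =>
    g3 (vpartial a X q) (ka b q) (l2 q) x y z + g3 (X q) (vpartial a (ka b) q) (l2 q) x y z
    + g3 (X q) (ka b q) (vpartial a l2 q) x y z
    + (g3 (vpartial a X q) (l1 q) (mm b q) x y z + g3 (X q) (vpartial a l1 q) (mm b q) x y z
    + g3 (X q) (l1 q) (vpartial a (mm b) q) x y z))
  = - lam * g3 (X q) (l1 q) (l2 q) x y z.
Proof.
move=> Uq V0.
pose G := invmx (gmx s X q).
pose C b := - (G 0 0 * chris s X q b 0 0 + G 0 1 * chris s X q b 0 1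
  + (G 1 0 * chris s X q b 1 0 + G 1 1 * chris s X q b 1 1)).
pose F i j l r := tri (X r) (l1 r) (l2 r) i j l.
pose T1 b i j l := tri (X q) (ka b q) (l2 q) i j l + tri (X q) (l1 q) (mm b q) i j l.
pose T2 a b i j l := tri (vpartial a X q) (ka b q) (l2 q) i j l
  + tri (X q) (vpartial a (ka b) q) (l2 q) i j l
  + tri (X q) (ka b q) (vpartial a l2 q) i j l
  + (tri (vpartial a X q) (l1 q) (mm b q) i j l + tri (X q) (vpartial a l1 q) (mm b q) i j l
  + tri (X q) (l1 q) (vpartial a (mm b) q) i j l).
have E i j l : (G 0 0 * T2 0 0 i j l + G 0 1 * T2 0 1 i j l
    + (G 1 0 * T2 1 0 i j l + G 1 1 * T2 1 1 i j l))
    + (C 0 * T1 0 i j l + C 1 * T1 1 i j l) + lam * tri (X q) (l1 q) (l2 q) i j l = 0.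
  rewrite -(eigen i j l Uq) (patch_laplacianE s X (P := fun b => T1 b i j l)
    (H := fun a b => T2 a b i j l) (fun b => dtri b i j l Uq) (fun a b => d2tri a b i j l Uq)).
  rewrite !sum2 -/G /C.
  move: (T1 0 i j l) (T1 1 i j l) (T2 0 0 i j l) (T2 0 1 i j l) (T2 1 0 i j l) (T2 1 1 i j l).
  move: (chris s X q 0 0 0) (chris s X q 0 0 1) (chris s X q 0 1 0) (chris s X q 0 1 1).
  move: (chris s X q 1 0 0) (chris s X q 1 0 1) (chris s X q 1 1 0) (chris s X q 1 1 1).
  move: (G 0 0) (G 0 1) (G 1 0) (G 1 1) => *; ring.
have cT1 b : contract s x y z (T1 b) = 0 by rewrite -(V0 b); exact: contract_tri2.
have cT2 a b : contract s x y z (T2 a b) = _ := contract_tri6 s x y z _ _ _ _ _ _ _ _ _ _ _ _ _ _ _ _ _ _.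
have := contract_trace E cT1; rewrite (contract_tri s (X q) (l1 q) (l2 q)) => <-.
by apply: eq_bigr => a _; apply: eq_bigr => b _; congr (_ * _); exact/esym/cT2.
Qed.

End EigenEquation.

(** * The eigenvalue equation for the Gauss map *)

Section ContractedEquations.
Variables (R : realType) (n s : nat).
Local Notation "<< x , y >>" := (@scal R n s x y) (at level 0, format "<< x ,  y >>").
Local Notation g3 := (@gram3 R n s).

Section Algebra.
Variables (x u v : 'rV[R]_n).
Hypotheses (xx : << x, x >> = 1) (xu : << x, u >> = 0) (xv : << x, v >> = 0).
Hypotheses (ux : << u, x >> = 0) (uu : << u, u >> = 0) (uv : << u, v >> = 1).
Hypotheses (vx : << v, x >> = 0) (vu : << v, u >> = 1) (vv : << v, v >> = 0).

(** The three pairings below are the components of the second derivatives of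
the Gauss map along [u ^ v ^ w], [x ^ w ^ w'] and [x ^ u ^ v], with [w] and
[w'] normal. There [d], [du], [dv], [dk], [dm] stand for derivatives of the
position, of the frame, and of the normal parts [k] and [m] of the derivatives
of the frame. *)
Lemma contract_mean_curvature (w d k m dk dm du dv : 'rV[R]_n) :
  << x, w >> = 0 -> << u, w >> = 0 -> << v, w >> = 0 -> << d, w >> = 0 ->
  << k, u >> = 0 -> << k, v >> = 0 -> << m, u >> = 0 -> << m, v >> = 0 ->
  g3 d k v u v w + g3 x dk v u v w + g3 x k dv u v w
  + (g3 d u m u v w + g3 x du m u v w + g3 x u dm u v w)
  = << d, v >> * << k, w >> + << d, u >> * << m, w >>.
Proof.
move=> xw uw vw dw k1 k2 m1 m2; rewrite /gram3 xu xv xw uu uv uw vu vv vw dw k1 k2 m1 m2.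
ring.
Qed.

Lemma contract_normal_plane (w w' d k m dk dm du dv : 'rV[R]_n) :
  << x, w >> = 0 -> << u, w >> = 0 -> << v, w >> = 0 -> << d, w >> = 0 ->
  << x, w' >> = 0 -> << u, w' >> = 0 -> << v, w' >> = 0 -> << d, w' >> = 0 ->
  << d, x >> = 0 -> << k, x >> = 0 -> << m, x >> = 0 ->
  g3 d k v x w w' + g3 x dk v x w w' + g3 x k dv x w w'
  + (g3 d u m x w w' + g3 x du m x w w' + g3 x u dm x w w')
  = (<< k, w >> * << dv, w' >> - << k, w' >> * << dv, w >>)
    + (<< du, w >> * << m, w' >> - << du, w' >> * << m, w >>).
Proof.
move=> xw uw vw dw xw' uw' vw' dw' dx kx mx.
rewrite /gram3 xx xw xw' ux uw uw' vx vw vw' dx dw dw' kx mx.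
ring.
Qed.

Lemma contract_tangent (d k m dk dm du dv : 'rV[R]_n) :
  << d, x >> = 0 -> << k, x >> = 0 -> << k, u >> = 0 -> << k, v >> = 0 ->
  << m, x >> = 0 -> << m, u >> = 0 -> << m, v >> = 0 ->
  g3 d k v x u v + g3 x dk v x u v + g3 x k dv x u v
  + (g3 d u m x u v + g3 x du m x u v + g3 x u dm x u v)
  = - << dk, v >> - << dm, u >>.
Proof.
move=> dx kx ku kv mx mu mv.
rewrite /gram3 xx xu xv ux uu uv vx vu vv dx kx ku kv mx mu mv; ring.
Qed.

End Algebra.

Variables (U : set 'rV[R]_2) (X l1 l2 : 'rV[R]_2 -> 'rV[R]_n).
Hypothesis NF : null_frame s U X l1 l2.
Let oU := nf_open NF.
Local Notation th := (theta s X l2).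
Local Notation ph := (phi s X l1).
Local Notation ka := (kap s X l1 l2).
Local Notation mm := (mu s X l1 l2).
Local Notation II11 := (sff11 s X l1 l2).
Local Notation II12 := (sff12 s X l1 l2).
Local Notation II22 := (sff22 s X l1 l2).
Local Notation nor := (normal s X l1 l2).
Local Notation tr := (trace s X).

Variable lam : R.
Hypothesis eigen : forall q i j l, U q ->
  patch_laplacian s X (fun r => tri (X r) (l1 r) (l2 r) i j l) q =
  lam * tri (X q) (l1 q) (l2 q) i j l.

Lemma trace_theta_l q (v : 'I_2 -> R) : U q -> tr q (fun a b => th a q * v b) =
  up2 s X l1 l2 0 q * v 0 + up2 s X l1 l2 1 q * v 1.
Proof.
move=> Uq; rewrite (trace_mul NF _ _ Uq); have [-> _ -> _] := up_pairings NF Uq.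
by rewrite mul1r mul0r addr0.
Qed.

Lemma trace_phi_l q (v : 'I_2 -> R) : U q -> tr q (fun a b => ph a q * v b) =
  up1 s X l1 l2 0 q * v 0 + up1 s X l1 l2 1 q * v 1.
Proof.
move=> Uq; rewrite (trace_mul NF _ _ Uq); have [_ -> _ ->] := up_pairings NF Uq.
by rewrite mul1r mul0r add0r.
Qed.

Lemma normalC q w : nor q w -> [/\ << X q, w >> = 0, << l1 q, w >> = 0 & << l2 q, w >> = 0].
Proof. by move=> [h1 h2 h3]; split; rewrite scalC. Qed.

Lemma dX_normal a q w : U q -> nor q w -> << vpartial a X q, w >> = 0.
Proof.
move=> Uq /normalC[_ w1 w2]; rewrite (dX_frame NF a Uq) scalDl !scalZl w1 w2.
by rewrite !mulr0 addr0.
Qed.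

Lemma dl1_normal a q w : nor q w -> << vpartial a l1 q, w >> = << ka a q, w >>.
Proof.
move=> /normalC[w0 w1 w2]; rewrite (dl1_frame s X l1 l2) !(scalDl, scalNl, scalZl) w0 w1.
by rewrite !mulr0 oppr0 addr0 add0r.
Qed.

Lemma dl2_normal a q w : nor q w -> << vpartial a l2 q, w >> = << mm a q, w >>.
Proof.
move=> /normalC[w0 w1 w2]; rewrite (dl2_frame s X l1 l2) !(scalDl, scalNl, scalZl) w0 w2.
by rewrite !mulr0 oppr0 addr0 add0r.
Qed.

(** Along [l1 ^ l2 ^ w], with [w] normal, the Gauss map has no component, while
the component of its Laplacian is a multiple of the product of [w] with the
mean curvature vector: the surface is minimal. *)
Lemma sff12_eq0 q : U q -> II12 q = 0.
Proof.
move=> Uq; apply: (normal_nondegenerate NF Uq (normal_sff12 NF Uq)) => w nw.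
have [[[xx xu xv] [ux uu uv]] [vx vu vv]] := frame_scal NF Uq.
have [xw uw vw] := normalC nw.
have V0 b : g3 (X q) (ka b q) (l2 q) (l1 q) (l2 q) w + g3 (X q) (l1 q) (mm b q) (l1 q) (l2 q) w = 0.
  by rewrite /gram3 xu xv xw; ring.
have H a b : _ = << vpartial a X q, l2 q >> * << ka b q, w >>
    + << vpartial a X q, l1 q >> * << mm b q, w >> :=
  let: And3 k0 k1 k2 := normal_kap NF b Uq in let: And3 m0 m1 m2 := normal_mu NF b Uq in
  contract_mean_curvature xu xv uu uv vu vv (vpartial a (ka b) q) (vpartial a (mm b) q)
    (vpartial a l1 q) (vpartial a l2 q) xw uw vw (dX_normal a Uq nw) k1 k2 m1 m2.
have := eigen_contract NF eigen Uq V0; rewrite (eq_trace s X q H).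
have H' a b : << vpartial a X q, l2 q >> * << ka b q, w >>
    + << vpartial a X q, l1 q >> * << mm b q, w >> =
  th a q * << ka b q, w >> + ph a q * << mm b q, w >> by rewrite thetaE phiE.
rewrite (eq_trace s X q H') traceD (trace_theta_l _ Uq) (trace_phi_l _ Uq) /gram3 xu xv xw.
rewrite (scal_kap NF 0 _ Uq) (scal_kap NF 1 _ Uq) (scal_mu NF 0 _ Uq) (scal_mu NF 1 _ Uq).
have [p1 p2 p3 p4] := up_pairings NF Uq; move: p1 p2 p3 p4.
move: (up1 _ _ _ _ 0 q) (up1 _ _ _ _ 1 q) (up2 _ _ _ _ 0 q) (up2 _ _ _ _ 1 q).
move: (th 0 q) (th 1 q) (ph 0 q) (ph 1 q) << II11 q, w >> << II22 q, w >> << II12 q, w >>.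
move=> t0 t1 q0 q1 A B C a0 a1 b0 b1 p1 p2 p3 p4 E.
have : A * (b0 * t0 + b1 * t1) + C * (b0 * q0 + b1 * q1)
   + (C * (a0 * t0 + a1 * t1) + B * (a0 * q0 + a1 * q1)) = 0.
  by move: E; rewrite !mul0r subr0 addr0 mulr0 => E; rewrite -[RHS]E; ring.
by rewrite p1 p2 p3 p4; lra.
Qed.

(** Along [X ^ w ^ w'], with [w] and [w'] normal, the component of the
Laplacian is a multiple of the normal curvature; its vanishing makes [II11] and
[II22] proportional. *)
Lemma sff_wedge q w w' : U q -> nor q w -> nor q w' ->
  << II11 q, w >> * << II22 q, w' >> = << II11 q, w' >> * << II22 q, w >>.
Proof.
move=> Uq nw nw'; have [[[xx xu xv] [ux uu uv]] [vx vu vv]] := frame_scal NF Uq.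
have [xw uw vw] := normalC nw; have [xw' uw' vw'] := normalC nw'.
have V0 b : g3 (X q) (ka b q) (l2 q) (X q) w w' + g3 (X q) (l1 q) (mm b q) (X q) w w' = 0.
  by rewrite /gram3 uw uw' vw vw' xw xw' ux vx; ring.
have H a b : _ = (<< ka b q, w >> * << vpartial a l2 q, w' >> -
     << ka b q, w' >> * << vpartial a l2 q, w >>) + (<< vpartial a l1 q, w >> * << mm b q, w' >>
     - << vpartial a l1 q, w' >> * << mm b q, w >>) :=
  let: And3 k0 k1 k2 := normal_kap NF b Uq in let: And3 m0 m1 m2 := normal_mu NF b Uq in
  contract_normal_plane xx ux vx (vpartial a (ka b) q) (vpartial a (mm b) q)
    (vpartial a l1 q) (vpartial a l2 q) xw uw vw (dX_normal a Uq nw) xw' uw' vw' (dX_normal a Uq nw')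
    (dX_X NF a Uq) k0 m0.
have H' a b : (<< ka b q, w >> * << vpartial a l2 q, w' >> -
     << ka b q, w' >> * << vpartial a l2 q, w >>) + (<< vpartial a l1 q, w >> * << mm b q, w' >>
     - << vpartial a l1 q, w' >> * << mm b q, w >>) =
  (<< II11 q, w >> * << II22 q, w' >> - << II11 q, w' >> * << II22 q, w >>)
   * (ph a q * th b q + th a q * ph b q).
  rewrite !(dl1_normal _ nw) !(dl1_normal _ nw') !(dl2_normal _ nw) !(dl2_normal _ nw').
  rewrite !(scal_kap NF _ _ Uq) !(scal_mu NF _ _ Uq) (sff12_eq0 Uq) !scal0l !mulr0 !addr0 !add0r.
  move: (th a q) (th b q) (ph a q) (ph b q) << II11 q, w >> << II22 q, w >> << II11 q, w' >> << II22 q, w' >>.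
  by move=> *; ring.
have := eigen_contract NF eigen Uq V0; rewrite (eq_trace s X q H) (eq_trace s X q H').
rewrite traceZ traceD (trace_theta_l _ Uq) (trace_phi_l _ Uq).
have [_ p2 p3 p4] := up_pairings NF Uq; have [p1 _ _ _] := up_pairings NF Uq.
rewrite p4 p1 /gram3 xw xw' uw uw' ux vx vw vw' => E.
apply/eqP; rewrite -subr_eq0; apply/eqP; move: E.
by move: (_ - _ : R) => c; lra.
Qed.

(** Along [X ^ l1 ^ l2] the component of the Laplacian is the square of the
second fundamental form. *)
Lemma sff_eigenvalue q : U q -> 2 * << II11 q, II22 q >> = lam.
Proof.
move=> Uq; have [[[xx xu xv] [ux uu uv]] [vx vu vv]] := frame_scal NF Uq.
have V0 b : g3 (X q) (ka b q) (l2 q) (X q) (l1 q) (l2 q)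
    + g3 (X q) (l1 q) (mm b q) (X q) (l1 q) (l2 q) = 0.
  have [k0 k1 k2] := normal_kap NF b Uq; have [m0 m1 m2] := normal_mu NF b Uq.
  by rewrite /gram3 k0 k1 k2 m0 m1 m2; ring.
have H a b : _ = - << vpartial a (ka b) q, l2 q >> - << vpartial a (mm b) q, l1 q >> :=
  let: And3 k0 k1 k2 := normal_kap NF b Uq in let: And3 m0 m1 m2 := normal_mu NF b Uq in
  contract_tangent xx xu xv ux uu uv vx vu vv (vpartial a (ka b) q) (vpartial a (mm b) q)
    (vpartial a l1 q) (vpartial a l2 q) (dX_X NF a Uq) k0 k1 k2 m0 m1 m2.
have H' a b : - << vpartial a (ka b) q, l2 q >> - << vpartial a (mm b) q, l1 q >> =
   << II11 q, II22 q >> * (ph a q * th b q + th a q * ph b q).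
  have kb z : U z -> << ka b z, l2 z >> = 0 by move=> /(normal_kap NF b)[].
  have mb z : U z -> << mm b z, l1 z >> = 0 by move=> /(normal_mu NF b)[].
  rewrite (scal_cst_derive NF a (smooth_kap NF b) (nf_s2 NF) kb Uq).
  rewrite (scal_cst_derive NF a (smooth_mu NF b) (nf_s1 NF) mb Uq) !opprK.
  rewrite (scalC _ (ka b q)) (scalC _ (mm b q)).
  rewrite (dl2_normal _ (normal_kap NF b Uq)) (dl1_normal _ (normal_mu NF b Uq)).
  rewrite (scal_mu NF _ _ Uq) (scal_kap NF _ _ Uq) (kap_sff NF _ Uq) (mu_sff NF _ Uq).
  rewrite (sff12_eq0 Uq) !scaler0 !addr0 !add0r !scal0l !mulr0 !addr0 !add0r !scalZr.
  rewrite (scalC s (II22 q) (II11 q)).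
  by move: (th a q) (th b q) (ph a q) (ph b q) << II11 q, II22 q >> => *; ring.
have := eigen_contract NF eigen Uq V0; rewrite (eq_trace s X q H) (eq_trace s X q H').
rewrite traceZ traceD (trace_theta_l _ Uq) (trace_phi_l _ Uq).
have [p1 _ _ p4] := up_pairings NF Uq.
by rewrite p4 p1 /gram3 xx xu xv ux uu uv vx vu vv; lra.
Qed.

End ContractedEquations.

(** * Frames with constant second fundamental form *)

Section CartanFrame.
Variables (R : realType) (n s : nat).
Local Notation "<< x , y >>" := (@scal R n s x y) (at level 0, format "<< x ,  y >>").
Variable X : 'rV[R]_2 -> 'rV[R]_n.

(** A null frame on which the second fundamental form has the constant values
[II11 = N], [II12 = 0] and [II22 = B N], for a unit normal [N]. *)
Record cartan_frame (U : set 'rV[R]_2) (l1 l2 N : 'rV[R]_2 -> 'rV[R]_n) (eps B : R) : Prop :=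
  CartanFrame {
    cf_nf : null_frame s U X l1 l2;
    cf_sN : smooth_map_on U N;
    cf_normal : forall q, U q -> normal s X l1 l2 q (N q);
    cf_NN : forall q, U q -> << N q, N q >> = eps;
    cf_kap : forall a q, U q -> kap s X l1 l2 a q = theta s X l2 a q *: N q;
    cf_mu : forall a q, U q -> mu s X l1 l2 a q = (B * phi s X l1 a q) *: N q }.

Section Rescaling.
Variables (U : set 'rV[R]_2) (l1 l2 : 'rV[R]_2 -> 'rV[R]_n).
Hypothesis NF : null_frame s U X l1 l2.
Variables (V : set 'rV[R]_2) (c : 'rV[R]_2 -> R).
Hypotheses (oV : open V) (VU : V `<=` U) (sc : smooth_on V c) (c0 : forall q, V q -> 0 < c q).
Let k1 q := (c q)^-1 *: l1 q.
Let k2 q := c q *: l2 q.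

Let sub (f : 'rV[R]_2 -> 'rV[R]_n) : smooth_map_on U f -> smooth_map_on V f.
Proof. by move=> h j; exact: (smooth_sub VU (h j)). Qed.

Let cn q : V q -> c q != 0. Proof. by move=> /c0 h; rewrite gt_eqF. Qed.

Let scV : smooth_on V (fun q => (c q)^-1) := smoothV oV cn sc.

Lemma theta_rescale a q : theta s X k2 a q = c q * theta s X l2 a q.
Proof. by rewrite /theta /k2 scalZr. Qed.

Lemma phi_rescale a q : phi s X k1 a q = (c q)^-1 * phi s X l1 a q.
Proof. by rewrite /phi /k1 scalZr. Qed.

Lemma null_frame_rescale : null_frame s V X k1 k2.
Proof.
have fr q : V q -> _ := fun Vq => frame_scal NF (VU Vq).
split.
- exact: oV.
- exact: (sub (nf_sX NF)).
- exact: (smoothvZ oV scV (sub (nf_s1 NF))).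
- exact: (smoothvZ oV sc (sub (nf_s2 NF))).
- by move=> q /VU; exact: (nf_XX NF).
- by move=> q /VU/(nf_X1 NF) e; rewrite /k1 scalZr e mulr0.
- by move=> q /VU/(nf_X2 NF) e; rewrite /k2 scalZr e mulr0.
- by move=> q /VU/(nf_11 NF) e; rewrite /k1 scalZr scalZl e !mulr0.
- by move=> q /VU/(nf_22 NF) e; rewrite /k2 scalZr scalZl e !mulr0.
- by move=> q Vq; rewrite /k1 /k2 scalZr scalZl (nf_12 NF (VU Vq)) mulr1 mulfV // cn.
- move=> a q Vq; rewrite thetaE phiE theta_rescale phi_rescale /k1 /k2 !scalerA.
  by rewrite mulrAC mulfV ?cn // mul1r mulrAC mulVf ?cn // mul1r; exact: (dX_frame NF a (VU Vq)).
- move=> q Vq.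
  rewrite -/(theta s X k2 0 q) -/(theta s X k2 1 q) -/(phi s X k1 0 q) -/(phi s X k1 1 q).
  rewrite !theta_rescale !phi_rescale.
  have := nf_area NF (VU Vq).
  rewrite -/(theta s X l2 0 q) -/(theta s X l2 1 q) -/(phi s X l1 0 q) -/(phi s X l1 1 q).
  move: (theta s X l2 0 q) (theta s X l2 1 q) (phi s X l1 0 q) (phi s X l1 1 q) => t0 t1 p0 p1.
  have := cn Vq; move: (c q) => e e0.
  suff -> : e * t0 * (e^-1 * p1) - e * t1 * (e^-1 * p0) = t0 * p1 - t1 * p0 by [].
  by field.
Qed.

Lemma kap_rescale a q : V q -> kap s X k1 k2 a q = (c q)^-1 *: kap s X l1 l2 a q.
Proof.
move=> Vq; have Uq := VU Vq; have [_ _ k2k] := normal_kap NF a Uq.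
have [[[_ _ xv] _] _] := frame_scal NF Uq; have [[_ [_ _ uv]] _] := frame_scal NF Uq.
rewrite kapE -rotE (vpartialZ oV a scV (sub (nf_s1 NF)) Vq) phi_rescale.
rewrite (dl1_frame s X l1 l2) /k1 /k2.
have := cn Vq; move: k2k xv uv.
move: (kap s X l1 l2 a q) (partial a _ q) (c q) (phi s X l1 a q) (rot s l1 l2 a q) (l1 q) (l2 q) (X q).
move=> k p e f r u v x kv xv uv e0.
rewrite !(scalZr, scalDl, scalNl, scalZl) kv xv uv.
by apply/rowP => i; rewrite !mxE; field.
Qed.

Lemma mu_rescale a q : V q -> mu s X k1 k2 a q = c q *: mu s X l1 l2 a q.
Proof.
move=> Vq; have Uq := VU Vq.
have [[[_ _ xv] _] _] := frame_scal NF Uq; have [[_ [_ _ uv]] _] := frame_scal NF Uq.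
have [_ _ k2k] := normal_kap NF a Uq.
rewrite muE -rotE (vpartialZ oV a scV (sub (nf_s1 NF)) Vq) theta_rescale.
rewrite (vpartialZ oV a sc (sub (nf_s2 NF)) Vq).
have pV : partial a (fun q => (c q)^-1) q = - partial a c q / (c q * c q).
  rewrite (partialV (cn Vq) (smooth_derivable sc Vq)).
  by rewrite invfM.
rewrite (dl1_frame s X l1 l2) (dl2_frame s X l1 l2) /k1 /k2 pV.
have := cn Vq; move: k2k xv uv.
move: (kap s X l1 l2 a q) (mu s X l1 l2 a q) (partial a _ q) (c q) (phi s X l1 a q).
move: (theta s X l2 a q) (rot s l1 l2 a q) (l1 q) (l2 q) (X q).
move=> t r u v x k m p e f kv xv uv e0.
rewrite !(scalZr, scalDl, scalNl, scalZl) kv xv uv.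
by apply/rowP => i; rewrite !mxE; field.
Qed.

End Rescaling.

Section Existence.
Variables (U : set 'rV[R]_2) (l1 l2 : 'rV[R]_2 -> 'rV[R]_n).
Hypothesis NF : null_frame s U X l1 l2.
Variable lam : R.
Hypothesis lam0 : lam != 0.
Hypothesis eigen : forall q i j l, U q ->
  patch_laplacian s X (fun r => tri (X r) (l1 r) (l2 r) i j l) q =
  lam * tri (X q) (l1 q) (l2 q) i j l.
Local Notation II11 := (sff11 s X l1 l2).
Local Notation II22 := (sff22 s X l1 l2).

(** Harmonic Gauss maps are excluded here: if [II11] were null, the
proportionality of [II11] and [II22] would make them orthogonal, against
[sff_eigenvalue]. *)
Lemma sff11_nonnull q : U q -> << II11 q, II11 q >> != 0.
Proof.
move=> Uq; have n1 := normal_sff11 NF Uq; have n2 := normal_sff22 NF Uq.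
have W := sff_wedge NF eigen Uq n1 n2; have E := sff_eigenvalue NF eigen Uq.
apply: contraNneq lam0 => f0; move: W; rewrite f0 mul0r (scalC s (II22 q)) -expr2.
by move=> /esym/eqP; rewrite sqrf_eq0 => /eqP e; rewrite -E e mulr0.
Qed.

Lemma sff22_sff11 q : U q ->
  II22 q = (lam / 2 / << II11 q, II11 q >>) *: II11 q.
Proof.
move=> Uq; have n1 := normal_sff11 NF Uq; have n2 := normal_sff22 NF Uq.
have f0 := sff11_nonnull Uq; have E := sff_eigenvalue NF eigen Uq.
apply/eqP; rewrite -subr_eq0; apply/eqP; rewrite -scaleNr -[X in X + _]scale1r.
apply: (normal_nondegenerate NF Uq (normalZD _ _ n2 n1)) => w nw.
rewrite scalDl !scalZl; have := sff_wedge NF eigen Uq n1 nw.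
move: f0; rewrite -E (scalC s (II22 q) (II11 q)).
move: << II11 q, II11 q >> << II11 q, II22 q >> << II11 q, w >> << II22 q, w >>.
move=> f g a b f0 e.
have -> : b = a * g / f by rewrite -e mulrC mulKf.
by field.
Qed.

(** Dividing [l1] by [c] divides the square of [II11] by [c ^+ 4], so a fourth
root normalizes it; [II22], being proportional, is then determined by the
eigenvalue. *)
Lemma exists_cartan_frame q0 : U q0 -> exists V k1 k2 N eps,
  [/\ V q0, eps = 1 \/ eps = -1 & cartan_frame V k1 k2 N eps (eps * lam / 2)].
Proof.
move=> Uq0; have oU := nf_open NF.
pose f q := << II11 q, II11 q >>.
have sII : smooth_map_on U II11 := smooth_sff11 NF.
have sf : smooth_on U f := smooth_scal s oU sII sII.
have [eps [eps1 e0]] : exists eps : R, (eps = 1 \/ eps = -1) /\ 0 < eps * f q0.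
  have := sff11_nonnull Uq0; rewrite -/(f q0) neq_lt => /orP[] h.
    by exists (-1); split; [right|rewrite mulN1r oppr_gt0].
  by exists 1; split; [left|rewrite mul1r].
have ee : eps * eps = 1 by case: eps1 => ->; rewrite ?mulr1 // mulrNN mulr1.
pose h q := eps * f q; have sh : smooth_on U h := smoothM oU (smooth_cst eps) sf.
pose V := [set q | U q /\ 0 < h q].
have oV : open V by apply: open_pos => // q; exact: smooth_continuous.
have VU : V `<=` U by move=> q [].
have shV : smooth_on V h := smooth_sub VU sh.
have h0 q : V q -> 0 < h q by case.
pose c q := Num.sqrt (Num.sqrt (h q)).
have r0 q : V q -> 0 < Num.sqrt (h q) by move=> Vq; rewrite sqrtr_gt0; exact: h0.
have sc : smooth_on V c := smooth_sqrt oV r0 (smooth_sqrt oV h0 shV).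
have c0 q : V q -> 0 < c q by move=> Vq; rewrite /c sqrtr_gt0; exact: r0.
have c4 q : V q -> c q ^+ 2 ^+ 2 = h q.
  by move=> Vq; rewrite /c !sqr_sqrtr // ltW // ?h0 // r0.
have cn q : V q -> c q != 0 by move=> /c0 hc; rewrite gt_eqF.
pose N q := ((c q)^-1 * (c q)^-1) *: II11 q.
exists V, (fun q => (c q)^-1 *: l1 q), (fun q => c q *: l2 q), N, eps.
have scV : smooth_on V (fun q => (c q)^-1) := smoothV oV cn sc.
have fE q : V q -> f q = eps * c q ^+ 2 ^+ 2 by move=> Vq; rewrite (c4 _ Vq) /h mulrA ee mul1r.
split=> //; split.
- exact: (null_frame_rescale NF oV VU sc c0).
- apply: (smoothvZ oV (smoothM oV scV scV)) => j; exact: (smooth_sub VU (sII j)).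
- move=> q Vq; have [n0 n1 n2] := normal_sff11 NF (VU _ Vq).
  by split; rewrite /N !(scalZl, scalZr) ?n0 ?n1 ?n2 ?mulr0.
- move=> q Vq; rewrite /N scalZl scalZr -/(f q) (fE _ Vq); have := cn q Vq.
  by move: (c q) => e en; field.
- move=> a q Vq; rewrite (kap_rescale NF oV VU sc c0 a Vq) (kap_sff NF a (VU _ Vq)).
  rewrite (sff12_eq0 NF eigen (VU _ Vq)) scaler0 addr0 theta_rescale /N !scalerA.
  congr (_ *: _); have := cn q Vq; move: (c q) (theta s X l2 a q) => e t en; by field.
- move=> a q Vq; rewrite (mu_rescale NF oV VU sc c0 a Vq) (mu_sff NF a (VU _ Vq)).
  rewrite (sff12_eq0 NF eigen (VU _ Vq)) scaler0 add0r phi_rescale /N.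
  rewrite (sff22_sff11 (VU _ Vq)) -/(f q) (fE _ Vq) !scalerA.
  congr (_ *: _); have := cn q Vq; move: (c q) (phi s X l1 a q) => e t en.
  case: eps1 => ->; by field.
Qed.

End Existence.
End CartanFrame.

(** * Integrability of the constant second fundamental form *)

Section CartanEquations.
Variables (R : realType) (n s : nat).
Local Notation "<< x , y >>" := (@scal R n s x y) (at level 0, format "<< x ,  y >>").
Variables (U : set 'rV[R]_2) (X l1 l2 N : 'rV[R]_2 -> 'rV[R]_n) (eps B : R).
Hypothesis eps1 : eps = 1 \/ eps = -1.
Hypothesis B0 : B != 0.
Hypothesis CF : cartan_frame s X U l1 l2 N eps B.
Let NF := cf_nf CF.
Let oU := nf_open NF.
Let sX := nf_sX NF.
Let s1 := nf_s1 NF.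
Let s2 := nf_s2 NF.
Let sN := cf_sN CF.
Local Notation th := (theta s X l2).
Local Notation ph := (phi s X l1).
Local Notation rt := (rot s l1 l2).
Local Notation nor := (normal s X l1 l2).

Let ee : eps * eps = 1. Proof. by case: eps1 => ->; rewrite ?mulr1 // mulrNN mulr1. Qed.
Let en0 : eps != 0. Proof. by case: eps1 => ->; rewrite ?oppr_eq0 oner_eq0. Qed.

Lemma cartan_dl1 a q : U q -> vpartial a l1 q = rt a q *: l1 q + th a q *: N q - ph a q *: X q.
Proof. by move=> Uq; rewrite (dl1_frame s X l1 l2) (cf_kap CF a Uq). Qed.

Lemma cartan_dl2 a q : U q ->
  vpartial a l2 q = - rt a q *: l2 q + (B * ph a q) *: N q - th a q *: X q.
Proof. by move=> Uq; rewrite (dl2_frame s X l1 l2) (cf_mu CF a Uq). Qed.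

Lemma dN_X a q : U q -> << vpartial a N q, X q >> = 0.
Proof.
move=> Uq; have h z : U z -> << N z, X z >> = 0 by move=> /(cf_normal CF)[].
rewrite (scal_cst_derive NF a sN sX h Uq) scalC (dX_normal NF a Uq (cf_normal CF Uq)).
by rewrite oppr0.
Qed.

Lemma dN_l1 a q : U q -> << vpartial a N q, l1 q >> = - (eps * th a q).
Proof.
move=> Uq; have h z : U z -> << N z, l1 z >> = 0 by move=> /(cf_normal CF)[].
rewrite (scal_cst_derive NF a sN s1 h Uq) (cartan_dl1 a Uq).
have [n0 n1 _] := cf_normal CF Uq; have nn := cf_NN CF Uq.
by rewrite !(scalDr, scalNr, scalZr) n0 n1 nn; congr (- _); ring.
Qed.

Lemma dN_l2 a q : U q -> << vpartial a N q, l2 q >> = - (eps * B * ph a q).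
Proof.
move=> Uq; have h z : U z -> << N z, l2 z >> = 0 by move=> /(cf_normal CF)[].
rewrite (scal_cst_derive NF a sN s2 h Uq) (cartan_dl2 a Uq).
have [n0 _ n2] := cf_normal CF Uq; have nn := cf_NN CF Uq.
by rewrite !(scalDr, scalNr, scalZr) n0 n2 nn; congr (- _); ring.
Qed.

Lemma dN_N a q : U q -> << vpartial a N q, N q >> = 0.
Proof. exact: (scal_self_derive NF a sN (cf_NN CF)). Qed.

Lemma cartan_d2l1 a b q : U q -> vpartial b (vpartial a l1) q =
  partial b (rt a) q *: l1 q + rt a q *: vpartial b l1 q
  + (partial b (th a) q *: N q + th a q *: vpartial b N q)
  - (partial b (ph a) q *: X q + ph a q *: vpartial b X q).
Proof.
move=> Uq.
have sr := smooth_rot NF a; have st := smooth_theta NF a; have sp := smooth_phi NF a.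
rewrite (eq_vpartial oU b (fun z Uz => cartan_dl1 a Uz) Uq).
rewrite (vpartialB oU b (smoothvD oU (smoothvZ oU sr s1) (smoothvZ oU st sN)) (smoothvZ oU sp sX) Uq).
rewrite (vpartialD oU b (smoothvZ oU sr s1) (smoothvZ oU st sN) Uq).
by rewrite (vpartialZ oU b sr s1 Uq) (vpartialZ oU b st sN Uq) (vpartialZ oU b sp sX Uq).
Qed.

Lemma cartan_d2l2 a b q : U q -> vpartial b (vpartial a l2) q =
  - (partial b (rt a) q *: l2 q + rt a q *: vpartial b l2 q)
  + B *: (partial b (ph a) q *: N q + ph a q *: vpartial b N q)
  - (partial b (th a) q *: X q + th a q *: vpartial b X q).
Proof.
move=> Uq.
have sr := smooth_rot NF a; have st := smooth_theta NF a; have sp := smooth_phi NF a.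
have E z : U z -> vpartial a l2 z = - (rt a z *: l2 z) + B *: (ph a z *: N z) - th a z *: X z.
  by move=> Uz; rewrite (cartan_dl2 a Uz) scaleNr scalerA.
rewrite (eq_vpartial oU b E Uq).
have sr2 := smoothvN oU (smoothvZ oU sr s2).
have spN := smoothvZ oU sp sN; have sBpN := smoothvZ oU (smooth_cst B) spN.
rewrite (vpartialB oU b (smoothvD oU sr2 sBpN) (smoothvZ oU st sX) Uq).
rewrite (vpartialD oU b sr2 sBpN Uq) (vpartialN oU b (smoothvZ oU sr s2) Uq).
rewrite (vpartialZ oU b (smooth_cst B) spN Uq) partial_cst scale0r add0r.
by rewrite (vpartialZ oU b sr s2 Uq) (vpartialZ oU b sp sN Uq) (vpartialZ oU b st sX Uq).
Qed.

(** The integrability condition of the derivative of [l1], paired with a vector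
[w]. The choices [w = N], [w = l2] and [w] normal give the equations of
Codazzi, of Gauss, and of Codazzi in higher codimension. *)
Lemma cartan_pair1 w q : U q ->
  let f a b := partial b (rt a) q * << l1 q, w >> + rt a q * << vpartial b l1 q, w >>
    + (partial b (th a) q * << N q, w >> + th a q * << vpartial b N q, w >>)
    - (partial b (ph a) q * << X q, w >> + ph a q * << vpartial b X q, w >>) in
  f 0 1 = f 1 0.
Proof.
move=> Uq f; have := congr1 (fun v => << v, w >>) (vpartialC oU 1 0 s1 Uq).
rewrite /= (cartan_d2l1 0 1 Uq) (cartan_d2l1 1 0 Uq).
rewrite /f; move: (partial 1 (rt 0) q) (partial 0 (rt 1) q) (rt 0 q) (rt 1 q).
move: (partial 1 (th 0) q) (partial 0 (th 1) q) (th 0 q) (th 1 q).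
move: (partial 1 (ph 0) q) (partial 0 (ph 1) q) (ph 0 q) (ph 1 q).
by move=> ? ? ? ? ? ? ? ? ? ? ? ?; rewrite !(scalDl, scalNl, scalZl).
Qed.

Lemma cartan_pair2 w q : U q ->
  let f a b := - (partial b (rt a) q * << l2 q, w >> + rt a q * << vpartial b l2 q, w >>)
    + B * (partial b (ph a) q * << N q, w >> + ph a q * << vpartial b N q, w >>)
    - (partial b (th a) q * << X q, w >> + th a q * << vpartial b X q, w >>) in
  f 0 1 = f 1 0.
Proof.
move=> Uq f; have := congr1 (fun v => << v, w >>) (vpartialC oU 1 0 s2 Uq).
rewrite /= (cartan_d2l2 0 1 Uq) (cartan_d2l2 1 0 Uq).
rewrite /f; move: (partial 1 (rt 0) q) (partial 0 (rt 1) q) (rt 0 q) (rt 1 q).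
move: (partial 1 (th 0) q) (partial 0 (th 1) q) (th 0 q) (th 1 q).
move: (partial 1 (ph 0) q) (partial 0 (ph 1) q) (ph 0 q) (ph 1 q).
by move=> ? ? ? ? ? ? ? ? ? ? ? ?; rewrite !(scalDl, scalNl, scalZl).
Qed.

(** The Codazzi equations along [N]: the coefficients 1 and [B] of the second
fundamental form are constant and nonzero, so its covariant derivative is a
multiple of the connection form, and its symmetry forces that form to vanish.
*)
Lemma rot_eq0 a q : U q -> rt a q = 0.
Proof.
move=> Uq; have [n0 n1 n2] := cf_normal CF Uq; have nn := cf_NN CF Uq.
have [xn u1 u2] := normalC (cf_normal CF Uq).
have [T1 T2 _] := torsion_free NF Uq; have A := area_neq0 NF Uq.
have dlN c : << vpartial c l1 q, N q >> = eps * th c q.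
  rewrite (cartan_dl1 c Uq) !(scalDl, scalNl, scalZl) xn u1 nn; ring.
have dlN2 c : << vpartial c l2 q, N q >> = eps * (B * ph c q).
  rewrite (cartan_dl2 c Uq) !(scalDl, scalNl, scalZl) xn u2 nn; ring.
have := cartan_pair1 (N q) Uq; rewrite /= !dlN !(dN_N _ Uq) !(dX_normal NF _ Uq (cf_normal CF Uq)) xn u1 nn.
have := cartan_pair2 (N q) Uq; rewrite /= !dlN2 !(dN_N _ Uq) !(dX_normal NF _ Uq (cf_normal CF Uq)) xn u2 nn.
move: A T1 T2; rewrite /area.
move: (partial 1 (th 0) q) (partial 0 (th 1) q) (th 0 q) (th 1 q).
move: (partial 1 (ph 0) q) (partial 0 (ph 1) q) (ph 0 q) (ph 1 q).
move: (partial 1 (rt 0) q) (partial 0 (rt 1) q).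
suff : forall r0 r1 r10 r01 p10 p01 p0 p1 t10 t01 t0 t1, t0 * p1 - t1 * p0 != 0 ->
    t10 + t0 * r1 = t01 + t1 * r0 -> p10 - p0 * r1 = p01 - p1 * r0 ->
    - (r10 * 0 + r0 * (eps * (B * p1))) + B * (p10 * eps + p0 * 0) - (t10 * 0 + t0 * 0) =
    - (r01 * 0 + r1 * (eps * (B * p0))) + B * (p01 * eps + p1 * 0) - (t01 * 0 + t1 * 0) ->
    r10 * 0 + r0 * (eps * t1) + (t10 * eps + t0 * 0) - (p10 * 0 + p0 * 0) =
    r01 * 0 + r1 * (eps * t0) + (t01 * eps + t1 * 0) - (p01 * 0 + p1 * 0) ->
    r0 = 0 /\ r1 = 0.
  move=> h r10 r01 p10 p01 p0 p1 t10 t01 t0 t1 A T1 T2 E2 E1.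
  have [h0 h1] := h _ _ _ _ _ _ _ _ _ _ _ _ A T1 T2 E2 E1.
  by have [-> | ->] := ord2 a.
move=> r0 r1 r10 r01 p10 p01 p0 p1 t10 t01 t0 t1 A T1 T2 E2 E1.
have D1 : t10 = t01 + t1 * r0 - t0 * r1 by lra.
have D2 : p10 = p01 - p1 * r0 + p0 * r1 by lra.
have F1 : r0 * t1 = r1 * t0.
  by apply: (mulfI en0); move: E1; rewrite D1; lra.
have F2 : r0 * p1 = r1 * p0.
  by apply: (mulfI en0); apply: (mulfI B0); move: E2; rewrite D2; lra.
split; apply: (mulIf A); rewrite mul0r.
  have -> : r0 * (t0 * p1 - t1 * p0) = t0 * (r0 * p1) - (r0 * t1) * p0 by ring.
  by rewrite F1 F2; ring.
have -> : r1 * (t0 * p1 - t1 * p0) = (r1 * t0) * p1 - t1 * (r1 * p0) by ring.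
by rewrite -F1 -F2; ring.
Qed.

Lemma dl1_parallel a q : U q -> vpartial a l1 q = th a q *: N q - ph a q *: X q.
Proof. by move=> Uq; rewrite (cartan_dl1 a Uq) (rot_eq0 a Uq) scale0r add0r. Qed.

Lemma dl2_parallel a q : U q -> vpartial a l2 q = (B * ph a q) *: N q - th a q *: X q.
Proof. by move=> Uq; rewrite (cartan_dl2 a Uq) (rot_eq0 a Uq) oppr0 scale0r add0r. Qed.

Lemma drot_eq0 a b q : U q -> partial b (rt a) q = 0.
Proof. by move=> Uq; rewrite (eq_partial b oU (fun z Uz => rot_eq0 a Uz) Uq) partial_cst. Qed.

(** A parallel frame forces the surface to be flat; the Gauss equation then fixes
the eigenvalue. *)
Lemma flat_eigenvalue q : U q -> eps * B = 1.
Proof.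
move=> Uq; have [n0 n1 n2] := cf_normal CF Uq.
have [[[xx xu xv] [ux uu uv]] [vx vu vv]] := frame_scal NF Uq.
have A := area_neq0 NF Uq.
have dlv c : << vpartial c l1 q, l2 q >> = 0.
  by rewrite (dl1_parallel c Uq) !(scalDl, scalNl, scalZl) n2 xv; ring.
have := cartan_pair1 (l2 q) Uq; rewrite /= !dlv !(dN_l2 _ Uq) n2 xv.
rewrite !(drot_eq0 _ _ Uq) -/(th 0 q) -/(th 1 q); move: A; rewrite /area.
move: (partial 1 (th 0) q) (partial 0 (th 1) q) (th 0 q) (th 1 q).
move: (partial 1 (ph 0) q) (partial 0 (ph 1) q) (ph 0 q) (ph 1 q).
move: (rt 0 q) (rt 1 q) => r0 r1 p10 p01 p0 p1 t10 t01 t0 t1 A E.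
apply: (mulIf A); rewrite mul1r; move: E; lra.
Qed.

Lemma B_eps q : U q -> B = eps.
Proof. by move=> Uq; rewrite -[B]mul1r -ee -mulrA (flat_eigenvalue Uq) mulr1. Qed.

(** For a normal [w] orthogonal to [N], the integrability conditions of [l1] and
[l2] say that the derivative of [N] has no component along [w]: the span of the
frame is constant, and the surface has codimension one in it. *)
Lemma dN_tangent a q : U q -> vpartial a N q = - (eps * th a q) *: l2 q - ph a q *: l1 q.
Proof.
move=> Uq; have BE := B_eps Uq; have [n0 n1 n2] := cf_normal CF Uq; have nn := cf_NN CF Uq.
have [[[xx xu xv] [ux uu uv]] [vx vu vv]] := frame_scal NF Uq.
have [xn un vn] := normalC (cf_normal CF Uq); have A := area_neq0 NF Uq.
have dNw w : nor q w -> << N q, w >> = 0 -> forall c, << vpartial c N q, w >> = 0.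
  move=> nw Nw; have [xw uw vw] := normalC nw.
  have d1 c : << vpartial c l1 q, w >> = 0.
    by rewrite (dl1_parallel c Uq) !(scalDl, scalNl, scalZl) Nw xw; ring.
  have d2 c : << vpartial c l2 q, w >> = 0.
    by rewrite (dl2_parallel c Uq) !(scalDl, scalNl, scalZl) Nw xw; ring.
  have := cartan_pair1 w Uq; rewrite /= !d1 !(dX_normal NF _ Uq nw) uw Nw xw.
  have := cartan_pair2 w Uq; rewrite /= !d2 !(dX_normal NF _ Uq nw) vw Nw xw.
  move: A; rewrite /area.
  move: (partial 1 (th 0) q) (partial 0 (th 1) q) (th 0 q) (th 1 q).
  move: (partial 1 (ph 0) q) (partial 0 (ph 1) q) (ph 0 q) (ph 1 q).
  move: (partial 1 (rt 0) q) (partial 0 (rt 1) q) (rt 0 q) (rt 1 q).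
  move=> r10 r01 r0 r1 p10 p01 p0 p1 t10 t01 t0 t1 A E2 E1.
  suff [h0 h1] : << vpartial 0 N q, w >> = 0 /\ << vpartial 1 N q, w >> = 0.
    by move=> c; have [-> | ->] := ord2 c.
  move: E1 E2; move: << vpartial 0 N q, w >> << vpartial 1 N q, w >> => m0 m1 E1 E2.
  have F1 : m1 * t0 = m0 * t1 by move: E1; lra.
  have F2 : m1 * p0 = m0 * p1 by apply: (mulfI B0); move: E2; lra.
  split; apply: (mulIf A); rewrite mul0r.
    have -> : m0 * (t0 * p1 - t1 * p0) = t0 * (m0 * p1) - (m0 * t1) * p0 by ring.
    by rewrite -F1 -F2; ring.
  have -> : m1 * (t0 * p1 - t1 * p0) = (m1 * t0) * p1 - t1 * (m1 * p0) by ring.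
  by rewrite F1 F2; ring.
have := dN_l2 a Uq; have := dN_l1 a Uq; have := dN_X a Uq; have := dN_N a Uq.
have := fun w nw Nw => dNw w nw Nw a.
rewrite BE ee mul1r; move: (vpartial a N q) (th a q) (ph a q) => d t p dw dn dx d1 d2.
apply/eqP; rewrite -subr_eq0; apply/eqP.
set v := _ - _.
have vX : << v, X q >> = 0 by rewrite /v !(scalDl, scalNl, scalZl) dx vx ux; ring.
have v1 : << v, l1 q >> = 0 by rewrite /v !(scalDl, scalNl, scalZl) d1 vu uu; ring.
have v2 : << v, l2 q >> = 0 by rewrite /v !(scalDl, scalNl, scalZl) d2 vv uv; ring.
have vN : << v, N q >> = 0 by rewrite /v !(scalDl, scalNl, scalZl) dn vn un; ring.
apply: (normal_nondegenerate NF Uq) => // w nw.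
have nw' : nor q (1 *: w + (- (eps * << w, N q >>)) *: N q).
  by apply: normalZD => //; exact: (cf_normal CF Uq).
have [xw uw vw] := normalC nw'.
have h : << d, 1 *: w + (- (eps * << w, N q >>)) *: N q >> = 0.
  by apply: dw => //; rewrite scalDr !scalZr nn (scalC s w); move: << N q, w >> => z;
     rewrite mulNr mulrAC ee; ring.
have : << v, 1 *: w + (- (eps * << w, N q >>)) *: N q >> = 0.
  by rewrite /v !(scalDl, scalNl, scalZl) h uw vw; ring.
by rewrite scalDr !scalZr vN mulr0 addr0 mul1r.
Qed.

End CartanEquations.

(** * The two quadrics *)

Section Quadrics.
Variable R : realType.

(** [true] stands for the product of a circle and a hyperbola in the
pseudo-sphere of index 1, [false] for the second model. [model_sign] is the
square of the unit normal. *)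
Definition model_index (b : bool) : nat := if b then 1%N else 2%N.
Definition model_sign (b : bool) : R := if b then 1 else -1.

(** A symmetric operator of square [model_sign b]: a reflection or a complex
structure. Both models are cut out of their pseudo-sphere by the equation [scal
a (twist b a) = 0], and [twist b a] is the unit normal at [a]. *)
Definition twist (b : bool) (a : 'rV[R]_4) : 'rV[R]_4 :=
  if b then row4 (- a 0 0) (- a 0 1) (a 0 2) (a 0 3)
  else row4 (- a 0 3) (a 0 2) (- a 0 1) (a 0 0).

Lemma sum4 (V : nmodType) (F : 'I_4 -> V) : \sum_(a < 4) F a = F 0 + F 1 + F 2 + F 3.
Proof.
rewrite !big_ord_recl big_ord0 addr0 !addrA.
by congr (_ + F _ + F _ + F _); apply/val_inj.
Qed.

Lemma row4E (a b c d : R) :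
  [/\ row4 a b c d 0 0 = a, row4 a b c d 0 1 = b, row4 a b c d 0 2 = c
    & row4 a b c d 0 3 = d].
Proof. by split; rewrite mxE (tnth_nth 0). Qed.

Lemma rowP4 (u v : 'rV[R]_4) : u 0 0 = v 0 0 -> u 0 1 = v 0 1 -> u 0 2 = v 0 2 ->
  u 0 3 = v 0 3 -> u = v.
Proof.
move=> h0 h1 h2 h3; apply/rowP => -[[|[|[|[|//]]]] i].
- by rewrite (_ : Ordinal i = 0) //; exact/val_inj.
- by rewrite (_ : Ordinal i = 1) //; exact/val_inj.
- by rewrite (_ : Ordinal i = 2) //; exact/val_inj.
- by rewrite (_ : Ordinal i = 3) //; exact/val_inj.
Qed.

Lemma scal4E b (a c : 'rV[R]_4) : scal (model_index b) a c =
  a 0 0 * c 0 0 + a 0 1 * c 0 1 + model_sign b * (a 0 2 * c 0 2) - a 0 3 * c 0 3.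
Proof. by rewrite /scal sum4 /model_sign; case: b => /=; ring. Qed.

Lemma twistE b (a : 'rV[R]_4) :
  [/\ twist b a 0 0 = if b then - a 0 0 else - a 0 3,
      twist b a 0 1 = if b then - a 0 1 else a 0 2,
      twist b a 0 2 = if b then a 0 2 else - a 0 1 &
      twist b a 0 3 = if b then a 0 3 else a 0 0].
Proof. by case: b => /=; split; rewrite mxE (tnth_nth 0). Qed.

Lemma scal_twist b (a : 'rV[R]_4) : scal (model_index b) a (twist b a) =
  if b then - (a 0 0 ^+ 2 + a 0 1 ^+ 2) + (a 0 2 ^+ 2 - a 0 3 ^+ 2)
  else 2 * (a 0 1 * a 0 2 - a 0 0 * a 0 3).
Proof.
rewrite scal4E; have [-> -> -> ->] := twistE b a.
by rewrite /model_sign; case: b; ring.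
Qed.

Definition quadric n (b : bool) (J : 'M[R]_(4, n)) : set 'rV[R]_n :=
  [set a *m J | a in [set a | scal (model_index b) a a = 1 /\
                              scal (model_index b) a (twist b a) = 0]].

Definition rows4 n (r0 r1 r2 r3 : 'rV[R]_n) : 'M[R]_(4, n) :=
  \matrix_(i, j) (tnth [tuple r0; r1; r2; r3] i) 0 j.

Lemma mulmx_rows4 n (r0 r1 r2 r3 : 'rV[R]_n) (a : 'rV[R]_4) :
  a *m rows4 r0 r1 r2 r3 = a 0 0 *: r0 + a 0 1 *: r1 + a 0 2 *: r2 + a 0 3 *: r3.
Proof. by apply/rowP => j; rewrite mxE sum4 !mxE !(tnth_nth 0). Qed.

Lemma rows4_isometric n s b (r0 r1 r2 r3 : 'rV[R]_n) :
  [/\ scal s r0 r0 = 1, scal s r1 r1 = 1, scal s r2 r2 = model_sign b & scal s r3 r3 = -1] ->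
  [/\ scal s r0 r1 = 0, scal s r0 r2 = 0, scal s r0 r3 = 0 &
    [/\ scal s r1 r2 = 0, scal s r1 r3 = 0 & scal s r2 r3 = 0]] ->
  isometric_embedding s (model_index b) (rows4 r0 r1 r2 r3).
Proof.
move=> [h00 h11 h22 h33] [h01 h02 h03 [h12 h13 h23]] a c.
rewrite !mulmx_rows4 scal4E !(scalDl, scalDr, scalZl, scalZr).
rewrite (scalC s r1 r0) (scalC s r2 r0) (scalC s r3 r0) (scalC s r2 r1) (scalC s r3 r1)
  (scalC s r3 r2) h00 h11 h22 h33 h01 h02 h03 h12 h13 h23; ring.
Qed.

Definition half_root : R := (Num.sqrt 2)^-1.

Lemma half_root2 : half_root * half_root = 2^-1.
Proof. by rewrite -invfM -expr2 sqr_sqrtr. Qed.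

(** The isometric embedding that maps a point of the model to [x], its normal to
[w] and a null frame to [u], [v]. When the twist is a reflection, its eigenvectors
are the sums and differences of [x] and [w] and of [u] and [v]. *)
Definition adapted_frame n (b : bool) (x u v w : 'rV[R]_n) : 'M[R]_(4, n) :=
  if b then rows4 (half_root *: (x - w)) (half_root *: (u + v))
                  (half_root *: (x + w)) (half_root *: (u - v))
  else rows4 x (half_root *: (u + v)) (half_root *: (u - v)) w.

Section AdaptedFrame.
Variables (n s : nat) (b : bool) (x u v w : 'rV[R]_n).
Hypotheses (xx : scal s x x = 1) (xu : scal s x u = 0) (xv : scal s x v = 0)
  (uu : scal s u u = 0) (uv : scal s u v = 1) (vv : scal s v v = 0)
  (wx : scal s w x = 0) (wu : scal s w u = 0) (wv : scal s w v = 0)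
  (ww : scal s w w = model_sign b).

Lemma adapted_frame_isometric :
  isometric_embedding s (model_index b) (adapted_frame b x u v w).
Proof.
have xw : scal s x w = 0 by rewrite scalC.
have uw : scal s u w = 0 by rewrite scalC.
have vw : scal s v w = 0 by rewrite scalC.
have ux : scal s u x = 0 by rewrite scalC.
have vx : scal s v x = 0 by rewrite scalC.
have vu : scal s v u = 1 by rewrite scalC.
have hh := half_root2; move: ww; rewrite /adapted_frame /model_sign; case: b => ww'.
- apply: (@rows4_isometric _ _ true); split; try split;
  rewrite ?(scalDl, scalDr, scalNl, scalNr, scalZl, scalZr) ?xx ?xu ?xv ?uu ?uv ?vv ?wx ?wu ?wv
    ?ww' ?xw ?uw ?vw ?ux ?vx ?vu ?mulrN ?mulNr ?mulr0 /model_sign; lra.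
- apply: (@rows4_isometric _ _ false); split; try split;
  rewrite ?(scalDl, scalDr, scalNl, scalNr, scalZl, scalZr) ?xx ?xu ?xv ?uu ?uv ?vv ?wx ?wu ?wv
    ?ww' ?xw ?uw ?vw ?ux ?vx ?vu ?mulrN ?mulNr ?mulr0 /model_sign; lra.
Qed.

Lemma adapted_frame_quadric y : scal s y y = 1 ->
  y = scal s y x *: x + scal s y v *: u + scal s y u *: v + (model_sign b * scal s y w) *: w ->
  2 * scal s y x * scal s y w = scal s y u ^+ 2 + model_sign b * scal s y v ^+ 2 ->
  quadric b (adapted_frame b x u v w) y.
Proof.
move=> yy.
have hh := half_root2; have iso := adapted_frame_isometric.
move: (scal s y x) (scal s y v) (scal s y u) (scal s y w) => A B C D yE P.
pose a : 'rV[R]_4 := if b then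
    row4 (half_root * (A - D)) (half_root * (B + C)) (half_root * (A + D)) (half_root * (B - C))
  else row4 A (half_root * (B + C)) (half_root * (B - C)) (- D).
have aE : a *m adapted_frame b x u v w = y.
  rewrite yE /a /adapted_frame /model_sign.
  case: (b); rewrite mulmx_rows4.
    have [-> -> -> ->] := row4E (half_root * (A - D)) (half_root * (B + C))
      (half_root * (A + D)) (half_root * (B - C)).
    apply/rowP => j; rewrite !mxE; move: (x 0 j) (u 0 j) (v 0 j) (w 0 j) => p q r t.
    transitivity (half_root * half_root *
      ((A - D) * (p - t) + (B + C) * (q + r) + (A + D) * (p + t) + (B - C) * (q - r))).
      by ring.
    by rewrite hh; field.
  have [-> -> -> ->] := row4E A (half_root * (B + C)) (half_root * (B - C)) (- D).
  apply/rowP => j; rewrite !mxE; move: (x 0 j) (u 0 j) (v 0 j) (w 0 j) => p q r t.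
  transitivity (A * p + half_root * half_root * ((B + C) * (q + r) + (B - C) * (q - r)) - D * t).
    by ring.
  by rewrite hh; field.
exists a => //; split; first by rewrite -iso aE.
rewrite scal_twist /a; move: P; rewrite /model_sign; case: (b) => P.
  have [-> -> -> ->] := row4E (half_root * (A - D)) (half_root * (B + C))
    (half_root * (A + D)) (half_root * (B - C)).
  transitivity (half_root * half_root * (2 * (2 * A * D - (C ^+ 2 + 1 * B ^+ 2)))); first by ring.
  by rewrite P; ring.
have [-> -> -> ->] := row4E A (half_root * (B + C)) (half_root * (B - C)) (- D).
transitivity (2 * ((half_root * half_root) * (B ^+ 2 - C ^+ 2) + A * D)); first by ring.
by rewrite hh; move: P; lra.
Qed.
End AdaptedFrame.
End Quadrics.

Section LocalExistence.
Variables (R : realType) (n s : nat).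
Local Notation "<< x , y >>" := (@scal R n s x y) (at level 0, format "<< x ,  y >>").

Section Calculus.
Variables (p : nat) (U : set 'rV[R]_p).
Hypothesis oU : open U.

Lemma smooth_scal_cst (f : 'rV[R]_p -> 'rV[R]_n) y : smooth_map_on U f ->
  smooth_on U (fun r => << f r, y >>).
Proof. by move=> hf; exact: (smooth_scal s oU hf (fun j => smooth_cst (y 0 j))). Qed.

Lemma partial_scal_cst a (f : 'rV[R]_p -> 'rV[R]_n) y q : smooth_map_on U f -> U q ->
  partial a (fun r => << f r, y >>) q = << vpartial a f q, y >>.
Proof.
move=> hf Uq; rewrite (partial_scal s oU a hf (fun j => smooth_cst (y 0 j)) Uq).
rewrite [X in _ + X](_ : _ = 0) ?addr0 //.
rewrite scalC (_ : vpartial a _ q = 0) ?scal0l //.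
by apply/rowP => j; rewrite vpartialE partial_cst mxE.
Qed.

Lemma partial_scal_mul a (f g : 'rV[R]_p -> 'rV[R]_n) y z q : smooth_map_on U f ->
  smooth_map_on U g -> U q ->
  partial a (fun r => << f r, y >> * << g r, z >>) q =
  << vpartial a f q, y >> * << g q, z >> + << f q, y >> * << vpartial a g q, z >>.
Proof.
move=> hf hg Uq.
rewrite (smooth_partialM a (smooth_scal_cst y hf) (smooth_scal_cst z hg) Uq).
by rewrite (partial_scal_cst a y hf Uq) (partial_scal_cst a z hg Uq).
Qed.

Lemma partial_add4 a (f1 f2 f3 f4 : 'rV[R]_p -> R) q : smooth_on U f1 -> smooth_on U f2 ->
  smooth_on U f3 -> smooth_on U f4 -> U q ->
  partial a (fun r => f1 r + f2 r + f3 r + f4 r) q =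
  partial a f1 q + partial a f2 q + partial a f3 q + partial a f4 q.
Proof.
move=> h1 h2 h3 h4 Uq.
rewrite (smooth_partialD a (smoothD oU (smoothD oU h1 h2) h3) h4 Uq).
by rewrite (smooth_partialD a (smoothD oU h1 h2) h3 Uq) (smooth_partialD a h1 h2 Uq).
Qed.

End Calculus.

Lemma constant_on_ball k (U : set 'rV[R]_k) (f : 'rV[R]_k -> R) q d : 0 < d ->
  (forall z, ball q d z -> U z) -> smooth_on U f ->
  (forall a z, U z -> partial a f z = 0) -> forall z, ball q d z -> f z = f q.
Proof.
move=> d0 dU sf f0.
have df (z : 'rV[R]_k) (i : 'I_k) : U z -> derivable f z (delta_mx 0 i).
  by move=> Uz; exact: smooth_derivable sf Uz.
apply: (partial0_locally_cst d0) => z i qz.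
  exact: df (dU z qz).
exact: f0 (dU z qz).
Qed.

Section Flat.
Variables (U : set 'rV[R]_2) (X l1 l2 N : 'rV[R]_2 -> 'rV[R]_n) (b : bool) (B : R).
Local Notation eps := (model_sign R b).
Hypothesis B0 : B != 0.
Hypothesis CF : cartan_frame s X U l1 l2 N eps B.
Let NF := cf_nf CF.
Let oU := nf_open NF.
Let sX := nf_sX NF.
Let s1 := nf_s1 NF.
Let s2 := nf_s2 NF.
Let sN := cf_sN CF.

Let eps1 : eps = 1 \/ eps = -1. Proof. by rewrite /model_sign; case: b; [left|right]. Qed.

(** The matrix coefficients of the orthogonal projection on the span of the
frame, and of the operator on this span that exchanges position and normal up
to sign. Both are constant along the surface, by the structure equations of the
parallel frame. *)
Definition projector y z q : R := << X q, y >> * << X q, z >> + << l2 q, y >> * << l1 q, z >>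
  + << l1 q, y >> * << l2 q, z >> + eps * (<< N q, y >> * << N q, z >>).

Definition twistor y z q : R := << X q, y >> * << N q, z >> + << N q, y >> * << X q, z >>
  + - 1 * (<< l1 q, y >> * << l1 q, z >>) + - eps * (<< l2 q, y >> * << l2 q, z >>).

Let sm f g y z c : smooth_map_on U f -> smooth_map_on U g ->
  smooth_on U (fun r => c * (<< f r, y >> * << g r, z >>)).
Proof.
move=> hf hg; apply: (smoothM oU (smooth_cst c)).
exact: (smoothM oU (smooth_scal_cst oU y hf) (smooth_scal_cst oU z hg)).
Qed.

Let sm1 f g y z : smooth_map_on U f -> smooth_map_on U g ->
  smooth_on U (fun r => << f r, y >> * << g r, z >>).
Proof.
move=> hf hg.
exact: (smoothM oU (smooth_scal_cst oU y hf) (smooth_scal_cst oU z hg)).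
Qed.

Lemma smooth_projector y z : smooth_on U (projector y z).
Proof.
exact: (smoothD oU (smoothD oU (smoothD oU (sm1 y z sX sX) (sm1 y z s2 s1)) (sm1 y z s1 s2))
  (sm y z eps sN sN)).
Qed.

Lemma smooth_twistor y z : smooth_on U (twistor y z).
Proof.
exact: (smoothD oU (smoothD oU (smoothD oU (sm1 y z sX sN) (sm1 y z sN sX)) (sm y z (-1) s1 s1))
  (sm y z (- eps) s2 s2)).
Qed.

Let frame_pairings a q y : U q ->
  [/\ << vpartial a X q, y >> = theta s X l2 a q * << l1 q, y >> + phi s X l1 a q * << l2 q, y >>,
      << vpartial a l1 q, y >> = theta s X l2 a q * << N q, y >> - phi s X l1 a q * << X q, y >>,
      << vpartial a l2 q, y >> = eps * phi s X l1 a q * << N q, y >> - theta s X l2 a q * << X q, y >> &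
      << vpartial a N q, y >> = - (eps * theta s X l2 a q) * << l2 q, y >> - phi s X l1 a q * << l1 q, y >>].
Proof.
move=> Uq; rewrite (dX_frame NF a Uq) (dl1_parallel eps1 B0 CF a Uq) (dl2_parallel eps1 B0 CF a Uq).
rewrite (dN_tangent eps1 B0 CF a Uq) (B_eps eps1 B0 CF Uq).
by rewrite !(scalDl, scalNl, scalZl).
Qed.

Lemma projector_flat y z a q : U q -> partial a (projector y z) q = 0.
Proof.
move=> Uq; rewrite /projector (partial_add4 oU a (sm1 y z sX sX) (sm1 y z s2 s1) (sm1 y z s1 s2) (sm y z eps sN sN) Uq).
rewrite (smooth_partialZ eps a (sm1 y z sN sN) Uq) (partial_scal_mul oU a y z sX sX Uq)(partial_scal_mul oU a y z s2 s1 Uq)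
  (partial_scal_mul oU a y z s1 s2 Uq)(partial_scal_mul oU a y z sN sN Uq).
have [-> -> -> ->] := frame_pairings a y Uq; have [-> -> -> ->] := frame_pairings a z Uq.
have : eps * eps = 1 by case: eps1 => ->; ring.
move: (theta s X l2 a q) (phi s X l1 a q) eps => t r e ee.
move: << X q, y >> << l1 q, y >> << l2 q, y >> << N q, y >> << X q, z >> << l1 q, z >> << l2 q, z >> << N q, z >> => *.
ring: ee.
Qed.

Lemma twistor_flat y z a q : U q -> partial a (twistor y z) q = 0.
Proof.
move=> Uq; rewrite /twistor (partial_add4 oU a (sm1 y z sX sN) (sm1 y z sN sX) (sm y z (-1) s1 s1) (sm y z (-eps) s2 s2) Uq).
rewrite (smooth_partialZ (-1) a (sm1 y z s1 s1) Uq) (smooth_partialZ (- eps) a (sm1 y z s2 s2) Uq) (partial_scal_mul oU a y z sX sN Uq)(partial_scal_mul oU a y z sN sX Uq)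
  (partial_scal_mul oU a y z s1 s1 Uq)(partial_scal_mul oU a y z s2 s2 Uq).
have [-> -> -> ->] := frame_pairings a y Uq; have [-> -> -> ->] := frame_pairings a z Uq.
have : eps * eps = 1 by case: eps1 => ->; ring.
move: (theta s X l2 a q) (phi s X l1 a q) eps => t r e ee.
move: << X q, y >> << l1 q, y >> << l2 q, y >> << N q, y >> << X q, z >> << l1 q, z >> << l2 q, z >> << N q, z >> => *.
ring: ee.
Qed.

(** Since both tensors are constant, [X] keeps satisfying at every point the
equations [projector X = X] and [<twistor X, X> = 0] written with the frame at
[q0]. In the basis [adapted_frame] these are the equations of the quadric. *)
Lemma flat_quadric q0 : U q0 -> \forall q \near (q0 : 'rV[R]_2),
  quadric b (adapted_frame b (X q0) (l1 q0) (l2 q0) (N q0)) (X q).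
Proof.
move=> Uq0; have /nbhs_ballP[d /= d0 dU] : nbhs q0 U by exact: open_nbhs_nbhs.
apply/nbhs_ballP; exists d => //= z qz; have Uz := dU z qz.
have [[[xx xu xv] [ux uu uv]] [vx vu vv]] := frame_scal NF Uq0.
have [nx n1 n2] := cf_normal CF Uq0; have nn := cf_NN CF Uq0.
have [[[zx zu zv] _] _] := frame_scal NF Uz; have [nz _ _] := cf_normal CF Uz.
have [uz vz] : << l1 z, X z >> = 0 /\ << l2 z, X z >> = 0 by rewrite !(scalC s _ (X z)).
apply: (adapted_frame_quadric xx xu xv uu uv vv nx n1 n2 nn zx).
  apply: (@scal_inj R n s) => y.
  have := constant_on_ball d0 dU (smooth_projector y (X z)) (projector_flat y (X z)) qz.
  rewrite /projector zx uz vz nz !mulr0 !addr0 mulr1 => ->.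
  rewrite !(scalDl, scalZl) !(scalC s (X z)); ring.
have := constant_on_ball d0 dU (smooth_twistor (X z) (X z)) (twistor_flat (X z) (X z)) qz.
rewrite /twistor zx uz vz nz !(scalC s (X z) _).
move: << X q0, X z >> << l1 q0, X z >> << l2 q0, X z >> << N q0, X z >> eps => *; lra.
Qed.

End Flat.

Lemma eigen_quadric D (X : 'rV[R]_2 -> 'rV[R]_n) lam q0 : lorentz_patch s D X -> lam != 0 -> D q0 ->
  (forall U l1 l2, U `<=` D -> null_frame s U X l1 l2 -> forall q i j l, U q ->
    patch_laplacian s X (fun r => tri (X r) (l1 r) (l2 r) i j l) q
    = lam * tri (X q) (l1 q) (l2 q) i j l) ->
  exists b (J : 'M[R]_(4, n)), isometric_embedding s (model_index b) J /\ \forall q \near (q0 : 'rV[R]_2), quadric b J (X q).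
Proof.
move=> LP l0 Dq0 eigen; have [U [l1 [l2 [Uq0 UD NF]]]] := exists_null_frame LP Dq0.
have [V [k1 [k2 [N [eps [Vq0 eps1 CF]]]]]] := exists_cartan_frame NF l0 (eigen U l1 l2 UD NF) Uq0.
have B0 : eps * lam / 2 != 0.
  by rewrite !mulf_neq0 ?invr_eq0 ?pnatr_eq0 //; case: eps1 => ->; rewrite ?oppr_eq0 oner_eq0.
have [b e] : exists b, eps = model_sign R b by case: eps1 => ->; [exists true|exists false].
rewrite e in B0 CF.
exists b, (adapted_frame b (X q0) (k1 q0) (k2 q0) (N q0)); split; last exact: flat_quadric B0 CF _ Vq0.
have NF' := cf_nf CF; have [[[xx xu xv] [ux uu uv]] [vx vu vv]] := frame_scal NF' Vq0.
have [nx n1 n2] := cf_normal CF Vq0; have nn := cf_NN CF Vq0.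
exact: adapted_frame_isometric.
Qed.

End LocalExistence.

(** * Uniqueness of the quadric *)

Section Twist.
Variables (R : realType) (b : bool).
Local Notation t := (model_index b).
Local Notation eps := (model_sign R b).
Local Notation "<< x , y >>" := (@scal R 4 t x y) (at level 0, format "<< x ,  y >>").
Implicit Types (a c : 'rV[R]_4).

Lemma model_sign_sqr : eps * eps = 1.
Proof. by rewrite /model_sign; case: b; ring. Qed.

Lemma model_sign_neq0 : eps != 0.
Proof. by rewrite /model_sign; case: b; rewrite ?oppr_eq0 oner_eq0. Qed.

Lemma twistD a c : twist b (a + c) = twist b a + twist b c.
Proof.
have [e0 e1 e2 e3] := twistE b (a + c).
have [a0 a1 a2 a3] := twistE b a; have [c0 c1 c2 c3] := twistE b c.
apply: rowP4; rewrite [RHS]mxE ?e0 ?e1 ?e2 ?e3 ?a0 ?a1 ?a2 ?a3 ?c0 ?c1 ?c2 ?c3 !mxE;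
  by case: (b); rewrite ?opprD.
Qed.

Lemma twistZ k a : twist b (k *: a) = k *: twist b a.
Proof.
have [e0 e1 e2 e3] := twistE b (k *: a); have [a0 a1 a2 a3] := twistE b a.
apply: rowP4; rewrite [RHS]mxE ?e0 ?e1 ?e2 ?e3 ?a0 ?a1 ?a2 ?a3 !mxE;
  by case: (b); rewrite ?mulrN.
Qed.

Lemma twistK a : twist b (twist b a) = eps *: a.
Proof.
have [e0 e1 e2 e3] := twistE b (twist b a); have [a0 a1 a2 a3] := twistE b a.
apply: rowP4; rewrite [RHS]mxE ?e0 ?e1 ?e2 ?e3 ?a0 ?a1 ?a2 ?a3 /model_sign;
  by case: (b); rewrite ?opprK ?mul1r ?mulN1r.
Qed.

Lemma twistC a c : << twist b a, c >> = << a, twist b c >>.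
Proof.
rewrite !scal4E; have [-> -> -> ->] := twistE b a; have [-> -> -> ->] := twistE b c.
by rewrite /model_sign; case: (b); ring.
Qed.

Lemma twist_isometry a c : << twist b a, twist b c >> = eps * << a, c >>.
Proof. by rewrite twistC twistK scalZr. Qed.

Definition twist_mx : 'M[R]_4 := \matrix_(i < 4) twist b (delta_mx 0 i).

Lemma twist_mul a : twist b a = a *m twist_mx.
Proof.
have tE : \sum_(i < 4) a 0 i *: twist b (delta_mx 0 i) = twist b a.
  rewrite [X in twist b X]row_sum_delta !sum4.
  by rewrite !twistD !twistZ.
rewrite -tE; apply/rowP => j; rewrite summxE mxE; apply: eq_bigr => i _.
by rewrite !mxE.
Qed.

Lemma gram2_inj (A B C p q : R) : A * B != C ^+ 2 -> p * A + q * C = 0 -> p * C + q * B = 0 ->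
  p = 0 /\ q = 0.
Proof.
move=> g E0 E1; have {}g : A * B - C ^+ 2 != 0 by rewrite subr_eq0.
split; apply: (mulIf g); rewrite mul0r.
  transitivity (B * (p * A + q * C) - C * (p * C + q * B)); first by ring.
  by rewrite E0 E1; ring.
transitivity (A * (p * C + q * B) - C * (p * A + q * C)); first by ring.
by rewrite E0 E1; ring.
Qed.

(** Position, two tangent vectors and the normal have an invertible Gram matrix,
so they form a basis of the 4-space. *)
Lemma frame_span a t0 t1 c z : << a, a >> = 1 -> << c, c >> = eps -> << a, c >> = 0 ->
  << a, t0 >> = 0 -> << a, t1 >> = 0 -> << c, t0 >> = 0 -> << c, t1 >> = 0 ->
  << t0, t0 >> * << t1, t1 >> != << t0, t1 >> ^+ 2 ->
  exists r0 r1, z = << z, a >> *: a + r0 *: t0 + r1 *: t1 + (eps * << z, c >>) *: c.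
Proof.
move=> aa cc ac a0 a1 c0 c1 g; set F := rows4 a t0 t1 c.
have ca : << c, a >> = 0 by rewrite scalC.
have ta : << t0, a >> = 0 by rewrite scalC.
have ta1 : << t1, a >> = 0 by rewrite scalC.
have tc : << t0, c >> = 0 by rewrite scalC.
have tc1 : << t1, c >> = 0 by rewrite scalC.
have pair w : [/\ << w *m F, a >> = w 0 0, << w *m F, c >> = eps * w 0 3,
    << w *m F, t0 >> = w 0 1 * << t0, t0 >> + w 0 2 * << t0, t1 >> &
    << w *m F, t1 >> = w 0 1 * << t0, t1 >> + w 0 2 * << t1, t1 >>].
  rewrite mulmx_rows4 !(scalDl, scalZl) aa ca ta ta1 ac cc tc tc1 a0 c0 a1 c1 (scalC t t1 t0).
  by split; ring.
have uF : F \in unitmx.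
  rewrite -row_free_unit -kermx_eq0; apply/rowV0P => w /sub_kermxP wF.
  have [] := pair w; rewrite wF !scal0l => w0 w3 w1 w2.
  have {}w3 : w 0 3 = 0.
    by apply: (mulfI model_sign_neq0); rewrite -w3 mulr0.
  have [w1' w2'] := gram2_inj g (esym w1) (esym w2).
  by apply: rowP4; rewrite mxE -?w0.
have zE : z = (z *m invmx F) *m F by rewrite mulmxKV.
have [wa wc _ _] := pair (z *m invmx F); exists ((z *m invmx F) 0 1), ((z *m invmx F) 0 2).
rewrite zE wa wc {1}mulmx_rows4 mulrA model_sign_sqr mul1r.
by rewrite -zE.
Qed.

End Twist.

Section QuadricJet.
Variable R : realType.
Local Notation "<< x , y >>_ b" := (@scal R 4 (model_index b) x y)
  (at level 0, b at level 0, format "<< x ,  y >>_ b").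

(** The relations obtained by differentiating twice the equations of the quadric
along a surface: [d] and [h] are the first and second derivatives of the position
[a]. *)
Record quadric_jet b (a : 'rV[R]_4) (d : 'I_2 -> 'rV[R]_4) (h : 'I_2 -> 'I_2 -> 'rV[R]_4) : Prop :=
  QuadricJet {
    qj_aa : << a, a >>_b = 1;
    qj_at : << a, twist b a >>_b = 0;
    qj_ad : forall c, << a, d c >>_b = 0;
    qj_td : forall c, << twist b a, d c >>_b = 0;
    qj_ha : forall c e, << h c e, a >>_b = - << d c, d e >>_b;
    qj_ht : forall c e, << h c e, twist b a >>_b = - << d c, twist b (d e) >>_b;
    qj_det : << d 0, d 0 >>_b * << d 1, d 1 >>_b != << d 0, d 1 >>_b ^+ 2 }.

Section Jet.
Variables (b : bool) (a : 'rV[R]_4) (d : 'I_2 -> 'rV[R]_4) (h : 'I_2 -> 'I_2 -> 'rV[R]_4).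
Hypothesis QJ : quadric_jet b a d h.
Local Notation eps := (model_sign R b).
Local Notation "<< x , y >>" := (<< x, y >>_b).

Lemma jet_twist_twist : << twist b a, twist b a >> = eps.
Proof. by rewrite twist_isometry (qj_aa QJ) mulr1. Qed.

Lemma jet_span z : exists r0 r1,
  z = << z, a >> *: a + r0 *: d 0 + r1 *: d 1 + (eps * << z, twist b a >>) *: twist b a.
Proof.
apply: frame_span (qj_det QJ); rewrite ?(qj_aa QJ) ?(qj_at QJ) ?(qj_ad QJ) ?(qj_td QJ) //.
exact: jet_twist_twist.
Qed.

(** The quadratic form of the second equation of the quadric is determined by
the second fundamental form of the surface. *)
Lemma jet_twist_form x r0 r1 m :
  let z := x *: a + r0 *: d 0 + r1 *: d 1 + m *: twist b a in
  << z, twist b z >> = 2 * eps * x * m + r0 * r0 * << d 0, twist b (d 0) >>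
    + 2 * (r0 * r1 * << d 0, twist b (d 1) >>) + r1 * r1 * << d 1, twist b (d 1) >>.
Proof.
rewrite /= !(twistD, twistZ) twistK !(scalDl, scalDr, scalZl, scalZr).
rewrite (qj_aa QJ) jet_twist_twist (qj_at QJ) (scalC _ (twist b a) a) (qj_at QJ).
have ta c : << a, twist b (d c) >> = 0 by rewrite -twistC (qj_td QJ).
have tta c : << twist b a, twist b (d c) >> = 0 by rewrite twist_isometry (qj_ad QJ) mulr0.
rewrite !ta !tta !(scalC _ (d _) (twist b a)) !(scalC _ (d _) a) !(qj_td QJ) !(qj_ad QJ).
rewrite (scalC _ (d 1) (twist b (d 0))) twistC; ring.
Qed.

(** The twist preserves the tangent plane and is invertible, so the second
fundamental form does not vanish. *)
Lemma jet_sff_neq0 : exists c e, << d c, twist b (d e) >> != 0.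
Proof.
apply: contrapT => no.
have h0 c e : << d c, twist b (d e) >> = 0.
  by apply/eqP; apply: contrapT => /negP ne; apply: no; exists c, e.
have T0 : twist b (d 0) = 0.
  have [r0 [r1 zE]] := jet_span (twist b (d 0)).
  have za : << twist b (d 0), a >> = 0 by rewrite twistC scalC (qj_td QJ).
  have zt : << twist b (d 0), twist b a >> = 0.
    by rewrite twist_isometry (scalC _ _ a) (qj_ad QJ) mulr0.
  apply: (@scal_nondegenerate R 4 (model_index b)) => y.
  have [s0 [s1 ->]] := jet_span y.
  by rewrite !(scalDr, scalZr) za zt !(scalC _ (twist b (d 0)) (d _)) !h0; ring.
have d0 : d 0 = 0.
  apply: (scalerI (model_sign_neq0 R b)); rewrite scaler0 -twistK T0.
  by rewrite -[X in twist b X](scale0r 0) twistZ scale0r.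
by have := qj_det QJ; rewrite d0 !scal0l mul0r expr0n eqxx.
Qed.

End Jet.

Section Uniqueness.
Variables (n s : nat).
Local Notation "<< x , y >>" := (@scal R n s x y) (at level 0, format "<< x ,  y >>").

(** The normal component of a second derivative is a multiple of the normal,
nonzero for one of them by [jet_sff_neq0]. So the 2-jet determines the normal
up to sign, hence the 4-space, and by [jet_twist_form] the quadric. *)
Lemma quadric_jet_sub b b' (J J' : 'M[R]_(4, n)) a a' d d' h h' :
  isometric_embedding s (model_index b) J -> isometric_embedding s (model_index b') J' ->
  quadric_jet b a d h -> quadric_jet b' a' d' h' ->
  a *m J = a' *m J' -> (forall c, d c *m J = d' c *m J') ->
  (forall c e, h c e *m J = h' c e *m J') ->
  b = b' /\ quadric b J `<=` quadric b' J'.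
Proof.
move=> iJ iJ' QJ QJ' Ea Ed Eh.
have Edd c e : << d c, d e >>_b = << d' c, d' e >>_b' by rewrite -iJ !Ed iJ'.
pose N := twist b a *m J; pose N' := twist b' a' *m J'.
pose X c := d c *m J.
have NX c : << N, X c >> = 0 by rewrite iJ (qj_td QJ).
have N'X c : << N', X c >> = 0 by rewrite /X Ed iJ' (qj_td QJ').
have g : << X 0, X 0 >> * << X 1, X 1 >> != << X 0, X 1 >> ^+ 2.
  by rewrite /X !iJ; exact: qj_det QJ.
have sffE c e : (model_sign R b * << d c, twist b (d e) >>_b) *: N =
    (model_sign R b' * << d' c, twist b' (d' e) >>_b') *: N'.
  have [r0 [r1 hE]] := jet_span QJ (h c e).
  have [q0 [q1 hE']] := jet_span QJ' (h' c e).
  move: hE hE'; rewrite (qj_ha QJ) (qj_ht QJ) (qj_ha QJ') (qj_ht QJ').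
  move=> /(congr1 (mulmx^~ J)) E1 /(congr1 (mulmx^~ J')) E2.
  move: E1 E2; rewrite /= Eh => -> E2; move: E2.
  rewrite !mulmxDl -!scalemxAl Ea Edd -/N -/N' -!Ed -/(X 0) -/(X 1).
  rewrite !mulrN; move: (model_sign R b * _) (model_sign R b' * _) => u v E2.
  pose T := (r0 - q0) *: X 0 + (r1 - q1) *: X 1.
  have TE : T = u *: N - v *: N'.
    apply/eqP; rewrite -subr_eq0; apply/eqP; move/eqP: E2; rewrite -subr_eq0 => /eqP <-.
    by apply/rowP => j; rewrite !mxE; move: (N 0 j) (N' 0 j) (X 0 0 j) (X 1 0 j) ((a' *m J') 0 j) => *; ring.
  have T0 c' : << T, X c' >> = 0 by rewrite TE !(scalDl, scalNl, scalZl) NX N'X; ring.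
  have : r0 - q0 = 0 /\ r1 - q1 = 0.
    apply: (gram2_inj g).
      by rewrite -[RHS](T0 0) /T !(scalDl, scalZl) (scalC s (X 1) (X 0)).
    by rewrite -[RHS](T0 1) /T !(scalDl, scalZl).
  move=> [e0 e1]; move: TE; rewrite /T e0 e1 !scale0r addr0 => /esym/eqP.
  by rewrite subr_eq0 => /eqP.
have [c [e ce]] := jet_sff_neq0 QJ.
have [k NE] : exists k, N = k *: N'.
  exists ((model_sign R b * << d c, twist b (d e) >>_b)^-1 * (model_sign R b' * << d' c, twist b' (d' e) >>_b')).
  by rewrite -scalerA -sffE scalerA mulVf ?scale1r // mulf_neq0 // model_sign_neq0.
have NN : << N, N >> = model_sign R b by rewrite iJ (jet_twist_twist QJ).
have NN' : << N', N' >> = model_sign R b' by rewrite iJ' (jet_twist_twist QJ').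
have kk : model_sign R b = k * k * model_sign R b'.
  by rewrite -NN NE scalZl scalZr NN' mulrA.
have bb : b = b'.
  have := sqr_ge0 k; rewrite expr2; move: kk; rewrite /model_sign.
  by case: (b); case: (b') => //; lra.
split=> //.
have {}kk : k * k = 1.
  by apply: (mulIf (model_sign_neq0 R b')); rewrite mul1r -kk bb.
have sffE' c' e' : << d' c', twist b' (d' e') >>_b' = k * << d c', twist b (d e') >>_b.
  have := congr1 (fun v => << v, N' >>) (sffE c' e').
  rewrite /= NE !scalZl NN' bb => H; apply: (mulfI (model_sign_neq0 R b')).
  apply: (mulIf (model_sign_neq0 R b')); rewrite -H; ring.
move=> _ [z [zz zt] <-]; have [r0 [r1 zE]] := jet_span QJ z.
have := jet_twist_form QJ << z, a >>_b r0 r1 (model_sign R b * << z, twist b a >>_b).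
rewrite /= -zE zt.
move: zE; move: << z, a >>_b (model_sign R b * << z, twist b a >>_b) => x m zE F0.
set z' := x *: a' + r0 *: d' 0 + r1 *: d' 1 + (m * k) *: twist b' a'.
have zJ : z' *m J' = z *m J.
  by rewrite [in RHS]zE !mulmxDl -!scalemxAl -/N -/N' Ea !Ed NE scalerA.
exists z' => //; split; first by rewrite -iJ' zJ iJ.
rewrite (jet_twist_form QJ') !sffE' -bb.
move: F0; move: (model_sign R b) << d 0, twist b (d 0) >>_b << d 0, twist b (d 1) >>_b
  << d 1, twist b (d 1) >>_b => e1 A B C F0.
transitivity (k * 0); last by rewrite mulr0.
by rewrite [in RHS]F0; ring.
Qed.

End Uniqueness.

Lemma smoothv_mul p n (U : set 'rV[R]_p) k (f : _ -> 'rV[R]_k) (A : 'M[R]_(k, n)) : open U ->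
  smooth_map_on U f -> smooth_map_on U (fun q => f q *m A).
Proof.
move=> oU sf j; apply: (smooth_eq oU (f := fun q => \sum_i f q 0 i * A i j)).
  by move=> z _; rewrite mxE.
exact: (smooth_sum oU _ (fun i => smoothM oU (sf i) (smooth_cst (A i j)))).
Qed.

Lemma vpartial_mul p n (U : set 'rV[R]_p) k (f : _ -> 'rV[R]_k) (A : 'M[R]_(k, n)) c q : open U ->
  smooth_map_on U f -> U q -> vpartial c (fun r => f r *m A) q = vpartial c f q *m A.
Proof.
move=> oU sf Uq; apply/rowP => j; rewrite vpartialE mxE.
rewrite (eq_partial (g := fun q => \sum_i f q 0 i * A i j) c oU _ Uq); last first.
  by move=> z _; rewrite mxE.
rewrite (partial_sum oU _ _ (fun i => smoothM oU (sf i) (smooth_cst (A i j))) Uq).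
apply: eq_bigr => i _; rewrite vpartialE.
by rewrite (smooth_partialM c (sf i) (smooth_cst (A i j)) Uq) partial_cst mulr0 addr0.
Qed.

Section Patch.
Variables (n s : nat) (b : bool) (J : 'M[R]_(4, n)).
Hypothesis iJ : isometric_embedding s (model_index b) J.
Local Notation t := (model_index b).

(** The coordinates of the point in the orthonormal basis formed by the rows of
[J]. *)
Definition quadric_coords (y : 'rV[R]_n) : 'rV[R]_4 :=
  \row_(i < 4) ((if (i < 4 - t)%N then 1 else -1) * scal s (row i J) y).

Lemma quadric_coordsK a : quadric_coords (a *m J) = a.
Proof.
apply/rowP => i; rewrite mxE rowE iJ (scalC t) scal_delta mulrA.
by case: ifP => _; ring.
Qed.

Lemma smooth_quadric_coords p (U : set 'rV[R]_p) f : open U -> smooth_map_on U f ->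
  smooth_map_on U (fun q => quadric_coords (f q)).
Proof.
move=> oU sf i; apply: (smooth_eq oU (f := fun q =>
    (if (i < 4 - t)%N then 1 else -1) * scal s (row i J) (f q))).
  by move=> z _; rewrite mxE.
apply: (smoothM oU (smooth_cst _)).
exact: (smooth_scal s oU (fun j => smooth_cst (row i J 0 j)) sf).
Qed.

Record quadric_patch U (X : 'rV[R]_2 -> 'rV[R]_n) (a : 'rV[R]_2 -> 'rV[R]_4) : Prop := QuadricPatch {
  qp_lorentz : lorentz_patch s U X;
  qp_smooth : smooth_map_on U a;
  qp_X : forall q, U q -> X q = a q *m J;
  qp_aa : forall q, U q -> << a q, a q >>_b = 1;
  qp_at : forall q, U q -> << a q, twist b (a q) >>_b = 0 }.

Lemma lorentz_patch_sub U D (X : 'rV[R]_2 -> 'rV[R]_n) : open U -> U `<=` D ->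
  lorentz_patch s D X -> lorentz_patch s U X.
Proof.
move=> oU UD [oD sX XX dt sp]; split=> //.
- by move=> j; exact: (smooth_sub UD (sX j)).
- by move=> q /UD; exact: XX.
- by move=> q /UD; exact: dt.
- by move=> q /UD; exact: sp.
Qed.

Lemma exists_quadric_patch D X q0 : lorentz_patch s D X -> D q0 ->
  (\forall q \near (q0 : 'rV[R]_2), quadric b J (X q)) ->
  exists U, [/\ U q0, U `<=` D & quadric_patch U X (fun q => quadric_coords (X q))].
Proof.
move=> LP Dq0 nQ; pose U := [set q | D q /\ quadric b J (X q)]^°.
have UD : U `<=` D by move=> q /interior_subset[].
have Uq0 : U q0 by apply: (filterI (open_near (lp_open LP) Dq0) nQ).
have UQ q : U q -> quadric b J (X q) by move=> /interior_subset[].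
exists U; split=> //; have LPU := lorentz_patch_sub (@open_interior _ _) UD LP.
split=> //.
- exact: smooth_quadric_coords (lp_open LPU) (lp_smooth LPU).
- by move=> q /= /UQ[a _ <-]; rewrite quadric_coordsK.
- by move=> q /= /UQ[a [aa _] <-]; rewrite quadric_coordsK.
- by move=> q /= /UQ[a [_ ta] <-]; rewrite quadric_coordsK.
Qed.

Section Jets.
Variables (U : set 'rV[R]_2) (X : 'rV[R]_2 -> 'rV[R]_n) (a : 'rV[R]_2 -> 'rV[R]_4).
Hypothesis QP : quadric_patch U X a.
Let oU := lp_open (qp_lorentz QP).
Let sa := qp_smooth QP.

Lemma patch_dX c q : U q -> vpartial c X q = vpartial c a q *m J.
Proof.
by move=> Uq; rewrite (eq_vpartial oU c (qp_X QP) Uq); exact: (vpartial_mul J c oU sa Uq).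
Qed.

Lemma patch_d2X c e q : U q -> vpartial c (vpartial e X) q = vpartial c (vpartial e a) q *m J.
Proof.
move=> Uq; rewrite (eq_vpartial oU c (fun z Uz => patch_dX e Uz) Uq).
exact: (vpartial_mul J c oU (smooth_vpartial oU e sa) Uq).
Qed.

Lemma smooth_twist f : smooth_map_on U f -> smooth_map_on U (fun q => twist b (f q)).
Proof.
move=> sf j; apply: (smooth_eq oU (f := fun q => (f q *m twist_mx R b) 0 j)).
  by move=> z _; rewrite twist_mul.
exact: (smoothv_mul (twist_mx R b) oU sf j).
Qed.

Lemma vpartial_twist c f q : smooth_map_on U f -> U q ->
  vpartial c (fun z => twist b (f z)) q = twist b (vpartial c f q).
Proof.
move=> sf Uq.
rewrite (eq_vpartial oU (g := fun z => f z *m twist_mx R b) c _ Uq); last first.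
  by move=> z _; rewrite twist_mul.
by rewrite (vpartial_mul _ c oU sf Uq) twist_mul.
Qed.

Lemma scal_cst_partial c (f g : 'rV[R]_2 -> 'rV[R]_4) k q : smooth_map_on U f ->
  smooth_map_on U g -> (forall z, U z -> << f z, g z >>_b = k) -> U q ->
  << vpartial c f q, g q >>_b + << f q, vpartial c g q >>_b = 0.
Proof.
move=> sf sg h Uq; rewrite -(partial_scal t oU c sf sg Uq).
by rewrite (eq_partial c oU h Uq) partial_cst.
Qed.

Lemma patch_jet q : U q ->
  quadric_jet b (a q) (fun c => vpartial c a q) (fun c e => vpartial c (vpartial e a) q).
Proof.
move=> Uq; have sd c := smooth_vpartial oU c sa; have st := smooth_twist sa.
have two z : z + z = 0 -> z = 0 :> R by move=> h; lra.
have ad c z : U z -> << a z, vpartial c a z >>_b = 0.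
  move=> Uz; have := scal_cst_partial c sa sa (qp_aa QP) Uz.
  by rewrite (scalC t (vpartial c a z)); exact: two.
have td c z : U z -> << twist b (a z), vpartial c a z >>_b = 0.
  move=> Uz; have := scal_cst_partial c sa st (qp_at QP) Uz.
  rewrite (vpartial_twist c sa Uz) (twistC b (a z)) -(twistC b (vpartial c a z)).
  rewrite (scalC t (twist b (vpartial c a z))); exact: two.
split.
- exact: qp_aa QP _ Uq.
- exact: qp_at QP _ Uq.
- by move=> c; exact: ad.
- by move=> c; exact: td.
- move=> c e; have := scal_cst_partial c sa (sd e) (ad e) Uq.
  by rewrite addrC => /eqP; rewrite addr_eq0 (scalC t (a q)) => /eqP.
- move=> c e; have := scal_cst_partial c st (sd e) (td e) Uq.
  rewrite addrC (vpartial_twist c sa Uq) (twistC b (vpartial c a q)) => /eqP; rewrite addr_eq0.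
  by rewrite (scalC t (twist b _)) => /eqP.
- have := lp_det (qp_lorentz QP) Uq.
  by rewrite !(patch_dX _ Uq) !iJ => h; rewrite lt_eqF.
Qed.

End Jets.
End Patch.

Lemma quadric_unique n s b b' (J J' : 'M[R]_(4, n)) D X q0 :
  isometric_embedding s (model_index b) J -> isometric_embedding s (model_index b') J' ->
  lorentz_patch s D X -> D q0 ->
  (\forall q \near (q0 : 'rV[R]_2), quadric b J (X q)) ->
  (\forall q \near (q0 : 'rV[R]_2), quadric b' J' (X q)) ->
  b = b' /\ quadric b J = quadric b' J'.
Proof.
move=> iJ iJ' LP Dq0 nQ nQ'.
have [U [Uq UD QP]] := exists_quadric_patch iJ LP Dq0 nQ.
have [V [Vq VD QP']] := exists_quadric_patch iJ' LP Dq0 nQ'.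
have jJ := patch_jet iJ QP Uq; have jJ' := patch_jet iJ' QP' Vq.
have E0 : quadric_coords s b J (X q0) *m J = quadric_coords s b' J' (X q0) *m J'.
  by rewrite -(qp_X QP Uq) -(qp_X QP' Vq).
have E1 c := etrans (esym (patch_dX QP c Uq)) (patch_dX QP' c Vq).
have E2 c e := etrans (esym (patch_d2X QP c e Uq)) (patch_d2X QP' c e Vq).
have [bb h] := quadric_jet_sub iJ iJ' jJ jJ' E0 E1 E2.
have [_ h'] := quadric_jet_sub iJ' iJ jJ' jJ (esym E0) (fun c => esym (E1 c)) (fun c e => esym (E2 c e)).
by split=> //; apply/seteqP.
Qed.

End QuadricJet.

(** * The surface is open in its quadric *)

Section Openness.
Variables (R : realType) (n s : nat).
Local Notation "<< x , y >>" := (@scal R n s x y) (at level 0, format "<< x ,  y >>").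

Lemma scal_continuous (y : 'rV[R]_n) : continuous (fun z => << z, y >>).
Proof.
have sid : smooth_map_on [set: 'rV[R]_n] (fun z => z) by move=> j; exact: smooth_coord.
by move=> z; exact: smooth_continuous (smooth_scal_cst s openT y sid) I.
Qed.

Lemma smooth_map_continuous p k (U : set 'rV[R]_p) (G : 'rV[R]_p -> 'rV[R]_k) q :
  open U -> smooth_map_on U G -> U q -> {for q, continuous G}.
Proof.
move=> oU sG Uq.
by have [/differentiable_continuous] := is_diff_coords oU (fun j => smooth_C1 (sG j)) Uq.
Qed.

Lemma det2 (A : 'M[R]_2) : \det A = A 0 0 * A 1 1 - A 0 1 * A 1 0.
Proof.
rewrite (expand_det_row _ 0) sum2 /cofactor !det_mx11 !mxE /=.
have e1 : lift (0 : 'I_2) (0 : 'I_1) = 1 by apply/val_inj.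
have e0 : lift (1 : 'I_2) (0 : 'I_1) = 0 by apply/val_inj.
by rewrite e1 e0; ring.
Qed.

Lemma gmx_unit D (X : 'rV[R]_2 -> 'rV[R]_n) q : lorentz_patch s D X -> D q -> gmx s X q \in unitmx.
Proof.
move=> LP Dq; rewrite unitmxE unitfE det2 !mxE.
have := lp_det LP Dq; rewrite (scalC s (vpartial 1 X q) (vpartial 0 X q)).
by move=> h; rewrite subr_eq0 lt_eqF // -expr2.
Qed.

(** The difference of two points with the same projection on the tangent plane
is a combination of [a] and [c]. The two equations of the quadric, polarized,
are a linear system for its coefficients, whose determinant is [p ^+ 2] minus
or plus [r ^+ 2], where [p] and [r] are the products of the sum of the points
with [a] and [c]. On the cone where [r] is smaller than [p] it is invertible.
*)
Lemma quadric_projection_inj b (a t0 t1 z z' : 'rV[R]_4) :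
  let t := model_index b in let c := twist b a in
  scal t a a = 1 -> scal t a c = 0 ->
  scal t a t0 = 0 -> scal t a t1 = 0 -> scal t c t0 = 0 -> scal t c t1 = 0 ->
  scal t t0 t0 * scal t t1 t1 != scal t t0 t1 ^+ 2 ->
  scal t z z = 1 -> scal t z (twist b z) = 0 -> scal t z' z' = 1 -> scal t z' (twist b z') = 0 ->
  `|scal t z c| < scal t z a -> `|scal t z' c| < scal t z' a ->
  scal t z t0 = scal t z' t0 -> scal t z t1 = scal t z' t1 -> z = z'.
Proof.
move=> t c aa ac a0 a1 c0 c1 g zz zt zz' zt' hz hz' E0 E1.
apply/eqP; rewrite -subr_eq0; apply/eqP; set dl := z - z'; set m := z + z'.
have cc : scal t c c = model_sign R b by rewrite twist_isometry aa mulr1.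
have d0 : scal t dl t0 = 0 by rewrite scalDl scalNl E0 subrr.
have d1 : scal t dl t1 = 0 by rewrite scalDl scalNl E1 subrr.
have [r0 [r1 dE]] := frame_span dl aa cc ac a0 a1 c0 c1 g.
have m1 : scal t dl m = 0.
  by rewrite /dl /m !(scalDl, scalDr, scalNl) zz zz' (scalC t z' z); ring.
have m2 : scal t dl (twist b m) = 0.
  rewrite /dl /m twistD !(scalDl, scalDr, scalNl) zt zt' -(twistC b z' z).
  by rewrite (scalC t (twist b z') z); ring.
have [r00 r10] : r0 = 0 /\ r1 = 0.
  apply: (gram2_inj g).
    by rewrite -[RHS]d0 dE !(scalDl, scalZl) a0 c0 (scalC t t1 t0); ring.
  by rewrite -[RHS]d1 dE !(scalDl, scalZl) a1 c1; ring.
move: dE; rewrite r00 r10 !scale0r !addr0.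
have [p0 rp] : 0 < scal t a m /\ `|scal t c m| < scal t a m.
  rewrite /m !scalDr !(scalC t _ z) !(scalC t _ z').
  have h : `|scal t z c + scal t z' c| < scal t z a + scal t z' a.
    by apply: (le_lt_trans (ler_normD _ _)); exact: ltrD.
  by split=> //; exact: le_lt_trans h.
move: (scal t dl a) (scal t dl c) => al be dE.
have e1 : al * scal t a m + model_sign R b * be * scal t c m = 0.
  by rewrite -m1 dE !(scalDl, scalZl).
have e2 : al * scal t c m + be * scal t a m = 0.
  rewrite -m2 -twistC dE twistD !twistZ twistK !(scalDl, scalZl) -/c.
  by have := model_sign_sqr R b; move: (model_sign R b) => e ee; ring: ee.
have h : scal t a m ^+ 2 - model_sign R b * scal t c m ^+ 2 != 0.
  have : scal t c m ^+ 2 < scal t a m ^+ 2.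
    move: rp; rewrite ltr_norml => /andP[l1 l2].
    have l3 : 0 < scal t a m + scal t c m by move: l1; lra.
    by rewrite -subr_gt0 subr_sqr mulr_gt0 // subr_gt0.
  have := sqr_ge0 (scal t c m); move: rp p0; move: (scal t a m) (scal t c m) => p r _ _ ? ?.
  by rewrite gt_eqF // /model_sign; case: (b); lra.
have al0 : al = 0.
  apply: (mulIf h); rewrite mul0r.
  transitivity (scal t a m * (al * scal t a m + model_sign R b * be * scal t c m)
    - model_sign R b * scal t c m * (al * scal t c m + be * scal t a m)); first by ring.
  by rewrite e1 e2; ring.
have be0 : be = 0.
  by apply: (mulIf (lt0r_neq0 p0)); rewrite mul0r -e2 al0; ring.
by rewrite dE al0 be0 mulr0 !scale0r addr0.
Qed.

(** Projected on the tangent plane, the surface covers a neighbourhood by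
[local_surjectivity], whereas the quadric projects injectively near the point.
*)
Lemma quadric_image_open b (J : 'M[R]_(4, n)) D X q0 (W : set 'rV[R]_2) :
  isometric_embedding s (model_index b) J -> lorentz_patch s D X -> D q0 ->
  (\forall q \near (q0 : 'rV[R]_2), quadric b J (X q)) -> nbhs q0 W ->
  \forall y \near X q0, quadric b J y -> (X @` W) y.
Proof.
move=> iJ LP Dq0 nQ nW.
have [U [Uq UD QP]] := exists_quadric_patch iJ LP Dq0 nQ.
have LPU := qp_lorentz QP; have oU := lp_open LPU; have sX := lp_smooth LPU.
set a := fun q => quadric_coords s b J (X q) in QP; have QJ := patch_jet iJ QP Uq.
pose T c := vpartial c X q0; pose N := twist b (a q0) *m J.
pose pr y : 'rV[R]_2 := \row_c << y, T c >>.
pose O := [set y | `|<< y, N >>| < << y, X q0 >>].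
have O1 : nbhs (X q0) O.
  have aN : << X q0, N >> = 0 by rewrite (qp_X QP Uq) iJ (qj_at QJ).
  have h : 0 < << X q0, X q0 >> - `|<< X q0, N >>|.
    by rewrite aN normr0 subr0 (lp_sphere LPU Uq).
  have ct : (fun y => << y, X q0 >> - `|<< y, N >>|) @ X q0 -->
      << X q0, X q0 >> - `|<< X q0, N >>|.
    exact: (cvgB (@scal_continuous (X q0) (X q0)) (cvg_norm (@scal_continuous N (X q0)))).
  move/cvgrPdist_lt: ct => /(_ _ h); apply: filterS => y.
  by rewrite /O /= ltr_norml => /andP[_]; rewrite ltrBlDr ltrDl subr_gt0.
have XO : nbhs q0 (X @^-1` O).
  exact: (smooth_map_continuous oU sX Uq).
have nW1 : nbhs q0 (W `&` U `&` X @^-1` O).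
  exact: filterI (filterI nW (open_near oU Uq)) XO.
have prW : nbhs (pr (X q0)) ((pr \o X) @` (W `&` U `&` X @^-1` O)).
  have prX c : (fun r => (pr (X r)) 0 c) = fun r => << X r, T c >>.
    by apply/funext => r; rewrite mxE.
  apply: (@local_surjectivity _ _ U _ (pr \o X) q0 (gmx s X q0)) => //.
  - move=> c /=; rewrite prX; exact: (smooth_C1 (smooth_scal_cst s oU (T c) sX)).
  - move=> v; apply/rowP => c; rewrite !mxE /gradient /= prX; apply: eq_bigr => i _.
    by rewrite (partial_scal_cst s oU i (T c) sX Uq) mxE.
  - exact: gmx_unit LPU Uq.
have O2 : \forall y \near X q0, ((pr \o X) @` (W `&` U `&` X @^-1` O)) (pr y).
  have sid : smooth_map_on [set: 'rV[R]_n] (fun z => z) by move=> j; exact: smooth_coord.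
  have spr : smooth_map_on [set: 'rV[R]_n] pr.
    move=> c; rewrite (_ : (fun y => pr y 0 c) = fun y => << y, T c >>).
      exact: (smooth_scal_cst s openT (T c) sid).
    by apply/funext => y; rewrite mxE.
  exact: (smooth_map_continuous openT spr I).
apply: filterS (filterI O1 O2) => y [y1 [q [[Wq Uq'] q1] E]] [z [zz zt] zy].
exists q => //; rewrite (qp_X QP Uq') -zy; congr (_ *m J).
have pE c : << X q, T c >> = << y, T c >>.
  by move/rowP: E => /(_ c); rewrite !mxE.
move: pE y1 q1; rewrite /O /= -zy /T /N (qp_X QP Uq') (qp_X QP Uq) => pE y1 q1.
have p0 := pE 0; have p1 := pE 1.
rewrite !(patch_dX QP _ Uq) !iJ in p0 p1.
rewrite !iJ in y1 q1.
exact: (quadric_projection_inj (qj_aa QJ) (qj_at QJ) (qj_ad QJ 0) (qj_ad QJ 1) (qj_td QJ 0)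
  (qj_td QJ 1) (qj_det QJ) (qp_aa QP Uq') (qp_at QP Uq') zz zt q1 y1 p0 p1).
Qed.

End Openness.

(** * Parametrization of the quadrics *)

Section Models.
Variable R : realType.
Implicit Types u v : R.

Lemma circle_angle (c d : R) : c ^+ 2 + d ^+ 2 = 1 -> exists v, c = cos v /\ d = sin v.
Proof.
move=> cd; have c1 : -1 <= c <= 1.
  rewrite -ler_norml -(@ler_pXn2r _ 2) ?nnegrE // expr1n real_normK ?num_real // -cd lerDl.
  exact: sqr_ge0.
have sE : sin (acos c) = `|d|.
  by rewrite sin_acos // (_ : 1 - c ^+ 2 = d ^+ 2) ?sqrtr_sqr // -cd addrC addKr.
have cE : cos (acos c) = c by rewrite acosK // in_itv.
have [d0|d0] := leP 0 d.
  by exists (acos c); rewrite sE cE ger0_norm.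
by exists (- acos c); rewrite cosN sinN sE cE ltr0_norm // opprK.
Qed.

Lemma cosh2Bsinh2 u : cosh u ^+ 2 - sinh u ^+ 2 = 1.
Proof.
have := expRxMexpNx_1 u; rewrite /cosh /sinh; move: (expR u) (expR (- u)) => x y h.
by transitivity (x * y); [field | exact: h].
Qed.

Lemma hyperbola_angle (c d : R) : c ^+ 2 - d ^+ 2 = 1 -> 0 < c ->
  exists u, c = cosh u /\ d = sinh u.
Proof.
move=> cd c0; have cdM : (c + d) * (c - d) = 1 by rewrite -cd; ring.
have cd0 : 0 < c + d.
  rewrite ltNge; apply/negP => h; have h' : 0 < c - d by lra.
  by have := mulr_le0_ge0 h (ltW h'); rewrite cdM; lra.
exists (ln (c + d)); have e1 : expR (ln (c + d)) = c + d by rewrite lnK.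
have e2 : expR (- ln (c + d)) = c - d.
  by rewrite expRN e1; apply: (mulfI (lt0r_neq0 cd0)); rewrite mulfV ?lt0r_neq0.
by rewrite /cosh /sinh e1 e2; split; field.
Qed.

Definition model (b : bool) : R -> R -> 'rV[R]_4 := if b then @model1 R else @model2 R.

Lemma model_quadric b u v : [/\ scal (model_index b) (model b u v) (model b u v) = 1,
  scal (model_index b) (model b u v) (twist b (model b u v)) = 0 & b -> 0 < model b u v 0 2].
Proof.
rewrite scal_twist scal4E /model /model_sign; case: b.
  have [e0 e1 e2 e3] := row4E (cos u) (sin u) (cosh v) (sinh v).
  have mE i : model1 u v 0 i = half_root R * row4 (cos u) (sin u) (cosh v) (sinh v) 0 i.
    by rewrite mxE.
  rewrite !mE e0 e1 e2 e3.
  have := cos2Dsin2 u; have := cosh2Bsinh2 v; have := half_root2 R.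
  have r0 : 0 < half_root R by rewrite invr_gt0 sqrtr_gt0.
  have ch0 : 0 < cosh v by rewrite divr_gt0 // addr_gt0 // expR_gt0.
  move: (cos u) (sin u) (sinh v) (cosh v) r0 ch0 => c d sh ch; move: (half_root R) => h r0 ch0 hh cs hs.
  split; last by move=> _; exact: mulr_gt0.
    transitivity (h * h * ((c ^+ 2 + d ^+ 2) + (ch ^+ 2 - sh ^+ 2))); first by ring.
    by rewrite hs cs hh; field.
  transitivity (h * h * ((ch ^+ 2 - sh ^+ 2) - (c ^+ 2 + d ^+ 2))); first by ring.
  by rewrite hs cs; ring.
have [e0 e1 e2 e3] := row4E (cosh u * cos v) (cosh u * sin v) (sinh u * cos v) (sinh u * sin v).
rewrite /model2 e0 e1 e2 e3; have := cos2Dsin2 v; have := cosh2Bsinh2 u.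
move: (cos v) (sin v) (sinh u) (cosh u) => c d sh ch hs cs.
split=> //; last by ring.
transitivity ((ch ^+ 2 - sh ^+ 2) * (c ^+ 2 + d ^+ 2)); first by ring.
by rewrite hs cs mulr1.
Qed.

Lemma model_onto b a : scal (model_index b) a a = 1 -> scal (model_index b) a (twist b a) = 0 ->
  (b -> 0 < a 0 2) -> exists u v, a = model b u v.
Proof.
rewrite scal_twist scal4E /model /model_sign; case: b => aa ta a2.
  have r2 : Num.sqrt 2 * Num.sqrt 2 = 2 :> R by rewrite -expr2 sqr_sqrtr.
  have r0 : 0 < Num.sqrt 2 :> R by rewrite sqrtr_gt0.
  have [|u [cu su]] := @circle_angle (Num.sqrt 2 * a 0 0) (Num.sqrt 2 * a 0 1).
    rewrite !exprMn expr2 r2; lra.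
  have [||v [cv sv]] := @hyperbola_angle (Num.sqrt 2 * a 0 2) (Num.sqrt 2 * a 0 3).
  - rewrite !exprMn expr2 r2; lra.
  - by rewrite mulr_gt0 // a2.
  exists u, v; rewrite /model1; have [e0 e1 e2 e3] := row4E (cos u) (sin u) (cosh v) (sinh v).
  by apply: rowP4; rewrite mxE ?e0 ?e1 ?e2 ?e3 -?cu -?su -?cv -?sv mulKf // lt0r_neq0.
move: aa ta; set p := a 0 0; set q := a 0 1; set r := a 0 2; set t := a 0 3 => aa ta.
pose rho := Num.sqrt (p ^+ 2 + q ^+ 2).
have rr : rho * rho = p ^+ 2 + q ^+ 2 by rewrite -expr2 sqr_sqrtr // addr_ge0 ?sqr_ge0.
have rho0 : 0 < rho.
  by rewrite sqrtr_gt0; have := sqr_ge0 r; have := sqr_ge0 t; lra.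
have rn : rho != 0 by rewrite lt0r_neq0.
have [|v [cv sv]] := @circle_angle (p / rho) (q / rho).
  by rewrite !exprMn -mulrDl -rr -expr2 -exprMn mulfV // expr1n.
pose sg := r * cos v + t * sin v.
have pE : p = rho * cos v by rewrite -cv mulrC divfK.
have qE : q = rho * sin v by rewrite -sv mulrC divfK.
have rt : cos v * t = sin v * r.
  by apply: (mulfI rn); rewrite !mulrA -pE -qE; lra.
have cs := cos2Dsin2 v.
have rE : sg * cos v = r.
  rewrite /sg; transitivity (r * cos v ^+ 2 + (cos v * t) * sin v); first by ring.
  by rewrite rt -[RHS]mulr1 -cs; ring.
have tE : sg * sin v = t.
  rewrite /sg; transitivity (cos v * (sin v * r) + t * sin v ^+ 2); first by ring.
  by rewrite -rt -[RHS]mulr1 -cs; ring.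
have [||u [cu su]] := @hyperbola_angle rho sg; last 2 first.
- exact: rho0.
- exists u, v; rewrite /model2.
  have [e0 e1 e2 e3] := row4E (cosh u * cos v) (cosh u * sin v) (sinh u * cos v) (sinh u * sin v).
  by apply: rowP4; rewrite ?e0 ?e1 ?e2 ?e3 -?cu -?su // ?rE ?tE.
rewrite -[RHS]aa; transitivity (rho * rho - sg ^+ 2 * (cos v ^+ 2 + sin v ^+ 2)).
  by rewrite cs; ring.
rewrite rr mulrDr -!exprMn rE tE; ring.
Qed.

(** The first quadric has two sheets, distinguished by the sign of the third
coordinate; the parametrization covers only the positive one. *)
Definition sheet_flip : 'M[R]_4 := diag_mx (row4 1 1 (-1) 1).

Lemma sheet_flipE a : a *m sheet_flip = row4 (a 0 0) (a 0 1) (- a 0 2) (a 0 3).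
Proof.
have [e0 e1 e2 e3] := row4E 1 1 (-1 : R) 1.
have [f0 f1 f2 f3] := row4E (a 0 0) (a 0 1) (- a 0 2) (a 0 3).
by apply: rowP4; rewrite mul_mx_diag mxE ?e0 ?e1 ?e2 ?e3 ?f0 ?f1 ?f2 ?f3 ?mulr1 ?mulrN1.
Qed.

Lemma sheet_flip_isometric n s (J : 'M[R]_(4, n)) : isometric_embedding s 1 J ->
  isometric_embedding s 1 (sheet_flip *m J).
Proof.
move=> iJ a c; rewrite !mulmxA iJ !sheet_flipE !(scal4E true).
have [e0 e1 e2 e3] := row4E (a 0 0) (a 0 1) (- a 0 2) (a 0 3).
have [f0 f1 f2 f3] := row4E (c 0 0) (c 0 1) (- c 0 2) (c 0 3).
by rewrite e0 e1 e2 e3 f0 f1 f2 f3; ring.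
Qed.

Lemma quadric_sheet_flip n (J : 'M[R]_(4, n)) : quadric true (sheet_flip *m J) = quadric true J.
Proof.
have sub (K : 'M[R]_(4, n)) : quadric true (sheet_flip *m K) `<=` quadric true K.
  move=> _ [a [aa ta] <-]; exists (a *m sheet_flip); last by rewrite mulmxA.
  move: aa ta; rewrite !scal_twist !scal4E sheet_flipE /model_sign.
  have [f0 f1 f2 f3] := row4E (a 0 0) (a 0 1) (- a 0 2) (a 0 3).
  by move=> aa ta; split; rewrite ?scal_twist ?scal4E f0 f1 f2 f3 /model_sign; lra.
apply/seteqP; split; first exact: sub.
have := sub (sheet_flip *m J); suff -> : sheet_flip *m (sheet_flip *m J) = J by [].
rewrite mulmxA (_ : sheet_flip *m sheet_flip = 1%:M) ?mul1mx //.
apply/row_matrixP => i; rewrite row_mul row1 rowE -mulmxA.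
move: (delta_mx 0 i) => a; rewrite mulmxA !sheet_flipE.
have [f0 f1 f2 f3] := row4E (a 0 0) (a 0 1) (- a 0 2) (a 0 3).
by rewrite f0 f1 f2 f3 opprK; apply: rowP4; have [] := row4E (a 0 0) (a 0 1) (a 0 2) (a 0 3).
Qed.

(** The largest open set that meets the quadric inside [A] cuts [A] out of the
image of the model. *)
Lemma open_part_of_model n s b (J : 'M[R]_(4, n)) (A : set 'rV[R]_n) :
  isometric_embedding s (model_index b) J -> A `<=` quadric b J ->
  (forall p, A p -> \forall y \near p, quadric b J y -> A y) ->
  (b -> forall p, A p -> 0 < quadric_coords s b J p 0 2) ->
  exists2 O, open O & A = [set model b w.1 w.2 *m J | w in [set: R * R]] `&` O.
Proof.
move=> iJ AQ Aop sheet; pose O := [set y | quadric b J y -> A y]^°.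
exists O; first exact: open_interior.
apply/seteqP; split=> [y Ay|y [[[u v] _ <-] /interior_subset h]].
  split; last exact: Aop.
  have [a [aa ta] aJ] := AQ y Ay.
  have [|u [v E]] := model_onto aa ta.
    by move=> bt; have := sheet bt y Ay; rewrite -aJ (quadric_coordsK iJ).
  by exists (u, v) => //=; rewrite -E.
by apply: h; exists (model b u v) => //; have [] := model_quadric b u v.
Qed.

End Models.

(** * The Gauss map of a quadric *)

Section PositionLaplacian.
Variables (R : realType) (n s : nat).
Local Notation "<< x , y >>" := (@scal R n s x y) (at level 0, format "<< x ,  y >>").
Variables (U : set 'rV[R]_2) (X : 'rV[R]_2 -> 'rV[R]_n).
Hypothesis LP : lorentz_patch s U X.
Let oU := lp_open LP.
Let sX := lp_smooth LP.

Lemma partial_gmx a b l q : U q -> partial a (fun r => gmx s X r b l) q =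
  << vpartial a (vpartial b X) q, vpartial l X q >> + << vpartial b X q, vpartial a (vpartial l X) q >>.
Proof.
move=> Uq; rewrite -(partial_scal s oU a (smooth_vpartial oU b sX) (smooth_vpartial oU l sX) Uq).
by congr (partial a _ q); apply/funext => r; rewrite mxE.
Qed.

(** The covariant derivative of a coordinate field is the tangential part of
its derivative in the ambient space (the formula of Koszul). *)
Lemma chris_lower q a b e : U q -> \sum_k chris s X q k a b * gmx s X q k e =
  << vpartial a (vpartial b X) q, vpartial e X q >>.
Proof.
move=> Uq; pose c l := << vpartial a (vpartial b X) q, vpartial l X q >>.
have E k : chris s X q k a b = \sum_l c l * invmx (gmx s X q) l k.
  rewrite /chris mulr_sumr; apply: eq_bigr => l _.
  rewrite !(partial_gmx _ _ _ Uq) /c.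
  rewrite (vpartialC oU l a sX Uq) (vpartialC oU l b sX Uq) (vpartialC oU b a sX Uq).
  have -> : invmx (gmx s X q) k l = invmx (gmx s X q) l k.
    have sym : (gmx s X q)^T = gmx s X q by apply/matrixP => i j; rewrite !mxE scalC.
    by rewrite -[in LHS]sym -trmx_inv mxE.
  rewrite (scalC s (vpartial b X q)) (scalC s (vpartial a X q) (vpartial b (vpartial l X) q)).
  move: << vpartial a (vpartial b X) q, vpartial l X q >> << vpartial a (vpartial l X) q, vpartial b X q >>.
  by move: << vpartial b (vpartial l X) q, vpartial a X q >> (invmx _ l k) => *; field.
under eq_bigr do rewrite E.
transitivity (((\row_l c l) *m invmx (gmx s X q) *m gmx s X q) 0 e).
  by rewrite [RHS]mxE; apply: eq_bigr => k _; congr (_ * _); rewrite mxE; apply: eq_bigr => l _; rewrite mxE.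
by rewrite mulmxKV ?(gmx_unit LP Uq) // mxE.
Qed.

(** The vector of the Laplacians of the coordinates of [X]. *)
Definition position_laplacian q : 'rV[R]_n := - \sum_a \sum_b invmx (gmx s X q) a b *:
  (vpartial a (vpartial b X) q - \sum_k chris s X q k a b *: vpartial k X q).

Lemma scal_sum (I : Type) (r : seq I) (F : I -> 'rV[R]_n) y :
  << \sum_(i <- r) F i, y >> = \sum_(i <- r) << F i, y >>.
Proof. by elim/big_rec2 : _ => [|i u v _ <-]; rewrite ?scal0l ?scalDl. Qed.

Lemma position_laplacianE q y : << position_laplacian q, y >> =
  - \sum_a \sum_b invmx (gmx s X q) a b * (<< vpartial a (vpartial b X) q, y >>
     - \sum_k chris s X q k a b * << vpartial k X q, y >>).
Proof.
rewrite scalNl scal_sum; congr (- _); apply: eq_bigr => a _.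
rewrite scal_sum; apply: eq_bigr => b _; rewrite scalZl scalDl scalNl scal_sum.
by congr (_ * (_ - _)); apply: eq_bigr => k _; rewrite scalZl.
Qed.

Lemma position_laplacian_tangent q e : U q -> << position_laplacian q, vpartial e X q >> = 0.
Proof.
move=> Uq; rewrite position_laplacianE big1 ?oppr0 // => a _; rewrite big1 // => b _.
rewrite -(chris_lower a b e Uq).
rewrite [X in _ - X](eq_bigr (fun k => chris s X q k a b * gmx s X q k e)) ?subrr ?mulr0 //.
by move=> k _; rewrite [gmx _ _ _ _ _]mxE.
Qed.

(** The radial part of the second derivatives of [X] is minus the metric, whose
trace is 2. *)
Lemma position_laplacian_radial q : U q -> << position_laplacian q, X q >> = 2.
Proof.
move=> Uq.
have dXX c z : U z -> << vpartial c X z, X z >> = 0.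
  move=> Uz; have := partial_scal s oU c sX sX Uz.
  rewrite (eq_partial c oU (g := fun=> 1) (fun w Uw => lp_sphere LP Uw) Uz) partial_cst.
  by rewrite (scalC s (X z)); lra.
have h a b : << vpartial a (vpartial b X) q, X q >> = - gmx s X q b a.
  have := partial_scal s oU a (smooth_vpartial oU b sX) sX Uq.
  rewrite (eq_partial a oU (g := fun=> 0) (fun w Uw => dXX b w Uw) Uq) partial_cst mxE.
  by move/esym/eqP; rewrite addr_eq0 => /eqP.
rewrite position_laplacianE.
transitivity (\tr (invmx (gmx s X q) *m gmx s X q)); last first.
  by rewrite mulVmx ?(gmx_unit LP Uq) // mxtrace1.
rewrite -sumrN; apply: eq_bigr => a _; rewrite mxE -sumrN; apply: eq_bigr => b _.
rewrite h big1 ?subr0 ?mulrN ?opprK // => k _; rewrite (dXX k q Uq) mulr0 //.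
Qed.

Definition frame_area q := Num.sqrt (<< vpartial 0 X q, vpartial 1 X q >> ^+ 2 -
  << vpartial 0 X q, vpartial 0 X q >> * << vpartial 1 X q, vpartial 1 X q >>).

Lemma frame_area_gt0 q : U q -> 0 < frame_area q.
Proof. by move=> Uq; rewrite sqrtr_gt0 subr_gt0; exact: lp_det LP _ Uq. Qed.

Lemma smooth_frame_area : smooth_on U frame_area.
Proof.
have sd c := smooth_vpartial oU c sX; have sg c e := smooth_scal s oU (sd c) (sd e).
apply: smooth_sqrt => //; last exact: (smoothB oU (smoothM oU (sg 0 1) (sg 0 1)) (smoothM oU (sg 0 0) (sg 1 1))).
by move=> z Uz; rewrite subr_gt0; exact: lp_det LP _ Uz.
Qed.

End PositionLaplacian.

Section QuadricLaplacian.
Variables (R : realType) (b : bool).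
Local Notation t := (model_index b).
Local Notation eps := (model_sign R b).
Local Notation "<< x , y >>" := (@scal R 4 t x y) (at level 0, format "<< x ,  y >>").

Section Jet.
Variables (a : 'rV[R]_4) (d : 'I_2 -> 'rV[R]_4) (h : 'I_2 -> 'I_2 -> 'rV[R]_4).
Hypothesis QJ : quadric_jet b a d h.

Lemma trace_twist : \tr (twist_mx R b) = 0.
Proof.
rewrite /mxtrace sum4.
have tE i j : twist_mx R b i j = twist b (delta_mx 0 i) 0 j by rewrite mxE.
have [e0 _ _ _] := twistE b (delta_mx 0 0 : 'rV[R]_4).
have [_ e1 _ _] := twistE b (delta_mx 0 1 : 'rV[R]_4).
have [_ _ e2 _] := twistE b (delta_mx 0 2 : 'rV[R]_4).
have [_ _ _ e3] := twistE b (delta_mx 0 3 : 'rV[R]_4).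
rewrite !tE e0 e1 e2 e3 !mxE; case: (b) => /=; ring.
Qed.

(** The twist is traceless and exchanges position and normal, so its tangential
part is traceless: the surface is minimal. *)
Lemma jet_minimal (G : 'M[R]_2) : G \in unitmx -> (forall c e, G c e = << d c, d e >>) ->
  \sum_c \sum_e invmx G c e * << d c, twist b (d e) >> = 0.
Proof.
move=> uG GE; pose F := rows4 a (d 0) (d 1) (twist b a).
have uF : F \in unitmx.
  rewrite -row_full_unit -sub1mx; apply/row_subP => i.
  have [r0 [r1 E]] := jet_span QJ (row i 1%:M).
  pose w := row4 << row i 1%:M, a >> r0 r1 (eps * << row i 1%:M, twist b a >>).
  apply/submxP; exists w; rewrite mulmx_rows4 [LHS]E /w.
  by have [-> -> -> ->] := row4E << row i 1%:M, a >> r0 r1 (eps * << row i 1%:M, twist b a >>).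
have coef c : exists r0 r1, twist b (d c) = r0 *: d 0 + r1 *: d 1.
  have [r0 [r1 E]] := jet_span QJ (twist b (d c)); exists r0, r1; move: E.
  rewrite twistC (scalC t (d c)) (qj_td QJ) twist_isometry (scalC t (d c)) (qj_ad QJ).
  by rewrite !mulr0 !scale0r add0r addr0.
have [p0 [p1 E0]] := coef 0; have [q0 [q1 E1]] := coef 1.
(* The matrix of the twist in the basis [F]; its trace is [p0 + q1]. *)
pose S := rows4 (row4 0 0 0 1) (row4 0 p0 p1 0) (row4 0 q0 q1 0) (row4 eps 0 0 0).
have SE w : w *m S = row4 (w 0 3 * eps) (w 0 1 * p0 + w 0 2 * q0) (w 0 1 * p1 + w 0 2 * q1) (w 0 0).
  rewrite mulmx_rows4; apply/rowP => -[[|[|[|[|//]]]] hi]; rewrite !mxE !(tnth_nth 0) /=; ring.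
have FS : F *m twist_mx R b = S *m F.
  apply/row_matrixP => i; rewrite !rowE !mulmxA; move: (delta_mx 0 i) => w.
  rewrite -twist_mul SE !mulmx_rows4 !(twistD, twistZ) E0 E1 twistK.
  have [-> -> -> ->] := row4E (w 0 3 * eps) (w 0 1 * p0 + w 0 2 * q0) (w 0 1 * p1 + w 0 2 * q1) (w 0 0).
  apply/rowP => j; rewrite !mxE.
  move: (w 0 0) (w 0 1) (w 0 2) (w 0 3) (a 0 j) (d 0 0 j) (d 1 0 j) (twist b a 0 j) => *; ring.
have trS : p0 + q1 = 0.
  transitivity (\tr S).
    by rewrite /mxtrace sum4 !(mxE, tnth_nth 0) /= ?(mxE, tnth_nth 0) /=; ring.
  rewrite -trace_twist -(mulKmx uF (twist_mx R b)) FS mxtrace_mulC -mulmxA mulmxV // mulmx1 //.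
pose r (c : 'I_2) : 'I_2 -> R := fun k => if c == 0 then (if k == 0 then p0 else p1)
  else (if k == 0 then q0 else q1).
have rE c e : << d c, twist b (d e) >> = \sum_k r c k * G k e.
  rewrite -twistC sum2 !GE; have [-> | ->] := ord2 c; rewrite /r /= ?E0 ?E1 !(scalDl, scalZl) //.
rewrite -[RHS]trS; transitivity (\sum_c r c c); last by rewrite sum2.
apply: eq_bigr => c _; transitivity (\sum_k r c k * (G *m invmx G) k c); last first.
  rewrite mulmxV // (bigD1 c) //= big1 => [|k kc]; rewrite mxE ?eqxx ?mulr1 ?addr0 //.
  by rewrite (negbTE kc) mulr0.
have sG : G^T = G by apply/matrixP => i j; rewrite mxE !GE scalC.
have siG e : invmx G c e = invmx G e c by rewrite -[in LHS]sG -trmx_inv mxE.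
under eq_bigr do rewrite rE siG mulr_sumr.
rewrite exchange_big; apply: eq_bigr => k _; rewrite mxE mulr_sumr.
by apply: eq_bigr => e _; ring.
Qed.
End Jet.

(** The Hodge dual of [f ^ g ^ h] in the 4-space. The pairing of the trivector
with constant vectors becomes a linear function of it, by the formula of Cauchy
and Binet. *)
Definition cross (f g h : 'rV[R]_4) : 'rV[R]_4 :=
  row4 (- tri f g h 1 2 3) (tri f g h 0 2 3) (- eps * tri f g h 0 1 3) (- tri f g h 0 1 2).

Lemma cross_orth f g h : [/\ << cross f g h, f >> = 0, << cross f g h, g >> = 0 &
  << cross f g h, h >> = 0].
Proof.
rewrite !scal4E /cross.
have [-> -> -> ->] := row4E (- tri f g h 1 2 3) (tri f g h 0 2 3) (- eps * tri f g h 0 1 3)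
  (- tri f g h 0 1 2).
have := model_sign_sqr R b; rewrite /tri; move: eps.
move: (f 0 0) (f 0 1) (f 0 2) (f 0 3) (g 0 0) (g 0 1) (g 0 2) (g 0 3) (h 0 0) (h 0 1) (h 0 2) (h 0 3).
by move=> f0 f1 f2 f3 g0 g1 g2 g3 h0 h1 h2 h3 e ee; split; ring: ee.
Qed.

Lemma cross_norm f g h : << cross f g h, cross f g h >> = - eps * gram3 t f g h f g h.
Proof.
rewrite /gram3 !scal4E /cross.
have [-> -> -> ->] := row4E (- tri f g h 1 2 3) (tri f g h 0 2 3) (- eps * tri f g h 0 1 3)
  (- tri f g h 0 1 2).
have := model_sign_sqr R b; rewrite /tri; move: eps.
move: (f 0 0) (f 0 1) (f 0 2) (f 0 3) (g 0 0) (g 0 1) (g 0 2) (g 0 3) (h 0 0) (h 0 1) (h 0 2) (h 0 3).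
by move=> f0 f1 f2 f3 g0 g1 g2 g3 h0 h1 h2 h3 e ee; ring: ee.
Qed.

Definition cross_dual n (J : 'M[R]_(4, n)) i j l : 'rV[R]_4 :=
  let M u v w := tri (row u J) (row v J) (row w J) i j l in
  row4 (- M 1 2 3) (M 0 2 3) (- M 0 1 3) (M 0 1 2).

Lemma tri_cross n (J : 'M[R]_(4, n)) f g h i j l :
  tri (f *m J) (g *m J) (h *m J) i j l = << cross f g h, cross_dual J i j l >>.
Proof.
rewrite scal4E /cross /cross_dual.
have [-> -> -> ->] := row4E (- tri f g h 1 2 3) (tri f g h 0 2 3) (- eps * tri f g h 0 1 3)
  (- tri f g h 0 1 2).
set M := fun u v w => tri (row u J) (row v J) (row w J) i j l.
have [-> -> -> ->] := row4E (- M 1 2 3) (M 0 2 3) (- M 0 1 3) (M 0 1 2).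
have ME u v w : M u v w = tri (row u J) (row v J) (row w J) i j l by [].
rewrite !ME /tri !mxE !sum4.
have := model_sign_sqr R b; move: eps.
move: (f 0 0) (f 0 1) (f 0 2) (f 0 3) (g 0 0) (g 0 1) (g 0 2) (g 0 3) (h 0 0) (h 0 1) (h 0 2) (h 0 3).
move: (J 0 i) (J 1 i) (J 2 i) (J 3 i) (J 0 j) (J 1 j) (J 2 j) (J 3 j) (J 0 l) (J 1 l) (J 2 l) (J 3 l).
by do 24!move=> ?; move=> e ee; ring: ee.
Qed.

End QuadricLaplacian.

Section GaussMapOfQuadric.
Variables (R : realType) (n s : nat) (b : bool) (J : 'M[R]_(4, n)).
Hypothesis iJ : isometric_embedding s (model_index b) J.
Local Notation "<< x , y >>" := (@scal R n s x y) (at level 0, format "<< x ,  y >>").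
Local Notation t := (model_index b).
Local Notation eps := (model_sign R b).
Variables (U : set 'rV[R]_2) (X : 'rV[R]_2 -> 'rV[R]_n) (a : 'rV[R]_2 -> 'rV[R]_4).
Hypothesis QP : quadric_patch s b J U X a.
Let LP := qp_lorentz QP.
Let oU := lp_open LP.
Let sX := lp_smooth LP.
Let sa := qp_smooth QP.
Local Notation d c q := (vpartial c a q).
Local Notation nu q := (twist b (a q)).

(** The tangential part of the Laplacian vanishes for every surface, its radial
part is 2, and its normal part is the mean curvature, which vanishes by
[jet_minimal]. *)
Lemma quadric_position_laplacian q : U q -> position_laplacian s X q = 2 *: X q.
Proof.
move=> Uq; have QJ := patch_jet iJ QP Uq.
pose v := - \sum_c \sum_e invmx (gmx s X q) c e *: (vpartial c (vpartial e a) q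
  - \sum_k chris s X q k c e *: d k q).
have vE : position_laplacian s X q = v *m J.
  rewrite mulNmx mulmx_suml; congr (- _); apply: eq_bigr => c _.
  rewrite mulmx_suml; apply: eq_bigr => e _; rewrite -scalemxAl mulmxBl mulmx_suml.
  rewrite (patch_d2X QP c e Uq); congr (_ *: (_ - _)); apply: eq_bigr => k _.
  by rewrite -scalemxAl (patch_dX QP k Uq).
rewrite vE (qp_X QP Uq) scalemxAl; congr (_ *m J).
have vd c : scal t v (d c q) = 0.
  by rewrite -iJ -vE -(patch_dX QP c Uq); exact: (position_laplacian_tangent LP c Uq).
have va : scal t v (a q) = 2.
  by rewrite -iJ -vE -(qp_X QP Uq); exact: (position_laplacian_radial LP Uq).
have vn : scal t v (nu q) = 0.
  rewrite -iJ -vE position_laplacianE.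
  have GE c e : gmx s X q c e = scal t (d c q) (d e q).
    by rewrite mxE !(patch_dX QP _ Uq) iJ.
  rewrite -[RHS](jet_minimal QJ (gmx_unit LP Uq) GE) -sumrN; apply: eq_bigr => c _.
  rewrite -sumrN; apply: eq_bigr => e _; rewrite (patch_d2X QP c e Uq) iJ (qj_ht QJ).
  rewrite big1 ?subr0 ?mulrN ?opprK // => k _.
  by rewrite (patch_dX QP k Uq) iJ (scalC t (d k q)) (qj_td QJ) mulr0.
apply: (@scal_inj R 4 t) => y; have [r0 [r1 ->]] := jet_span QJ y.
rewrite !(scalDr, scalZr) va vn !vd !scalZl !(scalC t (a q) (d _ q)).
rewrite !(scalC t (d _ q)) !(qj_ad QJ) (qj_at QJ) (qj_aa QJ); ring.
Qed.

Let c_ q := cross b (a q) (d 0 q) (d 1 q).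

Let orientation q := (frame_area s X q)^-1 * scal t (c_ q) (nu q).

Let cross_normal q : U q -> c_ q = (eps * scal t (c_ q) (nu q)) *: nu q.
Proof.
move=> Uq; have QJ := patch_jet iJ QP Uq.
have [ca c0 c1] := cross_orth b (a q) (d 0 q) (d 1 q); rewrite -/(c_ q) in ca c0 c1.
have [r0 [r1 E]] := jet_span QJ (c_ q).
have [r00 r10] : r0 = 0 /\ r1 = 0.
  apply: (gram2_inj (qj_det QJ)).
    by rewrite -[RHS]c0 [in RHS]E !(scalDl, scalZl) (qj_ad QJ) (qj_td QJ) (scalC t (d 1 q) (d 0 q)); ring.
  by rewrite -[RHS]c1 [in RHS]E !(scalDl, scalZl) (qj_ad QJ) (qj_td QJ); ring.
by rewrite [LHS]E ca r00 r10 !scale0r !add0r.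
Qed.

Let orientation_sqr q : U q -> orientation q * orientation q = 1.
Proof.
move=> Uq; have QJ := patch_jet iJ QP Uq; have w0 := frame_area_gt0 LP Uq.
have h : scal t (c_ q) (nu q) ^+ 2 = frame_area s X q ^+ 2.
  have := cross_norm b (a q) (d 0 q) (d 1 q); rewrite -/(c_ q) {1 2}cross_normal //.
  rewrite scalZl scalZr (jet_twist_twist QJ) /gram3 (qj_aa QJ) !(scalC t (d _ q) (a q)) !(qj_ad QJ).
  rewrite sqr_sqrtr ?subr_ge0; last exact: ltW (lp_det LP Uq).
  rewrite !(patch_dX QP _ Uq) !iJ (scalC t (d 1 q) (d 0 q)).
  have ee := model_sign_sqr R b.
  move: (scal t (c_ q) (nu q)) (scal t (d 0 q) (d 0 q)) (scal t (d 0 q) (d 1 q)) (scal t (d 1 q) (d 1 q)).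
  move=> k g00 g01 g11 H; apply: (mulfI (model_sign_neq0 R b)); move: H ee; move: eps => e H ee.
  transitivity (e * k * (e * k * e)); first by ring: ee.
  by rewrite H; ring.
rewrite /orientation mulrACA -!expr2 h -exprMn mulVf ?expr1n // lt0r_neq0 //.
Qed.

Lemma ord4 (j : 'I_4) : [\/ j = 0, j = 1, j = 2 | j = 3].
Proof.
case: j => [[|[|[|[|//]]]] hj]; [constructor 1|constructor 2|constructor 3|constructor 4]; exact/val_inj.
Qed.

Lemma smooth_row4 p (V : set 'rV[R]_p) (f0 f1 f2 f3 : 'rV[R]_p -> R) : open V ->
  smooth_on V f0 -> smooth_on V f1 -> smooth_on V f2 -> smooth_on V f3 ->
  smooth_map_on V (fun r => row4 (f0 r) (f1 r) (f2 r) (f3 r)).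
Proof.
move=> oV h0 h1 h2 h3 j; have [] := ord4 j => ->.
- by apply: (smooth_eq oV _ h0) => z _; rewrite mxE (tnth_nth 0).
- by apply: (smooth_eq oV _ h1) => z _; rewrite mxE (tnth_nth 0).
- by apply: (smooth_eq oV _ h2) => z _; rewrite mxE (tnth_nth 0).
- by apply: (smooth_eq oV _ h3) => z _; rewrite mxE (tnth_nth 0).
Qed.

Let smooth_orientation : smooth_on U orientation.
Proof.
have sd c := smooth_vpartial oU c sa.
have st i j l := smooth_tri i j l oU sa (sd 0) (sd 1).
have sc : smooth_map_on U c_.
  exact: (smooth_row4 oU (smoothN oU (st 1 2 3)) (st 0 2 3)
    (smoothM oU (smooth_cst (- eps)) (st 0 1 3)) (smoothN oU (st 0 1 2))).
apply: (smoothM oU (smoothV oU _ (smooth_frame_area LP))).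
  by move=> z Uz; rewrite lt0r_neq0 // (frame_area_gt0 LP Uz).
exact: (smooth_scal t oU sc (smooth_twist QP sa)).
Qed.

Let orientation_cst c q : U q -> partial c orientation q = 0.
Proof.
move=> Uq; have := smooth_partialM c smooth_orientation smooth_orientation Uq.
rewrite (eq_partial c oU (g := fun=> 1) orientation_sqr Uq) partial_cst => /esym E.
have o0 : orientation q != 0.
  by apply/eqP => o0; have := orientation_sqr Uq; rewrite o0 mul0r => /esym/eqP; rewrite oner_eq0.
apply: (mulfI o0); rewrite mulr0; move: E; rewrite (mulrC (partial c orientation q)); lra.
Qed.

(** By duality the Gauss map is, up to the locally constant sign [orientation], a
linear image of the normal [twist b a *m J], hence of the position, and so has the
same eigenvalue. *)
Lemma quadric_gauss_eigen i j l q : U q ->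
  let F r := (frame_area s X r)^-1 * tri (X r) (vpartial 0 X r) (vpartial 1 X r) i j l in
  patch_laplacian s X F q = 2 * F q.
Proof.
move=> Uq F; pose Y := (eps *: twist b (cross_dual J i j l)) *m J.
have FE z : U z -> F z = orientation z * << X z, Y >>.
  move=> Uz; rewrite /F (qp_X QP Uz) !(patch_dX QP _ Uz) (tri_cross b) -/(c_ z).
  rewrite [X in scal _ X _](cross_normal Uz) iJ scalZl scalZr -(twistC b (a z)) /orientation; ring.
have P0 c z : U z -> partial c F z = orientation z * << vpartial c X z, Y >>.
  move=> Uz; rewrite (eq_partial c oU FE Uz).
  rewrite (smooth_partialM c smooth_orientation (smooth_scal_cst s oU Y sX) Uz).
  by rewrite (orientation_cst c Uz) mul0r add0r (partial_scal_cst s oU c Y sX Uz).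
have H0 c e : partial c (partial e F) q = orientation q * << vpartial c (vpartial e X) q, Y >>.
  rewrite (eq_partial c oU (P0 e) Uq).
  have sd := smooth_vpartial oU e sX.
  rewrite (smooth_partialM c smooth_orientation (smooth_scal_cst s oU Y sd) Uq).
  by rewrite (orientation_cst c Uq) mul0r add0r (partial_scal_cst s oU c Y sd Uq).
rewrite (patch_laplacianE s X (fun c => P0 c q Uq) H0) (FE q Uq).
transitivity (orientation q * << position_laplacian s X q, Y >>); last first.
  by rewrite quadric_position_laplacian // scalZl; ring.
rewrite position_laplacianE mulrN mulr_sumr; congr (- _); apply: eq_bigr => c _.
rewrite mulr_sumr; apply: eq_bigr => e _; rewrite mulrCA; congr (_ * _).
by rewrite [RHS]mulrBr mulr_sumr !sum2; ring.
Qed.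

End GaussMapOfQuadric.

(** * Isometries of the pseudo-sphere are locally linear *)

Section ChainRule.
Variable R : realType.

Lemma tangent_mapZ n p (G : 'rV[R]_n -> 'rV[R]_p) q c u :
  tangent_map G q (c *: u) = c *: tangent_map G q u.
Proof. by apply/rowP => j; rewrite !mxE linearZ. Qed.

Lemma diff_tangent_map n p (U : set 'rV[R]_n) (G : 'rV[R]_n -> 'rV[R]_p) q :
  open U -> smooth_map_on U G -> U q -> 'd G q = tangent_map G q :> (_ -> _).
Proof.
by move=> oU sG Uq; have [_ ->] := is_diff_coords oU (fun j => smooth_C1 (sG j)) Uq.
Qed.

Lemma tangent_map_delta n p (G : 'rV[R]_n -> 'rV[R]_p) q c :
  tangent_map G q (delta_mx 0 c) = vpartial c G q.
Proof.
apply/rowP => j; rewrite vpartialE mxE /gradient (bigD1 c) //= big1 => [|i ic].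
  by rewrite mxE !eqxx mul1r addr0.
by rewrite mxE eqxx (negbTE ic) mul0r.
Qed.

#[local] Transparent partial.
Lemma vpartial_comp n p k (U : set 'rV[R]_n) (V : set 'rV[R]_p) (F : 'rV[R]_p -> 'rV[R]_k)
    (G : 'rV[R]_n -> 'rV[R]_p) c q :
  open U -> open V -> smooth_map_on U G -> smooth_map_on V F -> U q -> V (G q) ->
  vpartial c (fun r => F (G r)) q = tangent_map F (G q) (vpartial c G q).
Proof.
move=> oU oV sG sF Uq VGq; apply/rowP => j; rewrite vpartialE mxE /gradient.
have [_ E] := @is_derive_comp R n p U V (fun z => F z 0 j) G c q oU oV
  (fun i => smooth_C1 (sG i)) (smooth_C1 (sF j)) Uq VGq.
rewrite /partial E; apply: eq_bigr => i _; by rewrite vpartialE.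
Qed.
#[local] Opaque partial.

Lemma smooth_map_comp n p k (U : set 'rV[R]_n) (V : set 'rV[R]_p) (F : 'rV[R]_p -> 'rV[R]_k)
    (G : 'rV[R]_n -> 'rV[R]_p) : open U -> open V -> smooth_map_on U G -> smooth_map_on V F ->
  (forall q, U q -> V (G q)) -> smooth_map_on U (fun r => F (G r)).
Proof. by move=> oU oV sG sF UV j; exact: (smooth_comp oU oV sG (sF j) UV). Qed.

End ChainRule.

Section SphereIsometries.
Variables (R : realType) (n s : nat).
Local Notation "<< x , y >>" := (@scal R n s x y) (at level 0, format "<< x ,  y >>").
Variables (Phi : 'rV[R]_n -> 'rV[R]_n) (V : set 'rV[R]_n).
Hypotheses (oV : open V) (sPhi : smooth_map_on V Phi) (SV : @pseudosphere R n s `<=` V).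
Hypothesis PhiS : forall p, pseudosphere s p -> << Phi p, Phi p >> = 1.
Hypothesis iso : forall p v w, << p, p >> = 1 -> << p, v >> = 0 -> << p, w >> = 0 ->
  << tangent_map Phi p v, tangent_map Phi p w >> = << v, w >>.

Let C : set 'rV[R]_n := [set y | 0 < << y, y >>].
Let rho (y : 'rV[R]_n) := Num.sqrt << y, y >>.
Let G (y : 'rV[R]_n) := (rho y)^-1 *: y.

(** The homogeneous extension of the isometry preserves the flat metric of the cone. *)
Let F y := rho y *: Phi (G y).

Let sid : smooth_map_on C (fun y : 'rV[R]_n => y).
Proof. by move=> j; exact: smooth_coord. Qed.

Let oC : open C.
Proof.
rewrite openE => y /= Cy.
have sidT : smooth_map_on [set: 'rV[R]_n] (fun z => z) by move=> j; exact: smooth_coord.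
have c := smooth_continuous (smooth_scal s openT sidT sidT) (I : [set: 'rV[R]_n] y).
move/cvgrPdist_lt: c => /(_ _ Cy); apply: filterS => z.
by rewrite /C /= ltr_norml => /andP[_]; rewrite ltrBlDr ltrDl.
Qed.

Let srho : smooth_on C rho.
Proof. exact: (smooth_sqrt oC (fun y Cy => Cy) (smooth_scal s oC sid sid)). Qed.

Let rho_gt0 y : C y -> 0 < rho y. Proof. by move=> Cy; rewrite sqrtr_gt0. Qed.

Let rho_neq0 y : C y -> rho y != 0. Proof. by move=> Cy; rewrite lt0r_neq0 // rho_gt0. Qed.

Let rho2 y : C y -> rho y * rho y = << y, y >>.
Proof. by move=> Cy; rewrite -expr2 sqr_sqrtr // ltW. Qed.

Let sG : smooth_map_on C G.
Proof. exact: (smoothvZ oC (smoothV oC rho_neq0 srho) sid). Qed.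

Let GS y : C y -> << G y, G y >> = 1.
Proof.
by move=> Cy; rewrite scalZl scalZr -(rho2 Cy); have := rho_neq0 Cy; move: (rho y) => r r0; field.
Qed.

Let sF : smooth_map_on C F.
Proof. exact: (smoothvZ oC srho (smooth_map_comp oC oV sG sPhi (fun y Cy => SV (GS Cy)))). Qed.

Let vpartial_id c y : C y -> vpartial c (fun z : 'rV[R]_n => z) y = delta_mx 0 c.
Proof. by move=> Cy; apply/rowP => j; rewrite vpartialE partial_coord mxE eqxx eq_sym. Qed.

Let drho c y : C y -> partial c rho y = << G y, delta_mx 0 c >>.
Proof.
move=> Cy; have := smooth_partialM c srho srho Cy.
rewrite (eq_partial c oC (g := fun z => << z, z >>) rho2 Cy) (partial_scal s oC c sid sid Cy).
rewrite (vpartial_id c Cy) (scalC s (delta_mx 0 c)) scalZl; have := rho_neq0 Cy.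
move: (partial c rho y) (rho y) << y, delta_mx 0 c >> => d r k r0 E.
by apply: (mulfI r0); rewrite mulVKf //; lra.
Qed.

Let dG c y : C y -> rho y *: vpartial c G y = delta_mx 0 c - << G y, delta_mx 0 c >> *: G y.
Proof.
move=> Cy; have := vpartialZ oC c srho sG Cy.
rewrite (eq_vpartial oC (g := fun z => z) c _ Cy); last first.
  by move=> z Cz; rewrite scalerA mulfV ?scale1r // rho_neq0.
rewrite (drho c Cy) (vpartial_id c Cy) => E.
by rewrite [X in _ = X - _]E [X in _ = X - _]addrC addrK.
Qed.

Let dF c y : C y -> vpartial c F y = << G y, delta_mx 0 c >> *: Phi (G y) +
  tangent_map Phi (G y) (delta_mx 0 c - << G y, delta_mx 0 c >> *: G y).
Proof.
move=> Cy; rewrite -(dG c Cy).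
rewrite (vpartialZ oC c srho (smooth_map_comp oC oV sG sPhi (fun y Cy => SV (GS Cy))) Cy).
rewrite (drho c Cy) (vpartial_comp c oC oV sG sPhi Cy (SV (GS Cy))).
by rewrite tangent_mapZ.
Qed.

Let tangential c y := delta_mx 0 c - << G y, delta_mx 0 c >> *: G y.

Let F_norm z : C z -> << F z, F z >> = << z, z >>.
Proof. by move=> Cz; rewrite scalZl scalZr PhiS ?mulr1 ?rho2 //; exact: GS. Qed.

Let F_dF c y : C y -> << F y, vpartial c F y >> = << y, delta_mx 0 c >>.
Proof.
move=> Cy; have := partial_scal s oC c sF sF Cy.
rewrite (eq_partial c oC F_norm Cy) (partial_scal s oC c sid sid Cy) (vpartial_id c Cy).
rewrite (scalC s (delta_mx 0 c)) (scalC s (vpartial c F y)); lra.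
Qed.

Let dPhi_normal c y : C y -> << Phi (G y), tangent_map Phi (G y) (tangential c y) >> = 0.
Proof.
move=> Cy; have := F_dF c Cy; rewrite (dF c Cy) -/(tangential c y) scalZl scalDr scalZr.
rewrite (PhiS (GS Cy)).
have -> : << y, delta_mx 0 c >> = rho y * << G y, delta_mx 0 c >>.
  by rewrite scalZl mulVKf // rho_neq0.
have := rho_neq0 Cy; move: (rho y) << G y, delta_mx 0 c >>.
move: << Phi (G y), tangent_map _ _ _ >> => d r k r0 H; apply: (mulfI r0); lra.
Qed.

Let dF_isometric c e y : C y ->
  << vpartial c F y, vpartial e F y >> = << delta_mx 0 c, delta_mx 0 e >>.
Proof.
move=> Cy; rewrite !(dF _ Cy).
have gg := GS Cy; have P1 := PhiS (GS Cy).
have := dPhi_normal e Cy; have := dPhi_normal c Cy; rewrite /tangential.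
move: (G y) gg P1 => g gg P1 Pc Pe.
have tg i : << g, delta_mx 0 i - << g, delta_mx 0 i >> *: g >> = 0.
  by rewrite scalDr scalNr scalZr gg; ring.
rewrite !(scalDl, scalDr, scalZl, scalZr) P1 Pe (scalC s (tangent_map Phi g _) (Phi g)) Pc.
rewrite (iso gg (tg c) (tg e)) !(scalDl, scalDr, scalNl, scalNr, scalZl, scalZr).
by rewrite gg (scalC s (delta_mx 0 c) g); ring.
Qed.

Lemma isometric_mx (A : 'M[R]_n) :
  (forall c e, << row c A, row e A >> = << delta_mx 0 c, delta_mx 0 e >>) ->
  forall y z, << y *m A, z *m A >> = << y, z >>.
Proof.
move=> h y z; rewrite [in RHS](row_sum_delta y) [in RHS](row_sum_delta z) !mulmx_sum_row.
rewrite !scal_sum; apply: eq_bigr => c _; rewrite !scalZl; congr (_ * _).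
rewrite scalC [RHS]scalC !scal_sum; apply: eq_bigr => e _; rewrite !scalZl.
by rewrite scalC h scalC.
Qed.

Lemma isometric_mx_unit (A : 'M[R]_n) : (forall y z, << y *m A, z *m A >> = << y, z >>) ->
  A \in unitmx.
Proof.
move=> h; rewrite -row_free_unit -kermx_eq0; apply/rowV0P => w /sub_kermxP wA.
by apply: (@scal_nondegenerate R n s) => y; rewrite -h wA scal0l.
Qed.

Let A y : 'M[R]_n := \matrix_c vpartial c F y.

Let A_isometric y : C y -> forall u v, << u *m A y, v *m A y >> = << u, v >>.
Proof. by move=> Cy; apply: isometric_mx => c e; rewrite !rowK; exact: dF_isometric. Qed.

Let dF_span y v : C y -> (forall e, << v, vpartial e F y >> = 0) -> v = 0.
Proof.
move=> Cy h; apply: (@scal_nondegenerate R n s) => u.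
rewrite -(mulmxKV (isometric_mx_unit (A_isometric Cy)) u) mulmx_sum_row scalC scal_sum big1 // => c _.
by rewrite scalZl rowK scalC h mulr0.
Qed.

(** The Christoffel argument: the product of [vpartial i (vpartial j F)] with
[vpartial k F] is symmetric in [i], [j] and skew in [j], [k], hence zero. *)
Let d2F c d y : C y -> vpartial d (vpartial c F) y = 0.
Proof.
move=> Cy; have sd i := smooth_vpartial oC i sF.
pose T i j k := << vpartial i (vpartial j F) y, vpartial k F y >>.
have Tsym i j k : T i j k = T j i k by rewrite /T (vpartialC oC i j sF Cy).
have Tskew i j k : T i j k = - T i k j.
  have := partial_scal s oC i (sd j) (sd k) Cy.
  rewrite (eq_partial i oC (fun z Cz => dF_isometric j k Cz) Cy) partial_cst => /esym/eqP.
  by rewrite addr_eq0 /T (scalC s (vpartial j F y)) => /eqP.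
apply: (dF_span Cy) => e; rewrite -/(T d c e).
have : T d c e = - T d c e.
  by rewrite {1}Tskew Tsym Tskew opprK Tsym Tskew -Tsym.
lra.
Qed.

Let F_euler y : C y -> F y = y *m A y.
Proof.
move=> Cy; apply/eqP; rewrite -subr_eq0; apply/eqP/(dF_span Cy) => e.
rewrite scalDl scalNl F_dF // -(rowK (fun c => vpartial c F y) e) rowE A_isometric ?subrr //.
Qed.

(** The homogeneous extension has constant derivative near the point; by
homogeneity it is linear there, and on the pseudo-sphere it is the isometry. *)
Lemma isometry_locally_linear p : << p, p >> = 1 -> exists2 B : 'M[R]_n,
  (forall u v, << u *m B, v *m B >> = << u, v >>) &
  \forall y \near p, << y, y >> = 1 -> Phi y = y *m B.
Proof.
move=> pp; have Cp : C p by rewrite /C /= pp.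
exists (A p); first exact: A_isometric.
have /nbhs_ballP[d /= d0 dC] : nbhs p C by exact: open_near oC Cp.
apply/nbhs_ballP; exists d => //= y py yy; have Cy := dC y py.
have rho1 : rho y = 1 by rewrite /rho yy sqrtr1.
have Gy : G y = y by rewrite /G rho1 invr1 scale1r.
have <- : F y = Phi y by rewrite /F rho1 scale1r Gy.
rewrite F_euler //; congr (_ *m _); apply/matrixP => c j; rewrite !mxE.
have sd := smooth_vpartial oC c sF.
apply: (constant_on_ball d0 dC (sd j) _ py) => i z Cz.
by rewrite -vpartialE (d2F c i Cz) mxE.
Qed.

End SphereIsometries.

(** * Charts *)

Local Notation chart := Defs.coord.

Section JacobianAlgebra.
Variable R : realType.

Lemma tangent_mapE n p (G : 'rV[R]_n -> 'rV[R]_p) q v :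
  tangent_map G q v = \sum_c v 0 c *: vpartial c G q.
Proof.
apply/rowP => j; rewrite mxE summxE /gradient; apply: eq_bigr => c _.
by rewrite mxE vpartialE.
Qed.

Lemma tangent_map_comp n p k (U : set 'rV[R]_n) (V : set 'rV[R]_p) (F : 'rV[R]_p -> 'rV[R]_k)
    (G : 'rV[R]_n -> 'rV[R]_p) q v :
  open U -> open V -> smooth_map_on U G -> smooth_map_on V F -> U q -> V (G q) ->
  tangent_map (fun r => F (G r)) q v = tangent_map F (G q) (tangent_map G q v).
Proof.
move=> oU oV sG sF Uq VGq; rewrite !tangent_mapE.
transitivity (\sum_c v 0 c *: \sum_e vpartial c G q 0 e *: vpartial e F (G q)).
  by apply: eq_bigr => c _; rewrite (vpartial_comp c oU oV sG sF Uq VGq) tangent_mapE.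
under eq_bigr do rewrite scaler_sumr.
rewrite exchange_big; apply: eq_bigr => e _; rewrite summxE scaler_suml.
by apply: eq_bigr => c _; rewrite mxE scalerA.
Qed.

Lemma eq_tangent_map n p (U : set 'rV[R]_n) (F G : 'rV[R]_n -> 'rV[R]_p) q v : open U ->
  (forall z, U z -> F z = G z) -> U q -> tangent_map F q v = tangent_map G q v.
Proof.
move=> oU E Uq; rewrite !tangent_mapE; apply: eq_bigr => c _.
by rewrite (eq_vpartial oU c E Uq).
Qed.

End JacobianAlgebra.

Section Charts.
Variables (R : realType) (M : surface R).

Definition chart_image (i : atlas M) := chart i @` dom i.

Lemma chart_imageP (i : atlas M) q : chart_image i q -> dom i (param i q) /\ chart i (param i q) = q.
Proof. by move=> [p dp <-]; rewrite coordK. Qed.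

Lemma transition_open (i j : atlas M) : open (chart i @` (dom i `&` dom j)).
Proof.
rewrite openE => _ [p [pi pj] <-]; rewrite /interior.
have Dq : chart_image i (chart i p) by exists p.
have oij : open (dom i `&` dom j) by exact: openI (dom_open i) (dom_open j).
have n1 : nbhs (chart i p) (param i @^-1` (dom i `&` dom j)).
  apply: (param_continuous Dq); apply: open_nbhs_nbhs; split=> //.
  by rewrite coordK.
have n2 := open_near (@coord_open R M i) Dq.
apply: filterS (filterI n1 n2) => r [[r1 r2] [p' p'i E]].
by exists p' => //; split=> //; move: r2; rewrite -E coordK.
Qed.

Lemma near_chart (i : atlas M) p (P : set M) : dom i p ->
  (\forall p' \near p, P p') <-> (\forall q \near chart i p, P (param i q)).
Proof.
move=> pi; have Dq : chart_image i (chart i p) by exists p.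
split=> h.
  by apply: (param_continuous Dq); rewrite coordK.
have n1 : nbhs p (chart i @^-1` [set q | P (param i q)]) := Defs.coord_continuous pi h.
have n2 : nbhs p (dom i) by apply: open_nbhs_nbhs; split=> //; exact: dom_open.
by apply: (filterS _ (filterI n1 n2)) => p' [] /= + p'i; rewrite coordK.
Qed.

End Charts.

Section ImmersedSurface.
Variables (R : realType) (n s : nat) (M : surface R) (x : M -> 'rV[R]_n).
Hypotheses (hx : immersed_in_pseudosphere s x) (hL : lorentzian s x).
Local Notation "<< x , y >>" := (@scal R n s x y) (at level 0, format "<< x ,  y >>").

Let oD (i : atlas M) : open (chart_image i) := @coord_open R M i.

Lemma smooth_local i : smooth_map_on (chart_image i) (local x i).
Proof. by have [_ + _] := hx; exact. Qed.

Lemma diff_local i q v : chart_image i q -> 'd (local x i) q v = tangent_map (local x i) q v.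
Proof. by move=> Dq; rewrite (diff_tangent_map (@oD i) (@smooth_local i) Dq). Qed.

(** The chain rule for the transition map. *)
Lemma change_chart i j p a : dom i p -> dom j p ->
  'd (local x j) (chart j p) a = tangent_map (local x i) (chart i p) (a *m 'J (chart i \o param j) (chart j p)).
Proof.
move=> pi pj; rewrite diff_local; last by exists p.
pose O := chart j @` (dom j `&` dom i).
have Oq : O (chart j p) by exists p.
have oO : open O := @transition_open R M j i.
have sT : smooth_map_on O (chart i \o param j) := @transition_smooth R M j i.
have E z : O z -> local x j z = local x i ((chart i \o param j) z).
  by move=> [p' [p'j p'i] <-]; rewrite /local /= !coordK.
have Dq : chart_image i ((chart i \o param j) (chart j p)) by rewrite /= coordK //; exists p.
rewrite (eq_tangent_map a oO E Oq) (tangent_map_comp a oO (@oD i) sT (@smooth_local i) Oq Dq).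
rewrite /= coordK //; congr (tangent_map _ _ _).
by rewrite -(diff_tangent_map oO sT Oq) /derive.jacobian mul_rV_lin1.
Qed.

Lemma oriented_tangent_chart i p e : dom i p -> oriented_basis x p e ->
  exists a1 a2 : 'rV[R]_2, [/\ 0 < a1 0 0 * a2 0 1 - a1 0 1 * a2 0 0,
    e.1 = tangent_map (local x i) (chart i p) a1 & e.2 = tangent_map (local x i) (chart i p) a2].
Proof.
move=> pi [j [a1 [a2 [pj ad -> ->]]]]; rewrite !(change_chart _ pi pj).
set T := derive.jacobian _ _; exists (a1 *m T), (a2 *m T); split=> //.
have : 0 < \det ((\matrix_(k < 2) tnth [tuple a1; a2] k) *m T).
  by rewrite det_mulmx mulr_gt0 //; apply: transition_oriented; exists p.
congr (0 < _); rewrite det2 !mxE !sum2 !mxE !(tnth_nth 0) /=; ring.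
Qed.

Lemma gram_change (y0 y1 : 'rV[R]_n) (a1 a2 : 'rV[R]_2) :
  let e1 := a1 0 0 *: y0 + a1 0 1 *: y1 in let e2 := a2 0 0 *: y0 + a2 0 1 *: y1 in
  << e1, e1 >> * << e2, e2 >> - << e1, e2 >> ^+ 2 =
  (a1 0 0 * a2 0 1 - a1 0 1 * a2 0 0) ^+ 2 * (<< y0, y0 >> * << y1, y1 >> - << y0, y1 >> ^+ 2).
Proof.
rewrite /= !(scalDl, scalDr, scalZl, scalZr) (scalC s y1 y0).
move: << y0, y0 >> << y0, y1 >> << y1, y1 >> (a1 0 0) (a1 0 1) (a2 0 0) (a2 0 1) => *; ring.
Qed.

Local Notation X i := (local x i).
Local Notation g00 i q := << vpartial 0 (X i) q, vpartial 0 (X i) q >>.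
Local Notation g01 i q := << vpartial 0 (X i) q, vpartial 1 (X i) q >>.
Local Notation g11 i q := << vpartial 1 (X i) q, vpartial 1 (X i) q >>.

Lemma tangent_map2 (F : 'rV[R]_2 -> 'rV[R]_n) q v :
  tangent_map F q v = v 0 0 *: vpartial 0 F q + v 0 1 *: vpartial 1 F q.
Proof. by rewrite tangent_mapE sum2. Qed.

Lemma chart_lorentz_basis i q : chart_image i q -> exists a1 a2 : 'rV[R]_2,
  [/\ << tangent_map (X i) q a1, tangent_map (X i) q a1 >> = 1,
      << tangent_map (X i) q a2, tangent_map (X i) q a2 >> = -1 &
      << tangent_map (X i) q a1, tangent_map (X i) q a2 >> = 0].
Proof.
move=> Dq; have [pi qE] := chart_imageP Dq.
have [e1 [e2 [t1 t2 h1 h2 h3]]] := hL (param i q).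
have tE e : tangent x (param i q) e -> exists a, e = tangent_map (X i) q a.
  move=> [j [b [pj E]]]; have F := etrans E (change_chart b pi pj); rewrite qE in F.
  by exists (b *m 'J (chart i \o param j) (chart j (param i q))).
by have [a1 E1] := tE _ t1; have [a2 E2] := tE _ t2; exists a1, a2; rewrite -E1 -E2.
Qed.

Lemma local_lorentz_patch i : lorentz_patch s (chart_image i) (X i).
Proof.
split; [exact: oD|exact: smooth_local| | |].
- by move=> q _; have [+ _ _] := hx; exact.
- move=> q Dq; have [a1 [a2 [h1 h2 h3]]] := chart_lorentz_basis Dq.
  have := gram_change (vpartial 0 (X i) q) (vpartial 1 (X i) q) a1 a2.
  rewrite /= -!tangent_map2 h1 h2 h3; have := sqr_ge0 (a1 0 0 * a2 0 1 - a1 0 1 * a2 0 0).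
  move: (_ ^+ 2) (g00 i q) (g11 i q) => d A B d0 E; rewrite -subr_lt0.
  have : d * (A * B - g01 i q ^+ 2) < 0 by rewrite -E; lra.
  by rewrite pmulr_rlt0 // lt0r d0 andbT; apply/eqP => d1; move: E; rewrite d1; lra.
- move=> q Dq; have [a1 [a2 [h1 _ _]]] := chart_lorentz_basis Dq.
  by exists (a1 0 0), (a1 0 1); rewrite -tangent_map2 h1.
Qed.

Lemma exists_oriented_basis i p : dom i p -> exists e, oriented_orthonormal_basis s x p e.
Proof.
move=> pi; have Dq : chart_image i (chart i p) by exists p.
have [a1 [a2 [h1 h2 h3]]] := chart_lorentz_basis Dq.
have d0 : a1 0 0 * a2 0 1 - a1 0 1 * a2 0 0 != 0.
  apply/eqP => d0; have := gram_change (vpartial 0 (X i) (chart i p)) (vpartial 1 (X i) (chart i p)) a1 a2.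
  by rewrite /= -!tangent_map2 h1 h2 h3 d0; lra.
pose e1 := tangent_map (X i) (chart i p) a1; pose e2 := tangent_map (X i) (chart i p) a2.
have basis (b1 b2 : 'rV[R]_2) : 0 < b1 0 0 * b2 0 1 - b1 0 1 * b2 0 0 ->
    oriented_basis x p (tangent_map (X i) (chart i p) b1, tangent_map (X i) (chart i p) b2).
  move=> b0; exists i, b1, b2; split=> //=; rewrite ?diff_local //.
  by rewrite det2 !mxE !(tnth_nth 0).
have [dp|dn] := ltP 0 (a1 0 0 * a2 0 1 - a1 0 1 * a2 0 0).
  by exists (e1, e2); split=> /=; [exact: basis|rewrite h1 normr1|rewrite h2 normrN1|].
exists (e2, e1); split=> /=; [|by rewrite h2 normrN1|by rewrite h1 normr1|by rewrite scalC].
apply: basis; rewrite lt_neqAle eq_sym in d0 dn *.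
by move: d0 dn; rewrite neq_lt => /orP[]; lra.
Qed.

(** The trivectors of two bases of the tangent plane differ by the determinant
of the change of basis. From an oriented orthonormal basis to the coordinate
frame it is positive, and its square is the ratio of the Gram determinants. *)
Lemma gauss_map_chart i q t : chart_image i q -> gauss_map s x (param i q) t =
  (frame_area s (X i) q)^-1 * tri (X i q) (vpartial 0 (X i) q) (vpartial 1 (X i) q)
    (tnth (val t) ord0) (tnth (val t) (lift ord0 ord0)) (tnth (val t) (lift ord0 (lift ord0 ord0))).
Proof.
move=> Dq; have [pi qE] := chart_imageP Dq.
have := xgetPex (0, 0) (exists_oriented_basis pi); rewrite /gauss_map.
move: (xget _ _) => e [eb n1 n2 n3]; rewrite wedge3E.
have [a1 [a2 [d0 E1 E2]]] := oriented_tangent_chart pi eb.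
move: n1 n2 n3; rewrite E1 E2 qE -/(X i q) !tangent_map2.
move: (tnth _ _) (tnth _ _) (tnth _ _) => j k l n1 n2 n3.
have G := gram_change (vpartial 0 (X i) q) (vpartial 1 (X i) q) a1 a2.
have w0 : 0 < frame_area s (X i) q.
  by rewrite sqrtr_gt0 subr_gt0; exact: (lp_det (local_lorentz_patch i) Dq).
have w2 : frame_area s (X i) q ^+ 2 = g01 i q ^+ 2 - g00 i q * g11 i q.
  by rewrite sqr_sqrtr // subr_ge0 ltW //; exact: (lp_det (local_lorentz_patch i) Dq).
have -> : (frame_area s (X i) q)^-1 = a1 0 0 * a2 0 1 - a1 0 1 * a2 0 0.
  move: G; rewrite /= n3 expr0n /= subr0.
  have -> : g00 i q * g11 i q - g01 i q ^+ 2 = - frame_area s (X i) q ^+ 2 by rewrite w2 opprB.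
  move=> G; have := congr1 Num.norm G; rewrite normrM n1 n2 mulr1 mulrN normrN -exprMn.
  rewrite ger0_norm ?sqr_ge0 // => /esym/eqP; rewrite sqrp_eq1; last by rewrite mulr_ge0 // ltW.
  by move/eqP => h; apply: (mulIf (lt0r_neq0 w0)); rewrite h mulVf // lt0r_neq0.
rewrite /tri !mxE -[x (param i q)]/(X i q).
move: (X i q 0 j) (X i q 0 k) (X i q 0 l) (vpartial 0 (X i) q 0 j) (vpartial 0 (X i) q 0 k)
  (vpartial 0 (X i) q 0 l) (vpartial 1 (X i) q 0 j) (vpartial 1 (X i) q 0 k) (vpartial 1 (X i) q 0 l).
by move: (a1 0 0) (a1 0 1) (a2 0 0) (a2 0 1) => *; ring.
Qed.

Lemma metric_gmx i q : chart_image i q -> metric s x i q = gmx s (X i) q.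
Proof.
by move=> Dq; apply/matrixP => a b; rewrite !mxE !diff_local // !tangent_map_delta.
Qed.

Lemma eq_patch_laplacian (U : set 'rV[R]_2) (Y : 'rV[R]_2 -> 'rV[R]_n) (F H : 'rV[R]_2 -> R) q : open U ->
  (forall z, U z -> F z = H z) -> U q -> patch_laplacian s Y F q = patch_laplacian s Y H q.
Proof.
move=> oU E Uq; have E1 b z : U z -> partial b F z = partial b H z.
  by move=> Uz; exact: (eq_partial b oU E Uz).
have E2 a b : partial a (partial b F) q = partial a (partial b H) q.
  exact: (eq_partial a oU (E1 b) Uq).
exact: (patch_laplacianE s Y (fun b => E1 b q Uq) E2).
Qed.

Lemma laplacian_chart f i q : chart_image i q ->
  laplacian s x f i (param i q) = patch_laplacian s (X i) (f \o param i) q.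
Proof.
move=> Dq; have [pi qE] := chart_imageP Dq; rewrite /laplacian qE /patch_laplacian.
congr (- _); apply: eq_bigr => a _; apply: eq_bigr => b _; rewrite (metric_gmx Dq).
congr (_ * _); rewrite /hessian; congr (_ - _); apply: eq_bigr => k _; congr (_ * _).
rewrite /christoffel /chris (metric_gmx Dq); congr (_ * _); apply: eq_bigr => l _; congr (_ * _).
have E c d e : partial c (fun r => metric s x i r d e) q = partial c (fun r => gmx s (X i) r d e) q.
  by apply: (eq_partial c (@oD i) _ Dq) => z Dz; rewrite metric_gmx.
by rewrite !E.
Qed.

(** The components are needed for all index triples, since contractions run
over all of them; those outside the increasing triples follow by antisymmetry.
*)
Definition gauss_component i j k l q := (frame_area s (X i) q)^-1 *
  tri (X i q) (vpartial 0 (X i) q) (vpartial 1 (X i) q) j k l.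

Lemma eigenmap_chart lam : laplacian_eigenmap s x (gauss_map s x) lam <->
  forall i q (t : triple n), chart_image i q ->
    let F := gauss_component i (tnth (val t) ord0) (tnth (val t) (lift ord0 ord0))
      (tnth (val t) (lift ord0 (lift ord0 ord0))) in
    patch_laplacian s (X i) F q = lam * F q.
Proof.
have E i q (t : triple n) : chart_image i q ->
    laplacian s x (fun r => gauss_map s x r t) i (param i q) =
    patch_laplacian s (X i) (gauss_component i (tnth (val t) ord0) (tnth (val t) (lift ord0 ord0))
      (tnth (val t) (lift ord0 (lift ord0 ord0)))) q.
  move=> Dq; rewrite laplacian_chart //.
  by apply: (eq_patch_laplacian (X i) (@oD i) _ Dq) => z Dz; exact: gauss_map_chart.
split=> h i => [q t Dq F|p pi t].
  have [pi _] := chart_imageP Dq; rewrite -(E i q t Dq) (h i _ pi t).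
  by rewrite (gauss_map_chart t Dq).
have Dq : chart_image i (chart i p) by exists p.
have := h i _ t Dq; rewrite /= -(E i _ t Dq) coordK // => ->.
by rewrite /gauss_component -(gauss_map_chart t Dq) coordK.
Qed.

Lemma smooth_gauss_component i j k l : smooth_on (chart_image i) (gauss_component i j k l).
Proof.
have LP := local_lorentz_patch i.
have sd c := smooth_vpartial (@oD i) c (@smooth_local i).
have a0 q : chart_image i q -> frame_area s (X i) q != 0.
  by move=> Dq; rewrite lt0r_neq0 // (frame_area_gt0 LP Dq).
exact: (smoothM (@oD i) (smoothV (@oD i) a0 (smooth_frame_area LP))
  (smooth_tri j k l (@oD i) (@smooth_local i) (sd 0) (sd 1))).
Qed.

Lemma alternating_triples (E : 'I_n -> 'I_n -> 'I_n -> Prop) :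
  (forall j k l : 'I_n, (j < k < l)%N -> E j k l) -> (forall j k l, E j k l -> E k j l) ->
  (forall j k l, E j k l -> E j l k) -> (forall j l, E j j l) -> forall j k l, E j k l.
Proof.
move=> h s1 s2 d j k l.
have d2 a b : E a b b by apply/s1/s2/d.
have d3 a b : E a b a by apply/s2/d.
have [jk|kj|/ord_inj ->] := ltngtP j k; last exact: d.
- have [kl|lk|/ord_inj ->] := ltngtP k l; last exact: d2.
    by apply: h; rewrite jk.
  have [jl|lj|/ord_inj ->] := ltngtP j l; last exact: d3.
    by apply/s2/h; rewrite jl.
  by apply/s2/s1/h; rewrite lj.
- have [jl|lj|/ord_inj ->] := ltngtP j l; last exact: d3.
    by apply/s1/h; rewrite kj.
  have [kl|lk|/ord_inj ->] := ltngtP k l; last exact: d2.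
    by apply/s1/s2/h; rewrite kl.
  by apply/s1/s2/s1/h; rewrite lk.
Qed.

Lemma patch_laplacianZ (U : set 'rV[R]_2) (Y : 'rV[R]_2 -> 'rV[R]_n) c F q : open U -> smooth_on U F -> U q ->
  patch_laplacian s Y (fun r => c * F r) q = c * patch_laplacian s Y F q.
Proof.
move=> oU sF Uq; have E1 b z : U z -> partial b (fun r => c * F r) z = c * partial b F z.
  by move=> Uz; exact: smooth_partialZ sF Uz.
have E2 a b : partial a (partial b (fun r => c * F r)) q = c * partial a (partial b F) q.
  by rewrite (eq_partial a oU (E1 b) Uq); exact: (smooth_partialZ c a (smooth_partial b sF) Uq).
rewrite (patch_laplacianE s Y (fun b => E1 b q Uq) E2) /patch_laplacian mulrN mulr_sumr.
congr (- _); apply: eq_bigr => a _; rewrite mulr_sumr; apply: eq_bigr => b _.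
rewrite mulrCA; congr (_ * _); rewrite [RHS]mulrBr mulr_sumr; congr (_ + - _).
by apply: eq_bigr => k _; rewrite mulrCA.
Qed.

Lemma eigenmap_component lam i q j k l : laplacian_eigenmap s x (gauss_map s x) lam ->
  chart_image i q -> patch_laplacian s (X i) (gauss_component i j k l) q = lam * gauss_component i j k l q.
Proof.
move=> /eigenmap_chart h Dq.
pose E j k l := patch_laplacian s (X i) (gauss_component i j k l) q = lam * gauss_component i j k l q.
have scaled c j' k' l' j2 k2 l2 : (forall r, gauss_component i j' k' l' r = c * gauss_component i j2 k2 l2 r) ->
    E j2 k2 l2 -> E j' k' l'.
  move=> e; rewrite /E; have -> : gauss_component i j' k' l' = fun r => c * gauss_component i j2 k2 l2 r.
    exact/funext.
  rewrite (patch_laplacianZ (X i) c (@oD i) (smooth_gauss_component j2 k2 l2) Dq) => ->; ring.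
suff hE : forall j k l, E j k l by exact: hE.
apply: alternating_triples => {j k l} [j k l jkl|j k l|j k l|j l].
- have st : sorted ltn (map val [tuple j; k; l]) by rewrite /= andbT.
  by have := h i q (Sub [tuple j; k; l] st : triple n) Dq.
- by apply: (scaled (-1)) => r; rewrite /gauss_component /tri; ring.
- by apply: (scaled (-1)) => r; rewrite /gauss_component /tri; ring.
- have z r : gauss_component i j j l r = 0 by rewrite /gauss_component /tri; ring.
  have e : gauss_component i j j l = fun r => 0 * gauss_component i j j l r.
    by apply/funext => r; rewrite z mul0r.
  rewrite /E z mulr0 e (patch_laplacianZ (X i) 0 (@oD i) (smooth_gauss_component j j l) Dq).
  by rewrite mul0r.
Qed.

(** By [nf_area], the bivector of the coordinate frame is a negative multiple
of the one of the null frame. *)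
Lemma gauss_component_null i U l1 l2 j k l q : U `<=` chart_image i -> null_frame s U (X i) l1 l2 ->
  U q -> gauss_component i j k l q = - 1 * tri (X i q) (l1 q) (l2 q) j k l.
Proof.
move=> UD NF Uq; have LP := local_lorentz_patch i; have w0 := frame_area_gt0 LP (UD _ Uq).
have [[[xx x1 x2] [k1 k2 k3]] [m1 m2 m3]] := frame_scal NF Uq.
have ar : area s (X i) l1 l2 q = - frame_area s (X i) q.
  have an := nf_area NF Uq; rewrite thetaE thetaE phiE phiE -/(area s (X i) l1 l2 q) in an.
  apply/eqP; rewrite -eqr_opp opprK -(eqrXn2 (n := 2)) //; last 2 first.
  - by rewrite oppr_ge0 ltW.
  - exact: ltW.
  rewrite sqr_sqrtr; last by rewrite subr_ge0 ltW // (lp_det LP (UD _ Uq)).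
  rewrite (dX_frame NF 0 Uq) (dX_frame NF 1 Uq) /area.
  rewrite !(scalDl, scalDr, scalZl, scalZr) k2 k3 m2 m3; apply/eqP.
  move: (theta _ _ _ 0 q) (theta _ _ _ 1 q) (phi _ _ _ 0 q) (phi _ _ _ 1 q) => *; ring.
rewrite /gauss_component (dX_frame NF 0 Uq) (dX_frame NF 1 Uq).
have w := lt0r_neq0 w0; apply: (mulfI w); rewrite mulVKf //.
transitivity (area s (X i) l1 l2 q * tri (X i q) (l1 q) (l2 q) j k l); last by rewrite ar; ring.
rewrite /area /tri !mxE.
move: (theta _ _ _ 0 q) (theta _ _ _ 1 q) (phi _ _ _ 0 q) (phi _ _ _ 1 q) => *; ring.
Qed.

Lemma eigenmap_null_frame lam i U l1 l2 : laplacian_eigenmap s x (gauss_map s x) lam ->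
  U `<=` chart_image i -> null_frame s U (X i) l1 l2 -> forall q j k l, U q ->
  patch_laplacian s (X i) (fun r => tri (X i r) (l1 r) (l2 r) j k l) q =
  lam * tri (X i q) (l1 q) (l2 q) j k l.
Proof.
move=> h UD NF q j k l Uq; have oU := nf_open NF.
have := eigenmap_component j k l h (UD _ Uq).
have st := smooth_tri j k l oU (nf_sX NF) (nf_s1 NF) (nf_s2 NF).
have E z : U z -> gauss_component i j k l z = - 1 * tri (X i z) (l1 z) (l2 z) j k l.
  exact: gauss_component_null.
rewrite (eq_patch_laplacian (X i) oU E Uq) (patch_laplacianZ (X i) (-1) oU st Uq) (E q Uq); lra.
Qed.

End ImmersedSurface.

(** * The classification *)

Section Classification.
Variables (R : realType) (n s : nat) (M : surface R) (x : M -> 'rV[R]_n).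
Hypotheses (hx : immersed_in_pseudosphere s x) (hL : lorentzian s x).
Local Notation "<< x , y >>" := (@scal R n s x y) (at level 0, format "<< x ,  y >>").

Lemma clopen_full (A : set M) : A !=set0 -> open A -> closed A -> A = setT.
Proof.
move=> A0 oA cA; apply: (surface_connected (s := M)) => //.
  by exists A => //; rewrite setTI.
by exists A => //; rewrite setTI.
Qed.

Lemma point_chart (p : M) : exists2 i, dom i p & chart_image i (chart i p).
Proof. by have [i di] := dom_cover p; exists i => //; exists p. Qed.

Lemma near_quadric_chart i p b (J : 'M[R]_(4, n)) : dom i p ->
  (\forall p' \near p, quadric b J (x p')) <-> (\forall q \near chart i p, quadric b J (local x i q)).
Proof. exact: (@near_chart R M i p (fun p' => quadric b J (x p'))). Qed.

Lemma eigen_locally_quadric (p : M) : nonharmonic_one_type s x (gauss_map s x) ->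
  exists b (J : 'M[R]_(4, n)), isometric_embedding s (model_index b) J /\
    \forall p' \near p, quadric b J (x p').
Proof.
move=> [lam l0 eig]; have [i di Dq] := point_chart p.
have [b [J [iJ nQ]]] := eigen_quadric (local_lorentz_patch hx hL i) l0 Dq
  (fun U l1 l2 UD NF => eigenmap_null_frame hx hL eig UD NF).
by exists b, J; split=> //; apply/(near_quadric_chart b J di).
Qed.

Lemma quadric_unique_at (p : M) b b' (J J' : 'M[R]_(4, n)) :
  isometric_embedding s (model_index b) J -> isometric_embedding s (model_index b') J' ->
  (\forall p' \near p, quadric b J (x p')) -> (\forall p' \near p, quadric b' J' (x p')) ->
  b = b' /\ quadric b J = quadric b' J'.
Proof.
move=> iJ iJ' h h'; have [i di Dq] := point_chart p.
exact: (quadric_unique iJ iJ' (local_lorentz_patch hx hL i) Dq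
  (proj1 (near_quadric_chart b J di) h) (proj1 (near_quadric_chart b' J' di) h')).
Qed.

(** The set of points near which the surface lies in a given quadric is open;
it is closed because the quadric is unique near every point. As the surface is
connected, one quadric contains it. *)
Lemma eigen_quadric_global : nonharmonic_one_type s x (gauss_map s x) ->
  exists b (J : 'M[R]_(4, n)), isometric_embedding s (model_index b) J /\
    forall p, quadric b J (x p).
Proof.
move=> eig; have [p0 _] := surface_nonempty M.
have [b [J [iJ h0]]] := eigen_locally_quadric p0 eig.
exists b, J; split=> // p; pose A := [set p | quadric b J (x p)]^°.
suff AT : A = setT by have : A p by [rewrite AT]; move=> /interior_subset.
apply: clopen_full; [by exists p0|exact: open_interior|].
move=> p1 cl; have [b1 [J1 [iJ1 h1]]] := eigen_locally_quadric p1 eig.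
have n1 : nbhs p1 ([set p | quadric b1 J1 (x p)]^°).
  by apply: open_nbhs_nbhs; split=> //; exact: open_interior.
have [p2 [Ap2 Bp2]] := cl _ n1.
have [_ E] := quadric_unique_at iJ iJ1 Ap2 Bp2.
by rewrite /A E.
Qed.

Lemma range_open_in_quadric b (J : 'M[R]_(4, n)) (p : M) : isometric_embedding s (model_index b) J ->
  (forall p, quadric b J (x p)) -> \forall y \near x p, quadric b J y -> range x y.
Proof.
move=> iJ Q; have [i di Dq] := point_chart p; have LP := local_lorentz_patch hx hL i.
have nQ : \forall q \near chart i p, quadric b J (local x i q).
  by apply: filterS (open_near (@coord_open R M i) Dq) => q _; exact: Q.
have nD := open_near (@coord_open R M i) Dq.
have := quadric_image_open iJ LP Dq nQ nD; rewrite /local /= coordK //.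
apply: filterS => y h Qy; have [q _ <-] := h Qy.
by exists (param i q).
Qed.

Lemma immersion_continuous : continuous x.
Proof.
move=> p; have [i di Dq] := point_chart p.
have cX := smooth_map_continuous (@coord_open R M i) (smooth_local hx (i := i)) Dq.
move=> A; rewrite -{1}(coordK di) => nA.
have := cX A nA => h; apply/(near_chart (fun p' => A (x p')) di).
exact: h.
Qed.

(** On the first quadric the third coordinate has no zero, and the surface is
connected. *)
Lemma sheet_sign (J : 'M[R]_(4, n)) : isometric_embedding s 1 J ->
  (forall p, quadric true J (x p)) ->
  (forall p, 0 < quadric_coords s true J (x p) 0 2) \/ (forall p, quadric_coords s true J (x p) 0 2 < 0).
Proof.
move=> iJ Q; pose f (p : M) : R := quadric_coords s true J (x p) 0 2.
have f0 p : f p != 0.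
  have [a [aa ta] aE] := Q p; rewrite /f -aE (@quadric_coordsK _ n s true J iJ).
  move: aa ta; rewrite scal_twist scal4E /model_sign => aa ta; apply/eqP => a0.
  by move: aa ta; rewrite a0; have := sqr_ge0 (a 0 3); lra.
have cf : continuous f.
  have fE : f = (fun y => quadric_coords s true J y 0 2) \o x by [].
  have c2 : continuous (fun y => quadric_coords s true J y 0 2).
    have sid : smooth_map_on [set: 'rV[R]_n] (fun z => z) by move=> j; exact: smooth_coord.
    by move=> y; exact: (smooth_continuous (smooth_quadric_coords s true J openT sid 2) I).
  by move=> p; rewrite fE; apply: continuous_comp; [exact: immersion_continuous|exact: c2].
pose A := [set p | 0 < f p].
have oA : open A by have /continuousP h := cf; exact: (h _ (@open_gt R 0)).
have [A0|A0] := pselect (A !=set0).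
  left=> p; have AT : A = setT.
    apply: clopen_full => //; rewrite (_ : A = [set p | 0 <= f p]).
      by have /continuous_closedP h := cf; exact: (h _ (@closed_ge R 0)).
    by apply/seteqP; split=> q /=; [exact: ltW|rewrite le_eqVlt eq_sym (negbTE (f0 q))].
  by have : A p by rewrite AT.
right=> p; have := f0 p; rewrite neq_lt => /orP[//|h].
by case: A0; exists p.
Qed.

Lemma id_isometry : @pseudosphere_isometry R n s id.
Proof.
exists setT, id; split=> //.
- by split; [exact: openT|].
- by split=> j; exact: smooth_coord.
- by move=> p v w _ _ _; rewrite (_ : 'd id p = id :> ('rV[R]_n -> 'rV[R]_n)) ?diff_val.
Qed.

Lemma eigen_congruent : nonharmonic_one_type s x (gauss_map s x) ->
  exists b, congruent_to_open_part s (model_index b) (model b) (range x).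
Proof.
move=> eig; have [b [J0 [iJ0 Q0]]] := eigen_quadric_global eig; exists b.
have [J [iJ Q sheet]] : exists J : 'M[R]_(4, n), [/\ isometric_embedding s (model_index b) J,
    forall p, quadric b J (x p) & b -> forall p, 0 < quadric_coords s b J (x p) 0 2].
  case: b iJ0 Q0 => iJ0 Q0; last by exists J0.
  have [h|h] := sheet_sign iJ0 Q0; first by exists J0.
  exists (sheet_flip R *m J0); have iJ := sheet_flip_isometric iJ0.
  split=> // [p|_ p]; first by rewrite quadric_sheet_flip.
  have := h p; have := Q0 p; rewrite -quadric_sheet_flip => -[a _ <-].
  rewrite (@quadric_coordsK _ n s true _ iJ) mulmxA (@quadric_coordsK _ n s true _ iJ0).
  have [_ _ e2 _] := row4E (a 0 0) (a 0 1) (- a 0 2) (a 0 3).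
  by rewrite sheet_flipE e2 oppr_lt0.
have [W oW E] : exists2 W, open W & range x = [set model b w.1 w.2 *m J | w in [set: R * R]] `&` W.
  apply: (open_part_of_model iJ).
  - by move=> _ [p _ <-].
  - by move=> _ [p _ <-]; exact: range_open_in_quadric.
  - by move=> bt _ [p _ <-]; exact: sheet.
exists J, id, W; split=> //; first exact: id_isometry.
by rewrite image_id.
Qed.

(** The congruence is linear near every point, so it carries the quadric of the
model back to a quadric. *)
Lemma congruent_locally_quadric b (p : M) : congruent_to_open_part s (model_index b) (model b) (range x) ->
  exists2 J : 'M[R]_(4, n), isometric_embedding s (model_index b) J &
    \forall p' \near p, quadric b J (x p').
Proof.
move=> [J [Phi [W [iJ [V [Psi [[oV SV] [sPhi _] SPhi _ iso]]] _ E]]]].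
have xS p' : pseudosphere s (x p') by have [h _ _] := hx; exact: h.
have iso' z v w : << z, z >> = 1 -> << z, v >> = 0 -> << z, w >> = 0 ->
    << tangent_map Phi z v, tangent_map Phi z w >> = << v, w >>.
  by move=> zz zv zw; rewrite -(diff_tangent_map oV sPhi (SV _ zz)); exact: iso.
have [B iB nB] := isometry_locally_linear oV sPhi SV (fun z Sz => (SPhi z Sz).1) iso' (xS p).
have uB := isometric_mx_unit iB; exists (J *m invmx B).
  by move=> a c; rewrite -iB !mulmxA !mulmxKV // iJ.
have n2 : nbhs p (x @^-1` [set y | << y, y >> = 1 -> Phi y = y *m B]) := immersion_continuous nB.
apply: (filterS _ n2) => p' /= h.
have : ([set model b w.1 w.2 *m J | w in [set: R * R]] `&` W) (Phi (x p')).
  by rewrite -E; exists (x p') => //; exists p'.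
move=> [[w _ wE] _]; have [m1 m2 _] := model_quadric b w.1 w.2.
exists (model b w.1 w.2) => //; rewrite mulmxA wE h ?mulmxK //; exact: xS.
Qed.

Lemma congruent_eigen b : congruent_to_open_part s (model_index b) (model b) (range x) ->
  nonharmonic_one_type s x (gauss_map s x).
Proof.
move=> C; exists 2; first by rewrite pnatr_eq0.
apply/(eigenmap_chart hx hL) => i q t Dq; have [di qE] := chart_imageP Dq.
have [J iJ nQ] := congruent_locally_quadric (param i q) C.
move/(near_quadric_chart b J di): nQ; rewrite qE => nQ.
have [U [Uq UD QP]] := exists_quadric_patch iJ (local_lorentz_patch hx hL i) Dq nQ.
exact: (quadric_gauss_eigen iJ QP).
Qed.

End Classification.

Theorem theorem5 (R : realType) (m s : nat) (hs : (s <= m)%N)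
    (M : surface R) (x : M -> 'rV[R]_m.+1)
    (hx : immersed_in_pseudosphere s x) (hL : lorentzian s x) :
  nonharmonic_one_type s x (gauss_map s x) <->
  congruent_to_open_part s 1 (@model1 R) (range x) \/
  congruent_to_open_part s 2 (@model2 R) (range x).
Proof.
split=> [/(eigen_congruent hx hL)[[]]|[]]; [by left|by right| |].
  exact: (@congruent_eigen _ _ _ _ _ hx hL true).
exact: (@congruent_eigen _ _ _ _ _ hx hL false).
Qed.
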